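(* The monoid variety $\mathbf S=\mathbf A_0\vee\mathbf R_2\vee\overleftarrow{\mathbf R_2}$ is a non-finitely based, finitely generated almost Cross variety.
   Context: All varieties are varieties of monoids; $\vee$ is the join in the lattice of monoid varieties, and $\mathbf V\Sigma$ denotes the subvariety of $\mathbf V$ defined within $\mathbf V$ by the identities $\Sigma$. $\overleftarrow{\mathbf V}$ denotes the dual of $\mathbf V$: the variety of all monoids anti-isomorphic to members of $\mathbf V$. A variety is finitely based if it can be defined by finitely many identities, finitely generated if it is generated by a single finite monoid, and small if its lattice of subvarieties is finite. A variety is Cross if it is finitely based, finitely generated and small; it is almost Cross if it is not Cross but every proper subvariety of it is Cross. In presentations below, $0$ is a zero element and ''$\cup\{1\}$'' means adjoining an identity element to the semigroup so presented. $\mathbf A_0$ is the variety generated by the monoid $A_0=\langle a,b\mid a^2=a,\ b^2=b,\ ba=0\rangle\cup\{1\}=\{a,b,ab,0,1\}$. $\mathbf E$ is the variety generated by the monoid $E=\langle a,b,c\mid a^2=ab=0,\ ba=ca=a,\ b^2=bc=b,\ c^2=cb=c\rangle\cup\{1\}=\{a,b,c,ac,0,1\}$; one has $\mathbf E=\operatorname{var}\{xyx\approx x^2yx\approx xyx^2,\ xy^2x\approx x^2y^2\}$. Then $\mathbf R_2=\mathbf E\{yt_2xt_1xy\approx yt_2xt_1yx\}$. *)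

(* Defs.v *)
From HB Require Import structures.
From mathcomp Require Import all_boot.
From mathcomp Require Import boolp.

Set Implicit Arguments.
Unset Strict Implicit.
Unset Printing Implicit Defensive.

Local Open Scope group_scope.

(* The choice structure included in [monoidType] is no restriction: by the
   axioms of boolp every type carries one. *)

Section DirectProduct.
Variables (I : Type) (F : I -> monoidType).

Definition dprod_monoid : Type := forall i, F i.

HB.instance Definition _ := gen_eqMixin dprod_monoid.
HB.instance Definition _ := gen_choiceMixin dprod_monoid.

Definition dprod_mul (x y : dprod_monoid) : dprod_monoid := fun i => x i * y i.
Definition dprod_one : dprod_monoid := fun i => 1.

Fact dprod_mulA : associative dprod_mul.
Proof. by move=> x y z; apply: functional_extensionality_dep => i; exact: mulgA. Qed.
Fact dprod_mul1 : left_id dprod_one dprod_mul.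
Proof. by move=> x; apply: functional_extensionality_dep => i; exact: mul1g. Qed.
Fact dprod_mulr1 : right_id dprod_one dprod_mul.
Proof. by move=> x; apply: functional_extensionality_dep => i; exact: mulg1. Qed.

HB.instance Definition _ :=
  isMonoid.Build dprod_monoid dprod_mulA dprod_mul1 dprod_mulr1.
End DirectProduct.

Section OppositeMonoid.
Variable M : monoidType.

Definition opp_monoid : Type := M.

HB.instance Definition _ := Choice.on opp_monoid.

Definition opp_mul (x y : opp_monoid) : opp_monoid := (y : M) * (x : M).

Fact opp_mulA : associative opp_mul.
Proof. by move=> x y z; rewrite /opp_mul mulgA. Qed.
Fact opp_mul1 : left_id (1 : M) opp_mul.
Proof. by move=> x; exact: mulg1. Qed.
Fact opp_mulr1 : right_id (1 : M) opp_mul.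
Proof. by move=> x; exact: mul1g. Qed.

HB.instance Definition _ :=
  isMonoid.Build opp_monoid opp_mulA opp_mul1 opp_mulr1.
End OppositeMonoid.

Definition anti_isomorphic (M N : monoidType) : Prop :=
  exists f : M -> N,
    [/\ bijective f, f 1 = 1 & forall x y, f (x * y) = f y * f x].

(* A variety: a class of monoids closed under submonoids, homomorphic images
   and direct products, hence also under isomorphism.  The empty product puts
   the trivial monoid in every variety. *)
Record variety := Variety {
  vclass :> monoidType -> Prop;
  variety_sub : forall (M N : monoidType) (f : N -> M),
    monoid_morphism f -> injective f -> vclass M -> vclass N;
  variety_img : forall (M N : monoidType) (f : M -> N),
    monoid_morphism f -> (forall y, exists x, f x = y) -> vclass M -> vclass N;
  variety_prod : forall (I : Type) (F : I -> monoidType),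
    (forall i, vclass (F i)) -> vclass (dprod_monoid F)
}.

Definition subvariety (U V : variety) : Prop := forall M, U M -> V M.
Definition variety_eq (U V : variety) : Prop := forall M, U M <-> V M.
Definition proper_subvariety (U V : variety) : Prop :=
  subvariety U V /\ ~ variety_eq U V.

Section Generated.
Variable K : monoidType -> Prop.

Definition generated_class (M : monoidType) : Prop :=
  forall V : variety, (forall N, K N -> V N) -> V M.

Fact generated_sub (M N : monoidType) (f : N -> M) :
  monoid_morphism f -> injective f -> generated_class M -> generated_class N.
Proof. by move=> fM fI KM V KV; apply: (variety_sub fM fI); exact: KM. Qed.

Fact generated_img (M N : monoidType) (f : M -> N) :
  monoid_morphism f -> (forall y, exists x, f x = y) ->
  generated_class M -> generated_class N.
Proof. by move=> fM fS KM V KV; apply: (variety_img fM fS); exact: KM. Qed.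

Fact generated_prod (I : Type) (F : I -> monoidType) :
  (forall i, generated_class (F i)) -> generated_class (dprod_monoid F).
Proof. by move=> KF V KV; apply: variety_prod => i; exact: KF. Qed.

Definition generated_variety : variety :=
  Variety generated_sub generated_img generated_prod.
End Generated.

Definition variety_of_monoid (M : monoidType) : variety :=
  generated_variety (fun N => N = M).

Definition variety_join (U V : variety) : variety :=
  generated_variety (fun M => U M \/ V M).

Section Dual.
Variable V : variety.

Definition dual_class (N : monoidType) : Prop :=
  exists2 M : monoidType, V M & anti_isomorphic N M.

Fact dual_classP (N : monoidType) : dual_class N <-> V (opp_monoid N).
Proof.
split=> [[M VM [f [fB f1 fM]]]|VN].
  apply: (@variety_sub V M (opp_monoid N) f) => //; last exact: bij_inj.
  by split=> // x y; rewrite /= [x * y]/(opp_mul x y) /opp_mul fM.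
by exists (opp_monoid N) => //; exists id; split=> //; exists id.
Qed.

Fact dual_sub (M N : monoidType) (f : N -> M) :
  monoid_morphism f -> injective f -> dual_class M -> dual_class N.
Proof.
move=> [f1 fM] fI /dual_classP VM; apply/dual_classP.
apply: (@variety_sub V (opp_monoid M) (opp_monoid N) f) => //.
by split=> // x y; exact: fM.
Qed.

Fact dual_img (M N : monoidType) (f : M -> N) :
  monoid_morphism f -> (forall y, exists x, f x = y) ->
  dual_class M -> dual_class N.
Proof.
move=> [f1 fM] fS /dual_classP VM; apply/dual_classP.
apply: (@variety_img V (opp_monoid M) (opp_monoid N) f) => //.
by split=> // x y; exact: fM.
Qed.

Fact dual_prod (I : Type) (F : I -> monoidType) :
  (forall i, dual_class (F i)) -> dual_class (dprod_monoid F).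
Proof.
move=> VF; apply/dual_classP.
pose G i : monoidType := opp_monoid (F i).
have VG : V (dprod_monoid G).
  by apply: variety_prod => i; apply/dual_classP; exact: VF.
by apply: (@variety_sub V (dprod_monoid G) (opp_monoid (dprod_monoid F)) id).
Qed.

Definition dual_variety : variety := Variety dual_sub dual_img dual_prod.
End Dual.

(* Identities are pairs of (possibly empty) words over countably many
   variables. *)
Definition word := seq nat.
Definition identity := (word * word)%type.

Definition eval_word (M : monoidType) (phi : nat -> M) (w : word) : M :=
  \prod_(x <- w) phi x.

Definition satisfies (M : monoidType) (e : identity) : Prop :=
  forall phi : nat -> M, eval_word phi e.1 = eval_word phi e.2.

Fact eval_word_morph (M N : monoidType) (f : M -> N) (phi : nat -> M) w :
  monoid_morphism f -> f (eval_word phi w) = eval_word (f \o phi) w.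
Proof. by move=> [f1 fM]; exact: (big_morph f fM f1). Qed.

Fact satisfies_sub (M N : monoidType) (f : N -> M) e :
  monoid_morphism f -> injective f -> satisfies M e -> satisfies N e.
Proof.
by move=> fM fI Me phi; apply: fI; rewrite !eval_word_morph //; exact: Me.
Qed.

Fact satisfies_img (M N : monoidType) (f : M -> N) e :
  monoid_morphism f -> (forall y, exists x, f x = y) ->
  satisfies M e -> satisfies N e.
Proof.
move=> fM fS Me phi; have [psi psiE] := choice (fun n => fS (phi n)).
have -> : phi = f \o psi by apply: funext => n /=; rewrite psiE.
by rewrite -!eval_word_morph // Me.
Qed.

Fact satisfies_prod (I : Type) (F : I -> monoidType) e :
  (forall i, satisfies (F i) e) -> satisfies (dprod_monoid F) e.
Proof.
move=> Fe phi; apply: functional_extensionality_dep => i.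
have pM : monoid_morphism (fun x : dprod_monoid F => x i) by [].
by rewrite !(eval_word_morph _ _ pM); exact: Fe.
Qed.

Section DefinedWithin.
Variables (V : variety) (Sigma : {pred identity}).

Definition within_class (M : monoidType) : Prop :=
  V M /\ forall e, e \in Sigma -> satisfies M e.

Fact within_sub (M N : monoidType) (f : N -> M) :
  monoid_morphism f -> injective f -> within_class M -> within_class N.
Proof.
move=> fM fI [VM Me]; split; first exact: (variety_sub fM fI VM).
by move=> e /Me; exact: satisfies_sub fM fI.
Qed.

Fact within_img (M N : monoidType) (f : M -> N) :
  monoid_morphism f -> (forall y, exists x, f x = y) ->
  within_class M -> within_class N.
Proof.
move=> fM fS [VM Me]; split; first exact: (variety_img fM fS VM).
by move=> e /Me; exact: satisfies_img fM fS.
Qed.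

Fact within_prod (I : Type) (F : I -> monoidType) :
  (forall i, within_class (F i)) -> within_class (dprod_monoid F).
Proof.
move=> VF; split; first by apply: variety_prod => i; have [] := VF i.
by move=> e Se; apply: satisfies_prod => i; have [_] := VF i; apply.
Qed.

Definition defined_within : variety := Variety within_sub within_img within_prod.
End DefinedWithin.

Definition finitely_based (V : variety) : Prop :=
  exists Sigma : seq identity,
    forall M, V M <-> forall e, e \in Sigma -> satisfies M e.

Definition finite_monoid (M : monoidType) : Prop :=
  exists s : seq M, forall x, x \in s.

Definition finitely_generated (V : variety) : Prop :=
  exists2 M : monoidType, finite_monoid M & variety_eq V (variety_of_monoid M).

Definition small (V : variety) : Prop :=
  exists (n : nat) (U : 'I_n -> variety),
    forall W, subvariety W V -> exists i, variety_eq W (U i).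

Definition cross (V : variety) : Prop :=
  [/\ finitely_based V, finitely_generated V & small V].

Definition almost_cross (V : variety) : Prop :=
  ~ cross V /\ forall W, proper_subvariety W V -> cross W.

Inductive A0 := A0_1 | A0_0 | A0_a | A0_b | A0_ab.

Definition A0_code (x : A0) : 'I_5 :=
  match x with
  | A0_1 => inord 0 | A0_0 => inord 1
  | A0_a => inord 2 | A0_b => inord 3 | A0_ab => inord 4
  end.
Definition A0_decode (i : 'I_5) : A0 :=
  nth A0_1 [:: A0_1; A0_0; A0_a; A0_b; A0_ab] i.
Fact A0_codeK : cancel A0_code A0_decode.
Proof. by case; rewrite /A0_decode inordK. Qed.
HB.instance Definition _ := Finite.copy A0 (can_type A0_codeK).

Definition A0_mul (x y : A0) : A0 :=
  match x, y with
  | A0_1, z | z, A0_1 => z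
  | A0_a, A0_a => A0_a
  | A0_a, A0_b | A0_a, A0_ab | A0_ab, A0_b => A0_ab
  | A0_b, A0_b => A0_b
  | _, _ => A0_0
  end.

Fact A0_mulA : associative A0_mul. Proof. by do 3!case. Qed.
Fact A0_mul1 : left_id A0_1 A0_mul. Proof. by case. Qed.
Fact A0_mulr1 : right_id A0_1 A0_mul. Proof. by case. Qed.
HB.instance Definition _ := isMonoid.Build A0 A0_mulA A0_mul1 A0_mulr1.

(* The table above is the one defined by
   < a, b | a^2 = a, b^2 = b, ba = 0 > with an identity adjoined. *)
Lemma A0_presented :
  [/\ A0_a * A0_a = A0_a, A0_b * A0_b = A0_b, A0_b * A0_a = A0_0,
      A0_a * A0_b = A0_ab & forall x, A0_0 * x = A0_0 /\ x * A0_0 = A0_0]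
  /\ forall (M : monoidType) (a b z : M),
    [/\ a * a = a, b * b = b, b * a = z &
        forall x, x \in [:: a; b; z] -> z * x = z /\ x * z = z] ->
    exists! f : A0 -> M,
      [/\ monoid_morphism f, f A0_a = a, f A0_b = b & f A0_0 = z].
Proof.
split; first by split=> //; case.
move=> M a b z [aa bb ba zP].
have [za az] : z * a = z /\ a * z = z by apply: zP; rewrite !inE eqxx.
have [zb bz] : z * b = z /\ b * z = z by apply: zP; rewrite !inE eqxx orbT.
have [zz _] : z * z = z /\ z * z = z by apply: zP; rewrite !inE eqxx !orbT.
exists (fun x => match x with
  A0_1 => 1 | A0_0 => z | A0_a => a | A0_b => b | A0_ab => a * b end).
split; first split=> //; first split=> //.
  have aba : a * b * a = z by rewrite -mulgA ba.
  have abb : a * b * b = a * b by rewrite -mulgA bb.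
  have abz : a * b * z = z by rewrite -mulgA bz.
  have H := (@mulgA M, aba, abb, abz, aa, ba, bb, (za, zb, zz, az, bz),
             @mul1g M, @mulg1 M).
  move=> x y; rewrite [x * y]/(A0_mul x y).
  by case: x y; case; rewrite /= ?H.
move=> g [[g1 gM] ga gb g0]; apply: funext; case; rewrite ?g1 ?ga ?gb ?g0 //.
by rewrite -ga -gb -gM.
Qed.

Inductive E := E_1 | E_0 | E_a | E_b | E_c | E_ac.

Definition E_code (x : E) : 'I_6 :=
  match x with
  | E_1 => inord 0 | E_0 => inord 1
  | E_a => inord 2 | E_b => inord 3 | E_c => inord 4 | E_ac => inord 5
  end.
Definition E_decode (i : 'I_6) : E :=
  nth E_1 [:: E_1; E_0; E_a; E_b; E_c; E_ac] i.
Fact E_codeK : cancel E_code E_decode.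
Proof. by case; rewrite /E_decode inordK. Qed.
HB.instance Definition _ := Finite.copy E (can_type E_codeK).

Definition E_mul (x y : E) : E :=
  match x, y with
  | E_1, z | z, E_1 => z
  | E_a, E_c => E_ac
  | E_b, E_a | E_c, E_a => E_a
  | E_b, E_b | E_b, E_c => E_b
  | E_c, E_b | E_c, E_c => E_c
  | E_b, E_ac | E_c, E_ac => E_ac
  | E_ac, E_b | E_ac, E_c => E_ac
  | _, _ => E_0
  end.

Fact E_mulA : associative E_mul. Proof. by do 3!case. Qed.
Fact E_mul1 : left_id E_1 E_mul. Proof. by case. Qed.
Fact E_mulr1 : right_id E_1 E_mul. Proof. by case. Qed.
HB.instance Definition _ := isMonoid.Build E E_mulA E_mul1 E_mulr1.

(* The table above is the one defined by < a, b, c | a^2 = ab = 0,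
   ba = ca = a, b^2 = bc = b, c^2 = cb = c > with an identity adjoined. *)
Lemma E_presented :
  [/\ E_a * E_a = E_0 /\ E_a * E_b = E_0, E_b * E_a = E_a /\ E_c * E_a = E_a,
      E_b * E_b = E_b /\ E_b * E_c = E_b, E_c * E_c = E_c /\ E_c * E_b = E_c &
      E_a * E_c = E_ac /\ forall x, E_0 * x = E_0 /\ x * E_0 = E_0]
  /\ forall (M : monoidType) (a b c z : M),
    [/\ a * a = z /\ a * b = z, b * a = a /\ c * a = a,
        b * b = b /\ b * c = b, c * c = c /\ c * b = c &
        forall x, x \in [:: a; b; c; z] -> z * x = z /\ x * z = z] ->
    exists! f : E -> M,
      [/\ monoid_morphism f, f E_a = a, f E_b = b, f E_c = c & f E_0 = z].
Proof.
split; first by split=> //; split=> //; case.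
move=> M a b c z [[aa ab] [ba ca] [bb bc] [cc cb] zP].
have [za az] : z * a = z /\ a * z = z by apply: zP; rewrite !inE eqxx.
have [zb bz] : z * b = z /\ b * z = z by apply: zP; rewrite !inE eqxx !orbT.
have [zc cz] : z * c = z /\ c * z = z by apply: zP; rewrite !inE eqxx !orbT.
have [zz _] : z * z = z /\ z * z = z by apply: zP; rewrite !inE eqxx !orbT.
exists (fun x => match x with
  E_1 => 1 | E_0 => z | E_a => a | E_b => b | E_c => c | E_ac => a * c end).
split; first split=> //; first split=> //.
  have aca : a * c * a = z by rewrite -mulgA ca.
  have acb : a * c * b = a * c by rewrite -mulgA cb.
  have acc : a * c * c = a * c by rewrite -mulgA cc.
  have acz : a * c * z = z by rewrite -mulgA cz.
  have H := (@mulgA M, aca, acb, acc, acz, aa, ab, ba, ca, bb, bc, cc, cb,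
             (za, zb, zc, zz, az, bz, cz), @mul1g M, @mulg1 M).
  move=> x y; rewrite [x * y]/(E_mul x y).
  by case: x y; case; rewrite /= ?H.
move=> g [[g1 gM] ga gb gc g0]; apply: funext.
by case; rewrite ?g1 ?ga ?gb ?gc ?g0 // -ga -gc -gM.
Qed.

Definition var_A0 : variety := variety_of_monoid A0.
Definition var_E : variety := variety_of_monoid E.

Definition R2_identity : identity :=
  let x := 0 in let y := 1%N in let t1 := 2 in let t2 := 3 in
  ([:: y; t2; x; t1; x; y], [:: y; t2; x; t1; y; x]).

Definition var_R2 : variety := defined_within var_E (pred1 R2_identity).

Definition var_S : variety :=
  variety_join (variety_join var_A0 var_R2) (dual_variety var_R2).

(* Main.v *)
(* S satisfies u = v iff both words have the same letters, the same scattered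
   subwords of length two (the identities of A_0), the same letters before each
   first occurrence and, for each letter t occurring once, the same letters
   between t and each first occurrence (the identities of R_2), and dually.

   Not finitely based: in z_1 ... z_n t x z_1 y_1 ... z_n y_n x s y_1 ... y_n a
   third x may be inserted between the two, but the last z_i and the first y_i
   cannot be exchanged or separated by anything but x, so an identity of S that
   is too short sees only one of the two x's of the middle block, or it has a
   letter occurring once between them; in both cases it cannot insert x after
   the last z_1 and before the first y_n.

   Subvarieties: an identity that fails in S yields, by erasing letters, one of
   sixteen identities in at most three letters.  Conversely these identities
   allow every word to be saturated in such a way that the corresponding
   feature carries no information any more, so a subvariety is determined by
   the ones among the sixteen that it satisfies.  Each of them implies
   xxyy = xyxy, or xtxyxy = xtyxxy, or the mirror image of the latter, and any
   of these three reduces all identities of S to bounded ones. *)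

From HB Require Import structures.
From mathcomp Require Import all_boot.
From mathcomp Require Import boolp zify.
Require Import Defs.

Set Implicit Arguments.
Unset Strict Implicit.
Unset Printing Implicit Defensive.

(** * Varieties and equational theories *)

(** Varieties enter only through their identities; as their definition mentions none, everything
    rests on Birkhoff's theorem. No normal forms are used: two words are shown equivalent by
    inserting letters until they coincide, or each is replaced by a member of its class that
    maximises a bounded count. Finite generation and smallness hold for all subvarieties, S
    included, for one reason: the sixteen identities that tell subvarieties apart involve three
    letters, so the relatively free monoid on three letters generates. Only the finite basis uses
    properness. There the obstacle is the insertion of a letter that has occurrences on both sides
    of the gap: whether it is allowed depends on letters arbitrarily far away, and the extra
    identity is what brings the insertion back to words of bounded length. *)

Section Quotient.
Variables (X : choiceType) (rho : seq X -> seq X -> Prop).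

Definition word_congruence : Prop :=
  [/\ forall u, rho u u, forall u v, rho u v -> rho v u,
      forall u v w, rho u v -> rho v w -> rho u w &
      forall u v u' v', rho u v -> rho u' v' -> rho (u ++ u') (v ++ v')].

Hypothesis rhoP : word_congruence.

Fact class_inhabited u : exists v, `[< rho u v >].
Proof. by exists u; apply/asboolP; case: rhoP => rr _ _ _; exact: rr. Qed.

(** The choice depends only on the class of [u], which makes the quotient a subtype of [seq X]. *)
Definition canon u : seq X := xchoose (class_inhabited u).

Lemma canonP u : rho u (canon u).
Proof. exact/asboolP/(xchooseP (class_inhabited u)). Qed.

Lemma canon_eq u v : rho u v -> canon u = canon v.
Proof.
case: rhoP => rr rs rt _ uv; apply: eq_xchoose => w /=.
by apply/asboolP/asboolP; [apply: rt; exact: rs|exact: rt].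
Qed.

Lemma canonK u : canon (canon u) = canon u.
Proof. by apply/esym/canon_eq/canonP. Qed.

Definition quotient_monoid : Type := {u : seq X | canon u == u}.

HB.instance Definition _ := Choice.on quotient_monoid.

Definition in_quotient u : quotient_monoid :=
  exist _ (canon u) (introT eqP (canonK u)).

Definition quotient_mul (a b : quotient_monoid) := in_quotient (val a ++ val b).

Lemma in_quotient_eq u v : rho u v -> in_quotient u = in_quotient v.
Proof. by move=> uv; apply: val_inj; exact: canon_eq. Qed.

Lemma in_quotientK a : in_quotient (val a) = a.
Proof. by apply: val_inj => /=; apply/eqP; exact: (valP a). Qed.

Lemma in_quotient_inj u v : in_quotient u = in_quotient v -> rho u v.
Proof.
case: rhoP => rr rs rt _ /(congr1 val) /= uv.
by apply: rt (canonP u) _; rewrite uv; exact: rs (canonP v).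
Qed.

Lemma in_quotientM u v :
  quotient_mul (in_quotient u) (in_quotient v) = in_quotient (u ++ v).
Proof.
case: rhoP => rr rs rt rc; apply: in_quotient_eq; apply: rs.
by apply: rc; exact: canonP.
Qed.

Fact quotient_mulA : associative quotient_mul.
Proof.
move=> a b c; rewrite -(in_quotientK a) -(in_quotientK b) -(in_quotientK c).
by rewrite !in_quotientM catA.
Qed.
Fact quotient_mul1 : left_id (in_quotient [::]) quotient_mul.
Proof. by move=> a; rewrite -(in_quotientK a) in_quotientM. Qed.
Fact quotient_mulr1 : right_id (in_quotient [::]) quotient_mul.
Proof. by move=> a; rewrite -(in_quotientK a) in_quotientM cats0. Qed.

HB.instance Definition _ :=
  isMonoid.Build quotient_monoid quotient_mulA quotient_mul1 quotient_mulr1.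
End Quotient.

Definition subst (X : Type) (sigma : X -> word) (u : seq X) : word :=
  flatten (map sigma u).

Lemma subst_cat (X : Type) (s : X -> word) u v :
  subst s (u ++ v) = subst s u ++ subst s v.
Proof. by rewrite /subst map_cat flatten_cat. Qed.

Lemma eval_word_cat (M : monoidType) (phi : nat -> M) u v :
  eval_word phi (u ++ v) = (eval_word phi u * eval_word phi v)%g.
Proof. by rewrite /eval_word big_cat. Qed.

Lemma eval_word_cons (M : monoidType) (phi : nat -> M) x u :
  eval_word phi (x :: u) = (phi x * eval_word phi u)%g.
Proof. by rewrite /eval_word big_cons. Qed.

Lemma eval_word_nil (M : monoidType) (phi : nat -> M) : eval_word phi [::] = 1%g.
Proof. by rewrite /eval_word big_nil. Qed.

Lemma eval_word_subst (M : monoidType) (phi : nat -> M) s u :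
  eval_word phi (subst s u) = eval_word (fun x => eval_word phi (s x)) u.
Proof.
elim: u => [|x u IH]; first by rewrite !eval_word_nil.
by rewrite -cat1s subst_cat eval_word_cat IH eval_word_cons /subst /= cats0.
Qed.

Lemma eq_eval_word (M : monoidType) (phi psi : nat -> M) u :
  {in u, phi =1 psi} -> eval_word phi u = eval_word psi u.
Proof. by move=> e; rewrite /eval_word; apply: eq_big_seq. Qed.

Section QuotientIdentities.
Variables (rho : word -> word -> Prop) (rhoP : word_congruence rho).

Lemma eval_quotient (s : nat -> word) u :
  eval_word (fun x => in_quotient rhoP (s x)) u = in_quotient rhoP (subst s u).
Proof.
elim: u => [|x u IH]; first by rewrite eval_word_nil.
by rewrite eval_word_cons IH; exact: (in_quotientM rhoP).
Qed.

(** Every assignment into the quotient comes from a substitution of representatives. The congruence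
    need not be fully invariant. *)
Lemma quotient_satisfies e :
  satisfies (quotient_monoid rhoP) e <->
  forall s, rho (subst s e.1) (subst s e.2).
Proof.
split=> [He s|He phi].
  apply: (in_quotient_inj (rhoP := rhoP)); rewrite -!eval_quotient; exact: He.
have -> : phi = fun x => in_quotient rhoP (val (phi x)).
  by apply: funext => x; rewrite in_quotientK.
by rewrite !eval_quotient; apply: in_quotient_eq; exact: He.
Qed.
End QuotientIdentities.

Definition identities (V : variety) (u v : word) : Prop :=
  forall M, V M -> satisfies M (u, v).

(** A fully invariant congruence on the free monoid over countably many letters. *)
Definition theory (th : word -> word -> Prop) : Prop :=
  word_congruence th /\ forall s u v, th u v -> th (subst s u) (subst s v).

Lemma identities_theory V : theory (identities V).
Proof.
split; first split.
- by [].
- by move=> u v uv M VM phi; rewrite /= (uv _ VM).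
- by move=> u v w uv vw M VM phi; rewrite /= (uv _ VM) (vw _ VM).
- move=> u v u' v' uv uv' M VM phi /=.
  by rewrite !eval_word_cat (uv _ VM phi) (uv' _ VM phi).
move=> s u v uv M VM phi /=; rewrite !eval_word_subst; exact: uv.
Qed.

(** * Birkhoff's theorem *)

Section Birkhoff.
Variables (V : variety) (M : monoidType).
Hypothesis idM : forall u v, identities V u v -> satisfies M (u, v).

Let evalX (N : monoidType) (f : M -> N) (w : seq M) : N := (\prod_(x <- w) f x)%g.

Let evalX_nat (N : monoidType) (f : M -> N) w s : {subset w <= s} ->
  evalX f w = eval_word (fun i => f (nth 1%g s i)) (map (index^~ s) w).
Proof.
move=> ws; rewrite /eval_word big_map; apply: eq_big_seq => x /ws xs.
by rewrite nth_index.
Qed.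

Let separated (e : seq M * seq M) (N : monoidType) : Prop :=
  V N /\ exists f : M -> N, evalX f e.1 <> evalX f e.2.

(** Words over the alphabet [M], modulo equality of their values in a product [P] of members of [V],
    embed in [P] and map onto [M]. The product has one factor for each pair of words over [M], a
    monoid of [V] separating the pair if there is one, so its index type is a fixed type and not the
    class [V]. *)
Lemma birkhoff : V M.
Proof.
(* The empty product serves as default factor for pairs that no member of [V] separates. *)
pose N0 : monoidType := dprod_monoid (fun i : void => (Empty_set_rect _ i : monoidType)).
have V0 : V N0 by apply: variety_prod; case.
have sepP (e : seq M * seq M) : exists g : {N : monoidType & M -> N},
    V (tag g) /\ ((exists N, separated e N) ->
                  evalX (tagged g) e.1 <> evalX (tagged g) e.2).
  have [[N [VN [f fe]]]|nsep] := pselect (exists N, separated e N).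
    by exists (Tagged (fun N : monoidType => M -> N) f).
  by exists (existT (fun N : monoidType => M -> N) N0 (fun=> 1%g)); split.
have [g gP] := choice sepP.
pose P := dprod_monoid (fun e => tag (g e)).
pose h (x : M) : P := fun e => tagged (g e) x.
have VP : V P by apply: variety_prod => e; case: (gP e).
have evalE w e : evalX h w e = evalX (tagged (g e)) w.
  by rewrite /evalX; elim: w => [|x w IH]; rewrite ?big_nil // !big_cons -IH.
pose rho u v := evalX h u = evalX h v.
have rhoP : word_congruence rho.
  rewrite /rho; split=> [//|u v -> //|u v w -> -> //|u v u' v' uv uv'].
  by rewrite /evalX !big_cat /=; congr (_ * _)%g.
have rhoM u v : rho u v -> evalX id u = evalX id v.
  (* Numbering the letters by their position in [s] turns a pair of words over [M] into an
     identity. *)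
  move=> uv; set s := undup (u ++ v).
  have us : {subset u <= s} by move=> x xu; rewrite mem_undup mem_cat xu.
  have vs : {subset v <= s} by move=> x xv; rewrite mem_undup mem_cat xv orbT.
  rewrite (evalX_nat _ us) (evalX_nat _ vs); apply: idM => N VN phi /=.
  have [uvN|] := pselect (evalX (fun x => phi (index x s)) u =
                          evalX (fun x => phi (index x s)) v).
    move: uvN; rewrite (evalX_nat _ us) (evalX_nat _ vs).
    rewrite (_ : eval_word _ _ = eval_word phi [seq index x s | x <- u]).
      rewrite (_ : eval_word _ [seq index x s | x <- v] =
                   eval_word phi [seq index x s | x <- v]) //.
      apply: eq_eval_word => i /mapP[x /vs xs ->].
      by rewrite nth_index.
    apply: eq_eval_word => i /mapP[x /us xs ->].
    by rewrite nth_index.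
  move=> ne; have [_] := gP (u, v); case.
    by exists N; split=> //; exists (fun x => phi (index x s)).
  by rewrite -!evalE -/(rho u v) uv.
apply: (@variety_img V (quotient_monoid rhoP) M (fun a => evalX id (val a))).
- have evM u v : evalX id (u ++ v) = (evalX id u * evalX id v)%g.
    by rewrite /evalX big_cat.
  split=> [|a b].
    rewrite (rhoM _ [::]); first by rewrite /evalX big_nil.
    exact/esym/(canonP rhoP).
  rewrite -evM; apply: rhoM.
  exact/esym/(canonP rhoP).
- move=> y; exists (in_quotient rhoP [:: y]) => /=.
  have -> : y = evalX id [:: y] by rewrite /evalX big_seq1.
  apply/esym/rhoM; have -> : evalX id [:: y] = y by rewrite /evalX big_seq1.
  exact: canonP.
apply: (@variety_sub V P (quotient_monoid rhoP) (fun a => evalX h (val a))) => //.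
- have evM u v : evalX h (u ++ v) = (evalX h u * evalX h v)%g.
    by rewrite /evalX big_cat.
  split=> [|a b].
    have : rho (canon rhoP [::]) [::].
      exact/esym/(canonP rhoP).
    by rewrite /rho => ->; rewrite /evalX big_nil.
  rewrite -evM.
  have : rho (canon rhoP (val a ++ val b)) (val a ++ val b).
    exact/esym/(canonP rhoP).
  by [].
move=> a b ab; rewrite -(in_quotientK (rhoP := rhoP) a) -(in_quotientK (rhoP := rhoP) b).
exact: in_quotient_eq.
Qed.
End Birkhoff.

Lemma identities_sub U V : subvariety U V <-> forall u v, identities V u v ->
  identities U u v.
Proof.
split=> [UV u v uv M UM|UV M UM]; first by apply: uv; exact: UV.
by apply: birkhoff => u v /UV; apply.
Qed.

(** * Scattered subwords, prefixes and suffixes *)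

(* Membership atoms occur both at [nat] and at its eqType sort; [lia] only
   identifies them once the type is normalised. *)
Ltac bool_lia :=
  change (Equality.sort Datatypes_nat__canonical__eqtype_Equality) with nat in *;
  lia.

(** The case [x = y] is used throughout: [sub2 t t u] says that [t] is repeated in [u], its negation
    that [t] occurs at most once. *)
Fixpoint sub2 (x y : nat) (u : word) : bool :=
  if u is c :: u' then (x == c) && (y \in u') || sub2 x y u' else false.

(* [pre y u] and [post y u] are all of u when y does not occur in u. *)
Fixpoint pre (y : nat) (u : word) : word :=
  if u is c :: u' then if y == c then [::] else c :: pre y u' else [::].

Fixpoint post (y : nat) (u : word) : word :=
  if u is c :: u' then
    if y \in u' then post y u' else if y == c then u' else u
  else [::].

Ltac bool_cases :=
  change (Equality.sort Datatypes_nat__canonical__eqtype_Equality) with nat in *;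
  repeat (match goal with
    | |- context [sub2 ?a ?b ?c] => case: (sub2 a b c)
    | |- context [in_mem ?a ?b] => case: (in_mem a b)
    | |- context [@eq_op ?T ?a ?b] => case: (@eq_op T a b)
  end => //=);
  intros;
  repeat match goal with H : is_true true -> _ |- _ => specialize (H isT) end;
  try done.

Lemma sub2_cat x y u v : sub2 x y (u ++ v) =
  [|| sub2 x y u, sub2 x y v | (x \in u) && (y \in v)].
Proof.
elim: u => [|c u IH] /=; first by rewrite orbF.
by rewrite IH mem_cat in_cons; bool_lia.
Qed.

Lemma pre_cat y u v : pre y (u ++ v) = if y \in u then pre y u else u ++ pre y v.
Proof.
elim: u => [|c u IH] //=; rewrite in_cons; case: eqP => //= _.
by rewrite IH; case: ifP.
Qed.

Lemma pre_notin y u : y \notin u -> pre y u = u.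
Proof. by elim: u => //= c u IH; rewrite in_cons negb_or => /andP[/negbTE-> /IH->]. Qed.

Lemma post_notin y u : y \notin u -> post y u = u.
Proof. by case: u => //= c u; rewrite in_cons negb_or => /andP[/negbTE->
  /negbTE->]. Qed.

Lemma post_cat y u v : post y (u ++ v) = if y \in v then post y v else post y u ++ v.
Proof.
elim: u => [|c u IH] /=; first by case: ifP => // /negbT /post_notin.
by rewrite mem_cat IH; case: (y \in v); rewrite ?orbT ?orbF //; do !case: ifP.
Qed.

Lemma notin_pre y u : y \notin pre y u.
Proof. by elim: u => //= c u IH; case: ifP => // yc; rewrite in_cons yc. Qed.

Lemma pre_sub y u : {subset pre y u <= u}.
Proof.
elim: u => //= c u IH x; case: ifP => // _; rewrite !in_cons.
by case/orP=> [->//|/IH->]; rewrite orbT.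
Qed.

Lemma split_first y u : y \in u -> exists r, u = pre y u ++ y :: r.
Proof.
elim: u => //= c u IH; rewrite in_cons; case: eqP => [->|_ /= /IH[r e]].
  by exists u.
by exists r; rewrite {1}e.
Qed.

Lemma sub2_rev x y u : sub2 x y (rev u) = sub2 y x u.
Proof.
elim: u => //= c u IH; rewrite rev_cons -cats1 sub2_cat IH /= !in_cons mem_rev.
by rewrite !in_nil; bool_lia.
Qed.

Lemma post_rev y u : post y (rev u) = rev (pre y u).
Proof.
elim: u => //= c u IH; rewrite rev_cons -cats1 post_cat IH /= in_cons in_nil orbF.
by case: eqP => //= _; rewrite rev_cons cats1.
Qed.

Lemma pre_rev y u : pre y (rev u) = rev (post y u).
Proof. by rewrite -{2}(revK u) post_rev revK. Qed.

Lemma post_sub y u : {subset post y u <= u}.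
Proof.
by move=> x; rewrite -{1}(revK u) post_rev mem_rev => /pre_sub; rewrite mem_rev.
Qed.

Lemma split_last y u : y \in u -> exists r, u = r ++ y :: post y u.
Proof.
rewrite -mem_rev => /split_first[r]; rewrite pre_rev => /(congr1 rev).
by rewrite revK rev_cat revK rev_cons cat_rcons => e; exists (rev r).
Qed.

Lemma sub2_mem x y u : sub2 x y u -> (x \in u) && (y \in u).
Proof. by elim: u => //= c u IH; rewrite !in_cons => /orP[/andP[-> ->]|/IH/andP[->
  ->]]; rewrite ?orbT. Qed.

Lemma sub2_meml x y u : sub2 x y u -> x \in u. Proof. by case/sub2_mem/andP. Qed.
Lemma sub2_memr x y u : sub2 x y u -> y \in u. Proof. by case/sub2_mem/andP. Qed.

Lemma mem_pre_cat x y u v : (x \in pre y (u ++ v)) =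
  (x \in pre y u) || (y \notin u) && (x \in pre y v).
Proof.
by rewrite pre_cat; case: (boolP (y \in u)) => [_|/pre_notin->]; rewrite ?orbF ?mem_cat.
Qed.

Lemma mem_post_cat x y u v : (x \in post y (u ++ v)) =
  (x \in post y v) || (y \notin v) && (x \in post y u).
Proof.
rewrite post_cat; case: (boolP (y \in v)) => [_|/post_notin->]; rewrite ?orbF //.
by rewrite mem_cat orbC.
Qed.

Lemma sub2_pre_cat t x y u v : sub2 t x (pre y (u ++ v)) =
  sub2 t x (pre y u) ||
  (y \notin u) && (sub2 t x (pre y v) || (t \in u) && (x \in pre y v)).
Proof.
by rewrite pre_cat; case: (boolP (y \in u)) => [_|/pre_notin->];
  rewrite ?orbF ?sub2_cat.
Qed.

Lemma sub2_post_cat x t y u v : sub2 x t (post y (u ++ v)) =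
  sub2 x t (post y v) ||
  (y \notin v) && (sub2 x t (post y u) || (x \in post y u) && (t \in v)).
Proof.
rewrite post_cat; case: (boolP (y \in v)) => [_|/post_notin->]; rewrite ?orbF //.
by rewrite sub2_cat /=; case: (sub2 x t v); rewrite ?orbT.
Qed.

Lemma mem_pre_cons x y c v : (x \in pre y (c :: v)) =
  (y != c) && ((x == c) || (x \in pre y v)).
Proof. by rewrite /=; case: eqP => //= _; rewrite in_cons. Qed.

Lemma sub2_pre_cons t x y c v : sub2 t x (pre y (c :: v)) =
  (y != c) && ((t == c) && (x \in pre y v) || sub2 t x (pre y v)).
Proof. by rewrite /=; case: eqP. Qed.

Lemma mem_post_cons x y c v : (x \in post y (c :: v)) =
  (x \in post y v) || [&& y \notin v, x == c & y != c].
Proof.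
rewrite -cat1s mem_post_cat /=; case: (eqVneq y c) => //= _;
  rewrite ?mem_seq1 ?andbT ?andbF //.
Qed.

Lemma sub2_post_cons x t y c v : sub2 x t (post y (c :: v)) =
  sub2 x t (post y v) || [&& y \notin v, x == c, y != c & t \in v].
Proof.
rewrite -cat1s sub2_post_cat /=; case: (eqVneq y c) => //= _;
  rewrite ?mem_seq1 ?andbF //.
Qed.

Lemma sub2_filter (P : pred nat) x y u :
  sub2 x y (filter P u) = [&& P x, P y & sub2 x y u].
Proof.
elim: u => [|c u IH] /=; first by rewrite !andbF.
case: ifP => Pc /=; rewrite ?mem_filter IH; case: (eqVneq x c) => [->|_] //=.
  by rewrite Pc /=; lia.
by rewrite Pc.
Qed.

Lemma pre_filter (P : pred nat) y u : P y -> pre y (filter P u) = filter P (pre y u).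
Proof.
move=> Py; elim: u => //= c u IH; case: (eqVneq y c) => [<-|nyc] /=.
  by rewrite Py /= eqxx.
by case: ifP => Pc //=; rewrite (negbTE nyc) IH.
Qed.

Lemma subseq_sub2 x y u v : subseq u v -> sub2 x y u -> sub2 x y v.
Proof.
elim: v u => [|c v IH] [|d u] //=; case: eqP => [->|_] suv.
  case/orP=> [/andP[-> yu]|s2]; first by rewrite (mem_subseq suv yu).
  by rewrite (IH _ suv s2) orbT.
by move=> s2; rewrite (IH (d :: u) suv) ?orbT.
Qed.

Lemma mem_pre_prefix x y z u : x \in pre y u -> y \in pre z u -> x \in pre z u.
Proof.
elim: u => //= d u IH; case: (eqVneq y d) => //= yd.
case: (eqVneq z d) => //= zd; rewrite !in_cons (negbTE yd) /=.
by case/orP=> [->//|xu yz]; rewrite IH ?orbT.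
Qed.

Lemma sub2_pre_prefix t x y z u : sub2 t x (pre y u) -> y \in pre z u ->
  sub2 t x (pre z u).
Proof.
elim: u => //= c u IH; case: (eqVneq y c) => //= yc; case: (eqVneq z c) => //= zc.
rewrite in_cons (negbTE yc) /= => /orP[/andP[-> xu] yz|s2 yz].
  by rewrite (mem_pre_prefix xu yz).
by rewrite IH // orbT.
Qed.

Lemma pre_total x y u : x != y -> x \in u -> (x \in pre y u) || (y \in pre x u).
Proof.
elim: u => //= c u IH xy; rewrite in_cons; case: (eqVneq x c) => [<- _|xc /=].
  by rewrite eq_sym (negbTE xy) mem_head.
move=> xu; case: (eqVneq y c) => [->|yc]; first by rewrite mem_head.
by rewrite !in_cons (negbTE yc) (negbTE xc) IH.
Qed.

Lemma pre_asym x y u : x \in pre y u -> y \in pre x u -> False.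
Proof. by move=> xy yx; have := mem_pre_prefix xy yx; apply/negP/notin_pre. Qed.

(** * The identities of S *)

Lemma notin_post y u : y \notin post y u.
Proof. by rewrite -(revK u) post_rev mem_rev notin_pre. Qed.

Lemma sub2_split x y u : sub2 x y u -> exists p q r, u = p ++ x :: q ++ y :: r.
Proof.
elim: u => //= c u IH /orP[/andP[/eqP<- /splitPr[q r]]|/IH[p [q [r ->]]]].
  by exists [::], q, r.
by exists (c :: p), q, r.
Qed.

Lemma sub2_total x y u : x != y -> x \in u -> y \in u -> sub2 x y u || sub2 y x u.
Proof.
move=> xy /splitPr[p q]; move: xy; rewrite !sub2_cat /= !mem_cat !in_cons.
by bool_lia.
Qed.

Definition invA (u v : word) : Prop :=
  (forall x, (x \in u) = (x \in v)) /\ forall x y, sub2 x y u = sub2 x y v.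

(** For [t] occurring once, [sub2 t x (pre y u)] says that [x] lies between [t] and the first [y];
    for [y] absent from [u], that [x] lies anywhere after [t]. *)
Definition invR (u v : word) : Prop :=
  [/\ forall x, (x \in u) = (x \in v), forall t, sub2 t t u = sub2 t t v,
      forall x y, (x \in pre y u) = (x \in pre y v) &
      forall t x y, ~~ sub2 t t u -> sub2 t x (pre y u) = sub2 t x (pre y v)].

Definition inv (u v : word) : Prop :=
  [/\ invA u v, invR u v & invR (rev u) (rev v)].

Lemma invR_sym u v : invR u v -> invR v u.
Proof. by case=> m s p q; split=> [x|t|x y|t x y vt]; rewrite ?m ?s ?p // q // s. Qed.

Lemma invR_trans u v w : invR u v -> invR v w -> invR u w.
Proof.
case=> m s p q [m' s' p' q']; split=> [x|t|x y|t x y ut].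
- by rewrite m.
- by rewrite s.
- by rewrite p.
by rewrite q // q' // -s.
Qed.

Definition all_monoids : variety :=
  @Variety (fun=> True) (fun _ _ _ _ _ _ => I) (fun _ _ _ _ _ _ => I)
    (fun _ _ _ => I).

Lemma generated_identities K u v :
  identities (generated_variety K) u v <-> forall M, K M -> satisfies M (u, v).
Proof.
split=> [uv M KM|uv M gM]; first by apply: uv => V; apply.
have := gM (defined_within all_monoids (pred1 (u, v))).
case=> [N KN|_]; last by apply; rewrite inE.
by split=> // e; rewrite inE => /eqP->; exact: uv.
Qed.

Lemma variety_of_monoid_identities M u v :
  identities (variety_of_monoid M) u v <-> satisfies M (u, v).
Proof. by rewrite generated_identities; split=> [|uv _ ->] //; apply. Qed.

Lemma variety_join_identities U V u v :
  identities (variety_join U V) u v <-> identities U u v /\ identities V u v.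
Proof.
rewrite generated_identities; split=> [uv|[uU uV] M [/uU|/uV]] //.
by split=> M HM; apply: uv; [left|right].
Qed.

Lemma eval_word_opp (M : monoidType) (phi : nat -> M) u :
  eval_word (phi : nat -> opp_monoid M) u = eval_word phi (rev u).
Proof.
elim: u => [|x u IH]; first by rewrite !eval_word_nil.
rewrite eval_word_cons rev_cons -cats1 eval_word_cat IH eval_word_cons eval_word_nil.
by rewrite mulg1.
Qed.

Lemma dual_variety_identities V u v :
  identities (dual_variety V) u v <-> identities V (rev u) (rev v).
Proof.
split=> uv M VM phi.
  have : dual_variety V (opp_monoid M).
    apply/dual_classP; apply: (@variety_sub V M (opp_monoid (opp_monoid M)) id) => //.
  move=> /uv/(_ phi); rewrite !(eval_word_opp (M := M)) //.
move/dual_classP: VM => /uv/(_ phi).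
by rewrite !(eval_word_opp (M := M)) /= !revK.
Qed.

(** * The identities of A_0 *)

Section A0Identities.
Variable phi : nat -> A0.

Let isA x := if phi x is (A0_a | A0_ab) then true else false.
Let isB x := if phi x is (A0_b | A0_ab) then true else false.
Let isZ x := if phi x is A0_0 then true else false.

Fixpoint A0_clash (u : word) : bool :=
  if u is c :: u' then isB c && has isA u' || A0_clash u' else false.

Lemma A0_clashP u : A0_clash u <-> exists x y, [/\ sub2 x y u, isB x & isA y].
Proof.
elim: u => [|c u IH] /=; first by split=> // -[x [y []]].
split=> [/orP[/andP[Bc /hasP[y yu Ay]]|/IH[x [y [xy Bx Ay]]]]|].
- by exists c, y; rewrite eqxx yu.
- by exists x, y; rewrite xy orbT.
case=> x [y [/orP[/andP[/eqP-> yu]|xy] Bx Ay]].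
  by rewrite Bx; apply/orP; left; apply/hasP; exists y.
by apply/orP; right; apply/IH; exists x, y.
Qed.

Lemma A0_eval u : eval_word phi u =
  if has isZ u || A0_clash u then A0_0 else
  if has isA u then if has isB u then A0_ab else A0_a
  else if has isB u then A0_b else A0_1.
Proof.
elim: u => [|c u IH]; first by rewrite eval_word_nil.
rewrite eval_word_cons IH [(phi c * _)%g]/(A0_mul _ _) /=.
move: (has isZ u) (has isA u) (has isB u) (A0_clash u); rewrite /isZ /isA /isB.
by case: (phi c) => -[] [] [] [].
Qed.
End A0Identities.

(** A product in [A0] vanishes exactly when a factor is zero or a factor involving b precedes one
    involving a. The assignment [g] detects a letter, [f] a scattered pair; for [x = y] the letter
    goes to [A0_ab], whose square is zero. *)
Lemma A0_identities u v : satisfies A0 (u, v) <-> invA u v.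
Proof.
split=> [uv|[muv suv] phi /=]; last first.
  have hasuv P : has P u = has P v by apply: eq_has_r.
  rewrite !A0_eval !hasuv.
  rewrite (_ : A0_clash phi u = A0_clash phi v) //.
  apply/idP/idP => /A0_clashP[x [y [xy Bx Ay]]]; apply/A0_clashP; exists x, y.
    by rewrite -suv.
  by rewrite suv.
split=> [x|x y].
  pose g z := if z == x then A0_0 else A0_1.
  have gZ (w : word) : has (fun z => if g z is A0_0 then true else false) w = (x \in w).
    by rewrite -has_pred1; apply: eq_has => z; rewrite /g /=; case: (z == x).
  have gA (w : word) : has (fun z => if g z is (A0_a | A0_ab) then true else false) w = false.
    by apply/hasPn => z _; rewrite /g; case: ifP.
  have gB (w : word) : has (fun z => if g z is (A0_b | A0_ab) then true else false) w = false.
    by apply/hasPn => z _; rewrite /g; case: ifP.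
  have gC (w : word) : A0_clash g w = false.
    by elim: w => //= c w ->; rewrite /g; case: (c == x).
  by have := uv g; rewrite /= !A0_eval !gZ !gA !gB !gC; do 2!case: (x \in _).
pose f z := if z == x then if z == y then A0_ab else A0_b
            else if z == y then A0_a else A0_1.
have clE (w : word) : A0_clash f w = sub2 x y w.
  elim: w => //= c w ->; congr (_ && _ || _).
    by rewrite /f eq_sym; case: (_ == _); case: (_ == _).
  rewrite -has_pred1; apply: eq_has => z /=.
  by rewrite /f; case: (z == x); case: (z == y).
have zE (w : word) : has (fun z => if f z is A0_0 then true else false) w = false.
  by apply/hasPn => z _; rewrite /f; do !case: ifP.
have := uv f; rewrite /= !A0_eval !zE !clE /=.
by case: (sub2 x y u); case: (sub2 x y v) => //; do 2!case: (has _ _).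
Qed.

(* The transition monoid of the automaton with states q0, q1, q2 and a sink
   which checks that in a word over t, x, y the letter t occurs once, with no
   y before it and with an x between it and the first y:  t : q0 -> q1;
   x : q0 -> q0, q1 -> q2, q2 -> q2;  y : q2 -> q2. *)
Inductive M7 := M7_1 | M7_0 | M7_t | M7_x | M7_y | M7_xy | M7_tx.

Definition M7_code (x : M7) : 'I_7 :=
  match x with
  | M7_1 => inord 0 | M7_0 => inord 1 | M7_t => inord 2 | M7_x => inord 3
  | M7_y => inord 4 | M7_xy => inord 5 | M7_tx => inord 6
  end.
Definition M7_decode (i : 'I_7) : M7 :=
  nth M7_1 [:: M7_1; M7_0; M7_t; M7_x; M7_y; M7_xy; M7_tx] i.
Fact M7_codeK : cancel M7_code M7_decode.
Proof. by case; rewrite /M7_decode inordK. Qed.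
HB.instance Definition _ := Finite.copy M7 (can_type M7_codeK).

Definition M7_mul (a b : M7) : M7 :=
  match a, b with
  | M7_1, c | c, M7_1 => c
  | M7_t, (M7_x | M7_xy) => M7_tx
  | M7_x, M7_t => M7_t
  | M7_x, M7_x => M7_x
  | M7_x, (M7_y | M7_xy) => M7_xy
  | M7_x, M7_tx => M7_tx
  | M7_y, (M7_x | M7_y | M7_xy) => M7_y
  | M7_xy, (M7_x | M7_y | M7_xy) => M7_xy
  | M7_tx, (M7_x | M7_y | M7_xy) => M7_tx
  | _, _ => M7_0
  end.

Fact M7_mulA : associative M7_mul. Proof. by do 3!case. Qed.
Fact M7_mul1 : left_id M7_1 M7_mul. Proof. by case. Qed.
Fact M7_mulr1 : right_id M7_1 M7_mul. Proof. by case. Qed.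
HB.instance Definition _ := isMonoid.Build M7 M7_mulA M7_mul1 M7_mulr1.

Definition M7_lift (a : M7) : E * E :=
  match a with
  | M7_1 => (E_1, E_1) | M7_0 => (E_0, E_1) | M7_t => (E_a, E_c)
  | M7_x => (E_c, E_1) | M7_y => (E_b, E_b) | M7_xy => (E_c, E_b)
  | M7_tx => (E_ac, E_c)
  end.

(* The inverse of [M7_lift], defined on a submonoid of E x E and sending an
   ideal of that submonoid to 0. *)
Definition M7_drop (e : E * E) : option M7 :=
  match e with
  | (E_1, E_1) => Some M7_1
  | (E_0, _) | (E_a, E_b) | (E_ac, E_b) => Some M7_0
  | (E_a, E_c) => Some M7_t | (E_c, E_1) => Some M7_x
  | (E_b, E_b) => Some M7_y | (E_c, E_b) => Some M7_xy
  | (E_ac, E_c) => Some M7_tx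
  | _ => None
  end.

Lemma M7_dropM a e b : M7_drop e = Some b ->
  M7_drop (E_mul (M7_lift a).1 e.1, E_mul (M7_lift a).2 e.2) = Some (M7_mul a b).
Proof. by case: e => e1 e2; case: a; case: e1; case: e2 => //= -[<-]. Qed.

Lemma M7_var_E : var_E M7.
Proof.
apply: birkhoff => u v /variety_of_monoid_identities uv phi /=.
have evalE w : M7_drop (eval_word (fun x => (M7_lift (phi x)).1) w,
                        eval_word (fun x => (M7_lift (phi x)).2) w) =
               Some (eval_word phi w).
  elim: w => [|c w IH]; first by rewrite !eval_word_nil.
  by rewrite !eval_word_cons; exact: (M7_dropM (phi c) IH).
by apply: Some_inj; rewrite -!evalE !uv.
Qed.

Lemma M7_R2_identity : satisfies M7 R2_identity.
Proof.
have H x y t1 t2 :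
    M7_mul y (M7_mul t2 (M7_mul x (M7_mul t1 (M7_mul x (M7_mul y M7_1))))) =
    M7_mul y (M7_mul t2 (M7_mul x (M7_mul t1 (M7_mul y (M7_mul x M7_1))))).
  by case: y; case: x; case: t2; case: t1.
move=> phi; rewrite /R2_identity /= !eval_word_cons !eval_word_nil.
exact: H.
Qed.

Lemma M7_var_R2 : var_R2 M7.
Proof.
split; first exact: M7_var_E.
by move=> e; rewrite inE => /eqP->; exact: M7_R2_identity.
Qed.

Section M7Identities.
Variables t x y : nat.
Hypotheses (tx : t != x) (ty : t != y) (xy : x != y).

Definition M7_point (z : nat) : M7 :=
  if z == t then M7_t else if z == x then M7_x else if z == y then M7_y else M7_1.

Lemma M7_eval u : eval_word M7_point u =
  if t \in u then
    if sub2 t t u || (t \notin pre y u) then M7_0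
    else if sub2 t x (pre y u) then M7_tx
    else if y \in u then M7_0 else M7_t
  else if y \in u then if x \in pre y u then M7_xy else M7_y
  else if x \in u then M7_x else M7_1.
Proof.
elim: u => [|c u IH]; first by rewrite eval_word_nil.
rewrite eval_word_cons IH [(M7_point c * _)%g]/(M7_mul _ _) {IH} /M7_point.
rewrite mem_pre_cons sub2_pre_cons mem_pre_cons /= !in_cons.
have Hy : y \notin u -> pre y u = u by exact: pre_notin.
have Ht := @pre_sub y u t; have Hx := @pre_sub y u x.
have Hs : sub2 t x (pre y u) -> (t \in pre y u) && (x \in pre y u).
  by move=> s; rewrite (sub2_meml s) (sub2_memr s).
case: (eqVneq t c) => [tc|tc].
  rewrite -tc ?eqxx (eq_sym x t) (eq_sym y t) (negbTE ty) (negbTE tx) /=.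
  case: (boolP (t \in u)) => tu /=.
    by case: (sub2 t t u || _); case: (sub2 t x _) => //; case: (y \in u).
  have s0 : sub2 t x (pre y u) = false.
    by apply/negbTE/negP => /Hs/andP[/Ht]; rewrite (negbTE tu).
  have s1 : sub2 t t u = false by apply/negbTE/negP => /sub2_meml; rewrite (negbTE tu).
  rewrite s0 s1 orbF /=; case: (boolP (y \in u)) => [|/Hy->] //=.
    by case: (x \in pre y u).
  by case: (x \in u).
rewrite /=; case: (eqVneq x c) => [xc|xc].
  rewrite -xc ?eqxx (eq_sym y x) (negbTE xy) /=.
  case: (t \in u) => /=.
    case: (sub2 t t u || _) => //; case: (sub2 t x _) => //.
    by case: (y \in u).
  by case: (y \in u); case: (x \in pre y u); case: (x \in u).
case: (eqVneq y c) => [yc|yc] /=.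
  case: (t \in u); first by do !case: ifP.
  case: (y \in u); first by case: ifP.
  by case: ifP.
by do !case: ifP.
Qed.
End M7Identities.

Lemma fresh_letters (u : word) : exists x y : nat, [/\ x \notin u, y \notin u & x != y].
Proof.
pose n := (sumn u).+1.
have F k : n <= k -> k \notin u.
  move=> nk; apply/negP => ku; have : k <= sumn u.
    by elim: u ku {n nk} => //= c u IH; rewrite in_cons => /orP[/eqP->|/IH]; lia.
  by rewrite /n in nk *; lia.
by exists n, n.+1; split; [apply: F|apply: F|]; rewrite /n; lia.
Qed.

(** With [x] and [y] absent, the value tells whether [t] is absent, single or repeated; with [t]
    absent, whether [x] precedes the first [y]; in general, whether [x] lies between a single [t]
    and the first [y]. *)
Lemma M7_identities u v : satisfies M7 (u, v) -> invR u v.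
Proof.
move=> uv.
have mem_sim t : (t \in u) = (t \in v) /\ sub2 t t u = sub2 t t v.
  have [x [y []]] := fresh_letters (t :: u ++ v).
  rewrite !in_cons !mem_cat !negb_or => /and3P[xt xu xv] /and3P[yt yu yv] xy.
  have := uv (M7_point t x y); rewrite /= !M7_eval ?(eq_sym t) //.
  rewrite (negbTE xu) (negbTE xv) (negbTE yu) (negbTE yv) !pre_notin //.
  have n2 w : x \notin w -> sub2 t x w = false.
    by move=> xw; apply/negbTE/negP => /sub2_memr; rewrite (negbTE xw).
  have n3 w : t \notin w -> sub2 t t w = false.
    by move=> xw; apply/negbTE/negP => /sub2_memr; rewrite (negbTE xw).
  rewrite !n2 //; have := n3 u; have := n3 v.
  case: (t \in u); case: (t \in v) => /=; rewrite ?orbF;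
    move: (sub2 t t u) (sub2 t t v) => [] [] //= a b;
    by first [by have := a isT | by have := b isT].
have mem z : (z \in u) = (z \in v) by case: (mem_sim z).
have sim z : sub2 z z u = sub2 z z v by case: (mem_sim z).
split=> // [x y|t x y tu].
  have [->|xy] := eqVneq x y; first by rewrite !(negbTE (notin_pre _ _)).
  have [yu|yu] := boolP (y \in u); last by rewrite !pre_notin -?mem.
  have [t [_ [tn _ _]]] := fresh_letters [:: x, y & u ++ v].
  move: tn; rewrite !in_cons mem_cat !negb_or => /and4P[tx ty tu tv].
  have := uv (M7_point t x y); rewrite /= !M7_eval //.
  by rewrite (negbTE tu) (negbTE tv) -mem yu; do 2!case: (x \in _).
have notT w : t = y -> sub2 t x (pre y w) = false.
  by move=> ->; apply/negbTE/negP => /sub2_meml; rewrite (negbTE (notin_pre _ _)).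
have notX w : x = y -> sub2 t x (pre y w) = false.
  by move=> ->; apply/negbTE/negP => /sub2_memr; rewrite (negbTE (notin_pre _ _)).
have [e|ty] := eqVneq t y; first by rewrite !notT.
have [e|xy] := eqVneq x y; first by rewrite !notX.
have [<-|tx] := eqVneq t x.
  have pre_sub2 w : sub2 t t (pre y w) -> sub2 t t w.
    move=> s; have [yw|yw] := boolP (y \in w); last by rewrite pre_notin in s.
    by have [r ->] := split_first yw; rewrite sub2_cat s.
  by apply/idP/idP => /pre_sub2; rewrite -?sim (negbTE tu).
have := uv (M7_point t x y); rewrite /= !M7_eval //.
rewrite -sim (negbTE tu) -!mem /=.
have H w : sub2 t x (pre y w) -> (t \in w) && (t \in pre y w).
  by move=> /sub2_meml s; rewrite (pre_sub s) s.
have := H u; have := H v; rewrite -mem.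
move: (sub2 t x (pre y u)) (sub2 t x (pre y v)) (t \in u) (y \in u).
by case: (t \in pre y u); case: (t \in pre y v) => -[] [] [] [] //= a b;
  first [by have := a isT | by have := b isT].
Qed.

Section TheoryFacts.
Variables (th : word -> word -> Prop) (thP : theory th).

Lemma th_refl u : th u u. Proof. by case: thP => [[]]. Qed.
Lemma th_sym u v : th u v -> th v u. Proof. by case: thP => [[_ s _ _] _];
  exact: s. Qed.
Lemma th_trans v u w : th u v -> th v w -> th u w.
Proof. by case: thP => [[_ _ t _] _]; exact: t. Qed.
Lemma th_cat u v u' v' : th u v -> th u' v' -> th (u ++ u') (v ++ v').
Proof. by case: thP => [[_ _ _ c] _]; exact: c. Qed.
Lemma th_subst s u v : th u v -> th (subst s u) (subst s v).
Proof. by case: thP => _; apply. Qed.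

Lemma th_ctx p q u v : th u v -> th (p ++ u ++ q) (p ++ v ++ q).
Proof.
move=> uv; apply: th_cat; first exact: th_refl.
by apply: th_cat => //; exact: th_refl.
Qed.

(** The list [l] is a substitution: letter [i] goes to its [i]-th entry, letters beyond its end to
    the empty word. *)
Lemma th_inst (l : seq word) p q u v u' v' : th u v ->
  u' = p ++ subst (nth [::] l) u ++ q -> v' = p ++ subst (nth [::] l) v ++ q ->
  th u' v'.
Proof. by move=> uv -> ->; apply: th_ctx; exact: th_subst. Qed.
End TheoryFacts.

Arguments th_inst {th} thP l p q {u v u' v'}.
Arguments th_ctx {th} thP p q {u v}.
Arguments th_trans {th} thP v {u w}.
Arguments th_refl {th} thP u.

Ltac inst thP l p q H :=
  apply: (th_inst thP l p q H); by rewrite /subst /= ?cats0; do 5!rewrite -?catA /=.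

Lemma E_eval0 (phi : nat -> E) c u : sub2 c c u ->
  (if phi c is (E_a | E_ac | E_0) then true else false) -> eval_word phi u = E_0.
Proof.
move=> /sub2_split[p [q [r ->]]].
rewrite eval_word_cat eval_word_cons eval_word_cat eval_word_cons.
rewrite ![(_ * _)%g]/(E_mul _ _).
by case: (phi c); case: (eval_word phi p); case: (eval_word phi q);
  case: (eval_word phi r).
Qed.

(** A repeated letter with value a, ac or 0 makes both sides zero. Otherwise the values of [a] and
    of the letters of [b] are among 1, b, c, where [x y x = x y], since b and c form a left zero
    band. *)
Lemma E_insert p a b q : sub2 a a (p ++ a :: b ++ q) ->
  (forall c, c \in b -> sub2 c c (p ++ a :: b ++ q)) ->
  satisfies E (p ++ a :: b ++ q, p ++ a :: b ++ a :: q).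
Proof.
move=> aa bb phi /=; set bad := fun c => if phi c is (E_a | E_ac | E_0) then true else false.
have mono c : sub2 c c (p ++ a :: b ++ q) -> sub2 c c (p ++ a :: b ++ a :: q).
  apply: subseq_sub2; rewrite cat_subseq // -!cat_cons cat_subseq //.
  exact: subseq_cons.
have zero c : sub2 c c (p ++ a :: b ++ q) -> bad c ->
    eval_word phi (p ++ a :: b ++ q) = eval_word phi (p ++ a :: b ++ a :: q).
  by move=> s cb; rewrite (E_eval0 s cb) (E_eval0 (mono _ s) cb).
have [abad|agood] := boolP (bad a); first exact: zero aa abad.
have [/hasP[c /bb]|/hasPn bgood] := boolP (has bad b); first exact: zero.
have : if eval_word phi b is (E_a | E_ac | E_0) then false else true.
  elim: b bgood {aa bb mono zero} => [|c b IH] bg; first by rewrite eval_word_nil.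
  have := IH (fun d db => bg d (mem_behead (s := c :: b) db)).
  have := bg c (mem_head _ _); rewrite /bad eval_word_cons [(_ * _)%g]/(E_mul _ _).
  by case: (phi c) => //; case: (eval_word phi b).
move: agood; rewrite /bad !(eval_word_cat, eval_word_cons).
rewrite ![(_ * _)%g]/(E_mul _ _).
by case: (phi a) => // _; case: (eval_word phi b) => // _;
  case: (eval_word phi p); case: (eval_word phi q).
Qed.

(** * The identities of R_2 *)

Section R2Identities.

Let th := identities var_R2.
Let thP : theory th := identities_theory var_R2.

Lemma R2_of_E u v : satisfies E (u, v) -> identities var_R2 u v.
Proof. by move=> /variety_of_monoid_identities uv M [EM _]; exact: uv. Qed.

(** One of the two letters precedes the other in [w]; up to exchanging them, this is an instance of
    [R2_identity]. *)
Lemma R2_swap w x y s : x \in w -> y \in w -> th (w ++ x :: y :: s) (w ++ y :: x :: s).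
Proof.
have R2 : th R2_identity.1 R2_identity.2.
  by move=> M [_ HM]; apply: HM; rewrite inE.
wlog: x y / exists p q r, w = p ++ y :: q ++ x :: r.
  move=> wl xw yw; have [->|xy] := eqVneq x y; first exact: (th_refl thP _).
  have /orP[] := sub2_total xy xw yw.
  - by move=> /sub2_split e; apply: (th_sym thP); apply: wl.
  by move=> /sub2_split e; apply: wl.
case=> p [q [r ->]] _ _.
inst thP [:: [:: x]; [:: y]; r; q] p s R2.
Qed.

Lemma R2_shift w a b s : a \in w -> {subset b <= w} ->
  th (w ++ b ++ a :: s) (w ++ a :: b ++ s).
Proof.
elim: b w => [|c b IH] w aw bw; first exact: (th_refl thP _).
apply: (th_trans thP (w ++ c :: a :: b ++ s)).
  have /= := IH (rcons w c) _ _; rewrite !cat_rcons; apply.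
    by rewrite mem_rcons in_cons aw orbT.
  by move=> d db; rewrite mem_rcons in_cons bw ?orbT // in_cons db orbT.
by apply: R2_swap => //; apply: bw; exact: mem_head.
Qed.

Lemma R2_insert w a v : a \in w -> invR (w ++ v) (w ++ a :: v) ->
  th (w ++ v) (w ++ a :: v).
Proof.
move=> aw [muv suv puv quv].
have aa : sub2 a a (w ++ v) by rewrite suv sub2_cat /= aw in_cons eqxx !orbT.
have [w1 ew] := split_last aw; set b := post a w in ew.
have [/allP bm|/allPn[t tb ts]] := boolP (all (fun c => sub2 c c (w ++ v)) b).
  apply: R2_of_E; rewrite ew -!catA /=; apply: E_insert.
    by move: aa; rewrite {1}ew -catA.
  by move=> c /bm; rewrite {1}ew -catA.
have tw : t \in w by rewrite {1}ew mem_cat in_cons tb !orbT.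
have tv : t \notin v.
  by apply/negP => tv; move: ts; rewrite sub2_cat tw tv !orbT.
have taw : sub2 t a w = false.
  apply/negbTE/negP => s; move: ts; rewrite sub2_cat => /norP[ts _].
  have := @sub2_meml t a w1; have := @sub2_memr t a b; have := notin_post a w.
  rewrite -/b; move: s ts; rewrite ew !sub2_cat /= !in_cons tb eqxx.
  by bool_lia.
have av : a \in v.
  (* For [y] in neither word, [quv] speaks of all that follows [t]. *)
  have [y [_ [yn _ _]]] := fresh_letters (w ++ a :: v).
  have yn' : y \notin w ++ v.
    by move: yn; rewrite !mem_cat in_cons !negb_or => /and3P[-> _ ->].
  have := quv t a y ts; rewrite !pre_notin // !sub2_cat taw /= tw in_cons eqxx.
  by have := @sub2_memr t a v; bool_lia.
have [v1 ev] := split_first av; set b1 := pre a v in ev.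
have b1w : {subset b1 <= w}.
  move=> y yb1; apply/negPn/negP => yw.
  have ya : y != a by apply: contraTneq yb1 => ->; exact: notin_pre.
  have := quv t a y ts; rewrite !sub2_pre_cat sub2_pre_cons mem_pre_cons.
  rewrite pre_notin // taw yw tw ya eqxx /= !orbT.
  case/orP=> [/sub2_meml/pre_sub|]; first by rewrite (negbTE tv).
  by move=> ap; case: (pre_asym ap yb1).
apply: (th_trans thP (w ++ a :: b1 ++ v1)).
  by rewrite {1}ev; apply: R2_shift.
rewrite {1}ev; apply: R2_of_E; apply: E_insert.
  by rewrite sub2_cat /= aw mem_head !orbT.
by move=> c cb; rewrite sub2_cat b1w //= in_cons mem_cat cb !orbT.
Qed.

(** The word [w ++ a :: u] has [a] in this very gap, so by the hypothesis [a] already belongs to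
    every block of [w ++ v] that the new occurrence enters. *)
Lemma invR_insert w a u v : a \in w -> invR (w ++ a :: u) (w ++ v) ->
  invR (w ++ v) (w ++ a :: v).
Proof.
move=> aw [m s p q]; split=> [x|t|x y|t x y ts].
- by rewrite !mem_cat in_cons; case: eqP => [->|] //; rewrite aw.
- have [->|ta] := eqVneq t a.
    by rewrite -s !sub2_cat /= aw !in_cons eqxx !orbT.
  by rewrite !sub2_cat /= in_cons (negbTE ta).
- rewrite !mem_pre_cat mem_pre_cons; case: (boolP (y \in w)) => yw; first by [].
  have ya : y != a by apply: contraNneq yw => ->.
  by rewrite ya /= (pre_notin yw); case: eqP => [->|//]; rewrite aw.
move: (q t x y); rewrite s => /(_ ts).
have ta : t != a.
  apply: contraNneq ts => ->; rewrite -s sub2_cat /= aw mem_head.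
  by rewrite !orbT.
rewrite !sub2_pre_cat !sub2_pre_cons !mem_pre_cons (negbTE ta).
case: (boolP (y \in w)) => yw; first by [].
have ya : y != a by apply: contraNneq yw => ->.
rewrite ya /=; case: (eqVneq x a) => [->|//] /=.
by rewrite !andbT; case: (t \in w); rewrite ?andbF ?orbF // !orbT => <-.
Qed.

(** A next letter that already occurs in [w] is inserted into the other word. When both words
    continue with new letters, these agree, because first occurrences come in the same order. *)
Lemma R2_merge w u v : invR (w ++ u) (w ++ v) -> th (w ++ u) (w ++ v).
Proof.
have [n] := ubnP (size u + size v); elim: n w u v => // n IH w u v sz uv.
have step a u' v' : size u' + size v' < n -> a \in w ->
    invR (w ++ a :: u') (w ++ v') -> th (w ++ a :: u') (w ++ v').
  move=> sz' aw uv'; have ins := invR_insert aw uv'.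
  apply: (th_trans thP (w ++ a :: v')).
    have := IH (rcons w a) u' v'; rewrite !cat_rcons; apply => //.
    exact: invR_trans uv' ins.
  by apply: (th_sym thP); apply: R2_insert.
case: u uv sz => [|e u] uv sz.
  case: v uv sz => [|f v] uv sz; first exact: (th_refl thP _).
  have [fw|fw] := boolP (f \in w); last first.
    by case: uv => /(_ f) + _ _ _; rewrite !mem_cat mem_head orbT (negbTE fw).
  apply: (th_sym thP); apply: step => //; first by move: sz => /=; lia.
  exact: invR_sym.
have [ew|ew] := boolP (e \in w); first by apply: step => //; move: sz => /=; lia.
case: v uv sz => [|f v] uv sz.
  by case: uv => /(_ e) + _ _ _; rewrite !mem_cat mem_head orbT (negbTE ew).
have [fw|fw] := boolP (f \in w).
  apply: (th_sym thP); apply: step => //; first by move: sz => /=; lia.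
  exact: invR_sym.
have [ef|ef] := eqVneq e f.
  rewrite -ef in uv *; have := IH (rcons w e) u v; rewrite !cat_rcons; apply => //.
  by move: sz => /=; lia.
case: uv => _ _ /(_ e f) + _; rewrite !mem_pre_cat !mem_pre_cons.
by rewrite !(pre_notin fw) (negbTE ew) (eq_sym f e) (negbTE ef) !eqxx /= fw.
Qed.
End R2Identities.

Lemma R2_identities u v : identities var_R2 u v <-> invR u v.
Proof.
split=> [uv|uv]; last exact: (@R2_merge [::]).
by apply: M7_identities; apply: uv; exact: M7_var_R2.
Qed.

Lemma S_identities u v : identities var_S u v <-> inv u v.
Proof.
rewrite !variety_join_identities dual_variety_identities !R2_identities.
by rewrite variety_of_monoid_identities A0_identities; split=> [[[]]|[]].
Qed.

(** * Insertion of letters *)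

(** Closure under substitution is inherited from the identities of [var_S] and never checked on the
    invariants. *)
Lemma inv_theory : theory inv.
Proof.
have -> : inv = identities var_S.
  apply: funext => u; apply: funext => v; apply: propext.
  by split=> /S_identities.
exact: identities_theory.
Qed.

Lemma inv_intro u v : (forall x, (x \in u) = (x \in v)) ->
  (forall x y, sub2 x y u = sub2 x y v) ->
  (forall x y, (x \in pre y u) = (x \in pre y v)) ->
  (forall x y, (x \in post y u) = (x \in post y v)) ->
  (forall t x y, ~~ sub2 t t u -> sub2 t x (pre y u) = sub2 t x (pre y v)) ->
  (forall t x y, ~~ sub2 t t u -> sub2 x t (post y u) = sub2 x t (post y v)) ->
  inv u v.
Proof.
move=> m s p q p' q'; split=> //.
split=> [x|t|x y|t x y]; rewrite ?mem_rev ?sub2_rev ?pre_rev ?mem_rev ?sub2_rev //.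
by exact: q'.
Qed.

Section InvElim.
Variables u v : word.
Hypothesis uv : inv u v.

Lemma inv_mem x : (x \in u) = (x \in v). Proof. by case: uv => -[]. Qed.
Lemma inv_sub2 x y : sub2 x y u = sub2 x y v. Proof. by case: uv => -[]. Qed.
Lemma inv_pre x y : (x \in pre y u) = (x \in pre y v).
Proof. by case: uv => _ []. Qed.
Lemma inv_post x y : (x \in post y u) = (x \in post y v).
Proof. by case: uv => _ _ [_ _ /(_ x y)]; rewrite !pre_rev !mem_rev. Qed.
Lemma inv_pre2 t x y : ~~ sub2 t t u -> sub2 t x (pre y u) = sub2 t x (pre y v).
Proof. by case: uv => _ [_ _ _ q] _; exact: q. Qed.
Lemma inv_post2 t x y : ~~ sub2 t t u -> sub2 x t (post y u) = sub2 x t (post y v).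
Proof.
case: uv => _ _ [_ _ _ /(_ t x y)]; rewrite sub2_rev !pre_rev !sub2_rev; exact.
Qed.
End InvElim.

Lemma inv_rev u v : inv u v -> inv (rev u) (rev v).
Proof.
case=> -[m s] r r'; split; rewrite ?revK //.
by split=> *; rewrite ?mem_rev ?sub2_rev.
Qed.

Section Insertion.
Variables (p q : word) (x : nat).
Hypotheses (xp : x \in p) (xq : x \in q).

Lemma insert_mem z : (z \in p ++ x :: q) = (z \in p ++ q).
Proof. by rewrite !mem_cat in_cons; case: eqP => [->|] //; rewrite xp. Qed.

Lemma insert_sub2 a b : sub2 a b (p ++ x :: q) = sub2 a b (p ++ q).
Proof.
rewrite !sub2_cat /= in_cons.
by case: (eqVneq a x) => [->|_] /=; case: (eqVneq b x) => [->|_] /=;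
  rewrite ?xp ?xq; bool_lia.
Qed.

Lemma insert_pre a b : (a \in pre b (p ++ x :: q)) = (a \in pre b (p ++ q)).
Proof.
rewrite !mem_pre_cat mem_pre_cons.
case: (boolP (b \in p)) => // bp; rewrite (pre_notin bp) /=.
have -> /= : b != x by apply: contraNneq bp => ->.
by case: eqP => [->|//]; rewrite xp.
Qed.

Lemma insert_post a b : (a \in post b (p ++ x :: q)) = (a \in post b (p ++ q)).
Proof.
rewrite !mem_post_cat mem_post_cons in_cons negb_or.
case: (boolP (b \in q)) => // bq; first by rewrite !andbF !orbF.
have -> /= : b != x by apply: contraNneq bq => ->.
by case: eqP => [->|//]; rewrite ?orbF ?(post_notin bq) ?xq ?orbT.
Qed.

Lemma insert_pre2 t a b : sub2 t a (pre b (p ++ q)) -> sub2 t a (pre b (p ++ x :: q)).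
Proof.
rewrite !sub2_pre_cat sub2_pre_cons mem_pre_cons.
case: (boolP (b \in p)) => // bp.
have -> /= : b != x by apply: contraNneq bp => ->.
by move: (sub2 t a (pre b q)) (a \in pre b q) (t \in p); bool_lia.
Qed.

Lemma insert_post2 t a b : sub2 a t (post b (p ++ q)) ->
  sub2 a t (post b (p ++ x :: q)).
Proof.
rewrite !sub2_post_cat sub2_post_cons in_cons negb_or.
case: (boolP (b \in q)) => [_|bq]; first by rewrite !andbF !orbF.
have -> /= : b != x by apply: contraNneq bq => ->.
by rewrite in_cons; bool_lia.
Qed.
End Insertion.

(** An occurrence of [x] with others on both sides can only affect the blocks next to letters
    occurring once. The last two hypotheses say that [x] is already in each block that it would
    enter. *)
Lemma inv_insert p x q : x \in p -> x \in q ->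
  (forall t y, ~~ sub2 t t (p ++ q) -> t \in p -> y \notin p ->
     sub2 t x p || (x \in pre y q)) ->
  (forall t y, ~~ sub2 t t (p ++ q) -> t \in q -> y \notin q ->
     sub2 x t q || (x \in post y p)) ->
  inv (p ++ q) (p ++ x :: q).
Proof.
move=> xp xq I1 I2; apply: inv_intro.
- by move=> z; rewrite insert_mem.
- by move=> a b; rewrite insert_sub2.
- by move=> a b; rewrite insert_pre.
- by move=> a b; rewrite insert_post.
- move=> t a b ts; rewrite !sub2_pre_cat sub2_pre_cons mem_pre_cons.
  have tx : t != x.
    by apply: contraNneq ts => ->; rewrite sub2_cat xp xq !orbT.
  case: (boolP (b \in p)) => // bp; rewrite (pre_notin bp) (negbTE tx) /=.
  have -> /= : b != x by apply: contraNneq bp => ->.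
  case: eqP => [->|//] /=; have := I1 t b ts.
  by rewrite bp; case: (t \in p) => // /(_ isT isT) /orP[->|->]; rewrite ?orbT.
move=> t a b ts; rewrite !sub2_post_cat sub2_post_cons in_cons negb_or.
have tx : t != x.
  by apply: contraNneq ts => ->; rewrite sub2_cat xp xq !orbT.
case: (boolP (b \in q)) => // bq; first by rewrite !andbF !orbF.
have -> /= : b != x by apply: contraNneq bq => ->.
rewrite in_cons (negbTE tx) /= (post_notin bq); case: eqP => [->|//] /=;
  last by rewrite orbF.
have := I2 t b ts; rewrite bq; case: (t \in q) => [/(_ isT isT)|_].
  by case/orP=> ->; rewrite ?orbT.
by rewrite !andbF !orbF.
Qed.

Lemma inv_insert_pre p x q t y : inv (p ++ q) (p ++ x :: q) -> x \in p ->
  ~~ sub2 t t (p ++ q) -> t \in p -> y \notin p -> sub2 t x p || (x \in pre y q).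
Proof.
move=> i xp ts tp yp; have := inv_pre2 i x y ts.
have yx : y != x by apply: contraNneq yp => ->.
rewrite !sub2_pre_cat sub2_pre_cons mem_pre_cons (pre_notin yp) tp yp yx eqxx /=.
by rewrite !orbT; have := @sub2_memr t x (pre y q); bool_lia.
Qed.

Lemma inv_insert_post p x q t y : inv (p ++ q) (p ++ x :: q) -> x \in q ->
  ~~ sub2 t t (p ++ q) -> t \in q -> y \notin q -> sub2 x t q || (x \in post y p).
Proof.
move=> i xq ts tq yq; have := inv_post2 i x y ts.
have yx : y != x by apply: contraNneq yq => ->.
rewrite !sub2_post_cat sub2_post_cons (post_notin yq) in_cons negb_or yq yx eqxx tq /=.
by rewrite !orbT; have := @sub2_meml x t (post y p); bool_lia.
Qed.

(** The two-sided form of [invR_insert]. In the dual half a letter [y] that does not occur after the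
    gap has to be absent from [u] as well; the third hypothesis provides this. *)
Lemma inv_insert_common w a u v : a \in w -> a \in v ->
  (forall b, b \in w -> (b \in a :: u) = (b \in v)) ->
  inv (w ++ a :: u) (w ++ v) -> inv (w ++ v) (w ++ a :: v).
Proof.
move=> aw av H uv; apply: inv_insert => // t y ts.
  move=> tw yw; have := inv_pre2 uv (t := t) a y.
  rewrite (inv_sub2 uv) => /(_ ts).
  have ya : y != a by apply: contraNneq yw => ->.
  rewrite !sub2_pre_cat sub2_pre_cons mem_pre_cons (pre_notin yw) tw yw ya eqxx /=.
  by rewrite !orbT; have := @sub2_memr t a (pre y v); bool_lia.
move=> tv yv; have := inv_post2 uv (t := t) a y.
rewrite (inv_sub2 uv) => /(_ ts).
have ya : y != a by apply: contraNneq yv => ->.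
have tw : t \notin w by apply: contraNN ts => tw; rewrite sub2_cat tw tv !orbT.
have ta : t != a by apply: contraNneq tw => ->.
have tu : t \in u.
  have := inv_mem uv t; rewrite !mem_cat in_cons (negbTE tw) (negbTE ta) tv /=.
  by move=> ->.
have yu : y \notin u.
  have := H y; have := inv_mem uv y; rewrite !mem_cat !in_cons; move: yv ya.
  by bool_lia.
rewrite !sub2_post_cat sub2_post_cons (post_notin yv) (post_notin yu) !in_cons.
rewrite yu yv ya eqxx tu tv /= !orbT.
by have := @sub2_meml a t (post y w); bool_lia.
Qed.

Section Merge.
Variables (th : word -> word -> Prop) (thP : theory th).
Hypothesis ins : forall p x q, x \in p -> x \in q ->
  inv (p ++ q) (p ++ x :: q) -> th (p ++ q) (p ++ x :: q).

(* Both words are read from the left.  A letter that is neither a first nor a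
   last occurrence is inserted into the other word; first and last occurrences
   come in the same order in both. *)
Lemma inv_merge w u v : (forall a, a \in w -> (a \in u) = (a \in v)) ->
  inv (w ++ u) (w ++ v) -> th (w ++ u) (w ++ v).
Proof.
have [n] := ubnP (size u + size v); elim: n w u v => // n IH w u v sz H uv.
have step a u' v' : size u' + size v' < n -> a \in w -> a \in u' ->
    (forall b, b \in w -> (b \in a :: u') = (b \in v')) ->
    inv (w ++ a :: u') (w ++ v') -> th (w ++ a :: u') (w ++ v').
  move=> sz' aw au' H' uv'.
  have av' : a \in v' by rewrite -H' // mem_head.
  have i := inv_insert_common aw av' H' uv'.
  apply: (th_trans thP (w ++ a :: v')); last by apply: (th_sym thP); apply: ins.
  have := IH (rcons w a) u' v'; rewrite !cat_rcons; apply => //.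
    move=> b; rewrite mem_rcons in_cons; case: (eqVneq b a) => [-> _|ba bw].
      by rewrite au' av'.
    by have := H' b bw; rewrite in_cons (negbTE ba).
  exact: (th_trans inv_theory _ uv' i).
have H' b : b \in w -> (b \in v) = (b \in u) by move=> /H.
have vu := th_sym inv_theory uv.
case: u uv vu sz H H' => [|e u] uv vu sz H H'.
  case: v uv vu sz H H' => [|f v] uv vu sz H H'; first exact: (th_refl thP).
  have := inv_mem uv f; rewrite !mem_cat mem_head orbT; case: (boolP (f \in w)) => //.
  by move=> /H; rewrite mem_head.
have [/andP[ew eu]|ne] := boolP ((e \in w) && (e \in u)).
  by apply: step => //; move: sz => /=; lia.
case: v uv vu sz H H' => [|f v] uv vu sz H H'.
  have := inv_mem uv e; rewrite !mem_cat mem_head orbT; case: (boolP (e \in w)) => //.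
  by move=> /H; rewrite mem_head.
have [/andP[fw fv]|nf] := boolP ((f \in w) && (f \in v)).
  by apply: (th_sym thP); apply: step => //; move: sz => /=; lia.
have [ef|ef] := eqVneq e f.
  rewrite -ef in uv H nf *; have := IH (rcons w e) u v; rewrite !cat_rcons; apply => //.
    by move: sz => /=; lia.
  move=> b; rewrite mem_rcons in_cons; case: (eqVneq b e) => [-> _|be bw].
    move: ne nf; case: (boolP (e \in w)) => ew /=; first by move=> /negbTE-> /negbTE->.
    move=> _ _; have := inv_sub2 uv e e;
      rewrite !sub2_cat /= !in_cons eqxx (negbTE ew) /= !orbF.
    have S (z : word) : sub2 e e z -> e \in z by exact: sub2_meml.
    have := S u; have := S v; have := S w; rewrite (negbTE ew).
    by bool_lia.
  by have := H b bw; rewrite !in_cons (negbTE be).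
(* Each of [e] and [f] is now a first or a last occurrence; in the four cases their order is
   recorded by [post], [sub2], [sub2] and [pre]. *)
exfalso; have fe : f != e by rewrite eq_sym.
have mem_e := inv_mem uv e; have mem_f := inv_mem uv f.
move: mem_e mem_f; rewrite !mem_cat !in_cons !eqxx (negbTE ef) (negbTE fe) /= !orbT.
case: (boolP (e \in w)) ne => ew /= ne; case: (boolP (f \in w)) nf => fw /= nf.
- move=> _ _; have fu : f \in u by have := H f fw; rewrite !in_cons eqxx (negbTE fe).
  have ev : e \in v by have := H e ew; rewrite !in_cons eqxx (negbTE ef).
  have := inv_post uv f e; have := @post_sub e v f.
  rewrite !mem_post_cat !mem_post_cons !in_cons (post_notin ne).
  by move: ev fu ne nf ef; bool_lia.
- move=> _ _; have ev : e \in v by have := H e ew; rewrite !in_cons eqxx (negbTE ef).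
  have := inv_sub2 uv f e; have := @sub2_meml f e w; have := @sub2_memr f e u.
  by rewrite !sub2_cat /= !in_cons; move: ev fw ne fe ef; bool_lia.
- move=> _ _; have fu : f \in u by have := H f fw; rewrite !in_cons eqxx (negbTE fe).
  have := inv_sub2 uv e f; have := @sub2_meml e f w; have := @sub2_memr e f v.
  by rewrite !sub2_cat /= !in_cons; move: fu ew nf fe ef; bool_lia.
move=> _ _; have := inv_pre uv e f; rewrite !mem_pre_cat !mem_pre_cons.
by rewrite !(pre_notin fw) (negbTE ew) (negbTE fe) !eqxx /= fw.
Qed.
End Merge.

(** * Finite bases under an additional identity *)

Section Cap.
Variable K : nat.

(** All letters from [K] on are absent from a bounded word, so [K] represents them and [inv] becomes
    a finite check, run by [vm_compute] below. *)
Definition cap (z : nat) : nat := if z < K then z else K.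

Definition bounded (u : word) : bool := all (fun z => z < K) u.

Lemma bounded_notin u z : bounded u -> K <= z -> z \notin u.
Proof. by move=> /allP ub zK; apply/negP => /ub; lia. Qed.

Lemma mem_cap u x : bounded u -> (cap x \in u) = (x \in u).
Proof.
move=> ub; rewrite /cap; case: ltnP => // Kx.
by rewrite !(negbTE (bounded_notin ub _)).
Qed.

Lemma sub2_cap u x y : bounded u -> sub2 (cap x) (cap y) u = sub2 x y u.
Proof.
elim: u => //= c u IH /andP[cK ub]; rewrite IH // mem_cap //.
by congr (_ && _ || _); rewrite /cap; case: ltnP => //; lia.
Qed.

Lemma pre_cap u y : bounded u -> pre (cap y) u = pre y u.
Proof.
move=> ub; rewrite /cap; case: ltnP => // Ky.
by rewrite !pre_notin // (bounded_notin ub).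
Qed.

Lemma post_cap u y : bounded u -> post (cap y) u = post y u.
Proof.
move=> ub; rewrite /cap; case: ltnP => // Ky.
by rewrite !post_notin // (bounded_notin ub).
Qed.

Lemma bounded_pre u y : bounded u -> bounded (pre y u).
Proof. by move=> /allP ub; apply/allP => z /pre_sub /ub. Qed.

Lemma bounded_post u y : bounded u -> bounded (post y u).
Proof. by move=> /allP ub; apply/allP => z /post_sub /ub. Qed.

Definition inv_data (u : word) (x y t : nat) : seq bool :=
  [:: x \in u; sub2 x y u; x \in pre y u; x \in post y u;
      ~~ sub2 t t u && sub2 t x (pre y u); ~~ sub2 t t u && sub2 x t (post y u)].

Lemma inv_data_cap u x y t : bounded u ->
  inv_data u (cap x) (cap y) (cap t) = inv_data u x y t.
Proof.
move=> ub; have pb := bounded_pre y ub; have qb := bounded_post y ub.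
by rewrite /inv_data pre_cap // post_cap // !mem_cap // !sub2_cap.
Qed.

Lemma inv_of_data u v :
  (forall x y t, inv_data u x y t = inv_data v x y t) -> inv u v.
Proof.
move=> e; apply: inv_intro => [x|x y|x y|x y|t x y ts|t x y ts].
- by case: (e x 0 0).
- by case: (e x y 0).
- by case: (e x y 0).
- by case: (e x y 0).
- have st : sub2 t t u = sub2 t t v by case: (e t t 0).
  by case: (e x y t) => _ _ _ _; rewrite -st ts.
have st : sub2 t t u = sub2 t t v by case: (e t t 0).
by case: (e x y t) => _ _ _ _ _; rewrite -st ts.
Qed.

Lemma inv_bounded u v : bounded u -> bounded v ->
  {in iota 0 K.+1 & & , forall x y t, inv_data u x y t = inv_data v x y t} ->
  inv u v.
Proof.
move=> ub vb e; apply: inv_of_data => x y t.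
rewrite -inv_data_cap // -[RHS]inv_data_cap //.
by apply: e; rewrite mem_iota /cap; case: ltnP; lia.
Qed.
End Cap.

Definition inv_check (K : nat) (u v : word) : bool :=
  [&& bounded K u, bounded K v &
   all (fun x => all (fun y => all (fun t => inv_data u x y t == inv_data v x y t)
     (iota 0 K.+1)) (iota 0 K.+1)) (iota 0 K.+1)].

Lemma inv_checkP K u v : inv_check K u v -> inv u v.
Proof.
move=> /and3P[ub vb /allP e]; apply: inv_bounded ub vb _ => x y t xK yK tK.
by move/allP: (e x xK) => /(_ y yK) /allP /(_ t tK) /eqP.
Qed.

Definition rev_rel (th : word -> word -> Prop) (u v : word) : Prop :=
  th (rev u) (rev v).

Lemma rev_subst (s : nat -> word) (u : word) :
  rev (subst s u) = subst (rev \o s) (rev u).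
Proof.
elim: u => [|c u IH] //; rewrite rev_cons -cats1 subst_cat -IH /subst /=.
by rewrite cats0 rev_cat.
Qed.

Lemma rev_theory th : theory th -> theory (rev_rel th).
Proof.
move=> thP; split; first split.
- by move=> u; exact: (th_refl thP).
- by move=> u v; exact: (th_sym thP).
- by move=> u v w; exact: (th_trans thP).
- by move=> u v u' v' uv uv'; rewrite /rev_rel !rev_cat; exact: (th_cat thP).
move=> s u v uv; rewrite /rev_rel !rev_subst.
exact: (th_subst thP).
Qed.

(* Large enough for the identities used in the derivations below. *)
Definition short_bound := 12.

Definition short (u : word) : bool := (size u <= short_bound) && bounded short_bound u.

(** The finitely many identities of S that go into a finite basis; the rules below are derived from
    these alone. *)
Definition short_inv (th : word -> word -> Prop) : Prop :=
  forall u v, short u -> short v -> inv u v -> th u v.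

Lemma short_rev u : short (rev u) = short u.
Proof. by rewrite /short size_rev /bounded all_rev. Qed.

Lemma short_inv_rev th : short_inv th -> short_inv (rev_rel th).
Proof. by move=> H u v su sv uv; apply: H; rewrite ?short_rev //; exact: inv_rev. Qed.

Definition alpha_id : identity := ([:: 0; 0; 1; 1], [:: 0; 1; 0; 1])%N.
Definition phi_id : identity := ([:: 0; 2; 0; 1; 0; 1], [:: 0; 2; 1; 0; 0; 1])%N.

(** * Insertions allowed by short identities of S *)

Section Rules.
Variables (th : word -> word -> Prop) (thP : theory th) (thS : short_inv th).

Lemma short_dec u v : [&& short u, short v & inv_check 6 u v] -> th u v.
Proof. by case/and3P=> su sv /inv_checkP; exact: thS. Qed.

Lemma th_dup p x q : x \in q -> th (p ++ x :: q) (p ++ x :: x :: q).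
Proof.
case/splitPr=> q1 q2.
have H : th [:: 0; 1; 0] [:: 0; 0; 1; 0] by apply: short_dec; vm_compute.
inst thP [:: [:: x]; q1] p q2 H.
Qed.

Lemma th_right p x c q : x \in q -> c \in q ->
  th (p ++ x :: c :: q) (p ++ x :: c :: x :: q).
Proof.
move=> xq cq; have [<-|xc] := eqVneq x c; first by apply: th_dup;
  rewrite in_cons xq orbT.
have /orP[/sub2_split|/sub2_split] := sub2_total xc xq cq.
- move=> [q1 [q2 [q3 ->]]].
  have H : th [:: 0; 1; 2; 0; 3; 1] [:: 0; 1; 0; 2; 0; 3; 1] by apply: short_dec;
    vm_compute.
  inst thP [:: [:: x]; [:: c]; q1; q2] p q3 H.
move=> [q1 [q2 [q3 ->]]].
have H : th [:: 0; 1; 2; 1; 3; 0] [:: 0; 1; 0; 2; 1; 3; 0] by apply: short_dec;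
  vm_compute.
inst thP [:: [:: x]; [:: c]; q1; q2] p q3 H.
Qed.

(** The [x] moves through [b] one letter at a time: an auxiliary [x] after [c] starts the induction
    and is removed at the end. *)
Lemma th_right_star p x b q : x \in q -> {subset b <= q} ->
  th (p ++ x :: b ++ q) (p ++ x :: b ++ x :: q).
Proof.
elim: b p => [|c b IH] p xq bq; first exact: th_dup.
have cq : c \in q by apply: bq; exact: mem_head.
have bq' : {subset b <= q} by move=> d db; apply: bq; rewrite in_cons db orbT.
apply: (th_trans thP (p ++ x :: c :: x :: b ++ q)).
  by apply: th_right; rewrite mem_cat ?xq ?cq orbT.
apply: (th_trans thP (p ++ x :: c :: x :: b ++ x :: q)).
  by have := IH (p ++ [:: x; c]) xq bq'; rewrite -!catA.
by apply/(th_sym thP)/th_right; rewrite mem_cat in_cons ?xq ?cq !orbT.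
Qed.

Lemma th_fill_right p m l r : {subset m <= r} -> {subset l <= m} ->
  th (p ++ m ++ r) (p ++ m ++ l ++ r).
Proof.
elim/last_ind: l r => [|l z IH] r mr lm; first exact: (th_refl thP).
have zm : z \in m by apply: lm; rewrite mem_rcons mem_head.
apply: (th_trans thP (p ++ m ++ z :: r)).
  have zr := mr _ zm; have [m1 e] := split_last zm.
  have := @th_right_star (p ++ m1) z (post z m) r zr.
  rewrite -!catA -!cat_cons !(catA m1) -e; apply.
  by move=> d dm; apply: mr; exact: post_sub dm.
rewrite cat_rcons; apply: IH.
  by move=> d /mr dr; rewrite in_cons dr orbT.
by move=> d dl; apply: lm; rewrite mem_rcons in_cons dl orbT.
Qed.
End Rules.

Section LeftRules.
Variables (th : word -> word -> Prop) (thP : theory th) (thS : short_inv th).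

Lemma th_left_star p x b q : x \in p -> {subset b <= p} ->
  th (p ++ b ++ x :: q) (p ++ x :: b ++ x :: q).
Proof.
move=> xp bp.
have := th_right_star (rev_theory thP) (short_inv_rev thS) (rev q)
  (x := x) (b := rev b) (q := rev p).
rewrite /rev_rel !rev_cat !rev_cons !rev_cat !rev_cons !revK -!cats1 -!catA /= -?catA /=.
by apply; [rewrite mem_rev|move=> d; rewrite !mem_rev; exact: bp].
Qed.
End LeftRules.

Lemma sub2_insert c p x q : sub2 c c (p ++ q) -> sub2 c c (p ++ x :: q).
Proof. by apply: subseq_sub2; rewrite cat_subseq // subseq_cons. Qed.

Section PhiRules.
Variables (th : word -> word -> Prop) (thP : theory th) (thS : short_inv th).
Hypothesis phi : th phi_id.1 phi_id.2.

(** The essential case is that [c] is new in [p ++ c :: x :: q] and recurs in [q]. Short identities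
    of S create the factor [c x x c] to which [phi_id] applies, and remove the surplus
    afterwards. *)
Lemma phi_left p x c q : x \in p -> sub2 c c (p ++ c :: x :: q) ->
  th (p ++ c :: x :: q) (p ++ x :: c :: x :: q).
Proof.
move=> xp; have L : {subset [:: c] <= p} ->
  th (p ++ c :: x :: q) (p ++ x :: c :: x :: q).
  by move=> cp; exact: (th_left_star thP thS (b := [:: c]) q xp cp).
have [cp _|cp] := boolP (c \in p); first by apply: L => d; rewrite inE => /eqP->.
have [cx|cx] := eqVneq c x; first by rewrite cx xp in cp.
rewrite sub2_cat (negbTE cp) /= orbF in_cons (negbTE cx) /=.
have -> : sub2 c c p = false by apply/negbTE/negP => /sub2_meml; rewrite (negbTE cp).
move=> /= s; have cq : c \in q by have := @sub2_meml c c q; move: s; bool_lia.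
case/splitPr: xp {L cp} => p1 p2; case/splitPr: cq {s} => q1 q2.
have H1 : th [:: 0; 1; 2; 0; 3; 2] [:: 0; 1; 2; 0; 0; 2; 0; 3; 2]%N.
  by apply: (short_dec thS); vm_compute.
have H2 : th [:: 0; 1; 0; 2; 0; 2; 0; 3; 2] [:: 0; 1; 0; 2; 0; 3; 2]%N.
  by apply: (short_dec thS); vm_compute.
apply: (th_trans thP (p1 ++ x :: p2 ++ c :: x :: x :: c :: x :: q1 ++ c :: q2)).
  inst thP [:: [:: x]; p2; [:: c]; q1] p1 q2 H1.
apply: (th_trans thP (p1 ++ x :: p2 ++ x :: c :: x :: c :: x :: q1 ++ c :: q2)).
  apply: (th_sym thP); inst thP [:: [:: x]; [:: c]; p2] p1 (x :: q1 ++ c :: q2) phi.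
inst thP [:: [:: x]; p2; [:: c]; q1] p1 q2 H2.
Qed.

Lemma phi_left_star p x b q : x \in p ->
  (forall c, c \in b -> sub2 c c (p ++ b ++ x :: q)) ->
  th (p ++ b ++ x :: q) (p ++ x :: b ++ x :: q).
Proof.
move=> xp; elim/last_ind: b q => [|b c IH] q bm.
  exact: (th_left_star thP thS (b := [::]) q xp).
have cm : sub2 c c (p ++ b ++ c :: x :: q).
  by have := bm c; rewrite mem_rcons mem_head cat_rcons; apply.
rewrite !cat_rcons.
apply: (th_trans thP (p ++ b ++ x :: c :: x :: q)).
  have := @phi_left (p ++ b) x c q; rewrite -!catA; apply => //.
  by rewrite mem_cat xp.
apply: (th_trans thP (p ++ x :: b ++ x :: c :: x :: q)).
  apply: IH => d db; rewrite catA; apply: sub2_insert; rewrite -catA.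
  by have := bm d; rewrite mem_rcons in_cons db orbT cat_rcons; apply.
apply: (th_sym thP); have := @phi_left (p ++ x :: b) x c q; rewrite -!catA; apply.
  by rewrite mem_cat xp.
exact: sub2_insert.
Qed.

Lemma phi_fill_left p m l r : {subset l <= p} -> {subset l <= m} ->
  (forall c, c \in m -> sub2 c c (p ++ m ++ r)) ->
  th (p ++ m ++ r) (p ++ l ++ m ++ r).
Proof.
elim: l p => [|z l IH] p lp lm mm; first exact: (th_refl thP).
have zp : z \in p by apply: lp; exact: mem_head.
have zm : z \in m by apply: lm; exact: mem_head.
apply: (th_trans thP (p ++ z :: m ++ r)).
  have [r' e] := split_first zm; rewrite {1 2}e -!catA /=.
  apply: phi_left_star => // c /pre_sub /mm.
  by rewrite {1}e -catA.
have := IH (rcons p z); rewrite !cat_rcons; apply.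
- by move=> d dl; rewrite mem_rcons in_cons lp ?orbT // in_cons dl orbT.
- by move=> d dl; rewrite lm // in_cons dl orbT.
by move=> c cm; apply: sub2_insert; exact: mm.
Qed.
End PhiRules.

Section AlphaRules.
Variables (th : word -> word -> Prop) (thP : theory th) (thS : short_inv th).
Hypothesis alpha : th alpha_id.1 alpha_id.2.

Lemma th_dup_mult p c q : sub2 c c (p ++ c :: q) ->
  th (p ++ c :: q) (p ++ c :: c :: q).
Proof.
have [cq _|cq] := boolP (c \in q); first exact: (th_dup thP thS).
have [cp _|cp] := boolP (c \in p).
  exact: (th_left_star thP thS (b := [::]) q cp).
by move=> /sub2_split[a [b [d e]]]; have := congr1 (count_mem c) e;
  rewrite !count_cat /= count_cat /= !eqxx (count_memPn cp) (count_memPn cq); lia.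
Qed.

(** Doubling the last letter and then, by induction, the rest gives [w w c c], which [alpha_id]
    turns into [w c w c]. *)
Lemma alpha_double p w r : (forall c, c \in w -> sub2 c c (p ++ w ++ r)) ->
  th (p ++ w ++ r) (p ++ w ++ w ++ r).
Proof.
elim/last_ind: w r => [|w c IH] r wm; first exact: (th_refl thP).
have cm : sub2 c c (p ++ w ++ c :: r).
  by have := wm c; rewrite mem_rcons mem_head cat_rcons; apply.
rewrite !cat_rcons.
apply: (th_trans thP (p ++ w ++ c :: c :: r)).
  by rewrite !(catA p); apply: th_dup_mult; rewrite -catA.
apply: (th_trans thP (p ++ w ++ w ++ c :: c :: r)).
  apply: IH => d dw; rewrite catA; apply: sub2_insert; rewrite -catA.
  by have := wm d; rewrite mem_rcons in_cons dw orbT cat_rcons; apply.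
inst thP [:: w; [:: c]] p r alpha.
Qed.
End AlphaRules.

Lemma sub2_before_last c x p b : x \notin b -> c \in b ->
  sub2 c x (p ++ x :: b) -> sub2 c c (p ++ x :: b).
Proof.
rewrite !sub2_cat /= !in_cons; have := @sub2_meml c x p; have := @sub2_memr c x b.
by bool_lia.
Qed.

Section Bases.
Variables (th : word -> word -> Prop) (thP : theory th) (thS : short_inv th).

Definition simple_free (u b : word) : bool := all (fun c => sub2 c c u) b.

(* If a letter occurring once separates the gap from the next x, then every
   letter between the gap and the previous x occurs again later. *)
Lemma insert_after_simple p x q : x \in p -> x \in q ->
  inv (p ++ q) (p ++ x :: q) -> ~~ simple_free (p ++ q) (pre x q) ->
  th (p ++ q) (p ++ x :: q).
Proof.
move=> xp xq i /allPn[t tb ts]; have tq := pre_sub tb.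
have [p1 ep] := split_last xp.
have xt : sub2 x t q = false.
  apply/negbTE/negP => s; move: ts; rewrite sub2_cat => /norP[_ /norP[ts _]].
  have [q' eq] := split_first xq; move: s ts tb (notin_pre x q).
  rewrite eq; set b := pre x q; rewrite pre_cat (negbTE (notin_pre x q)) /= eqxx cats0.
  rewrite !sub2_cat /= !in_cons; have := @sub2_meml x t b.
  have := @sub2_memr x t q'; bool_lia.
rewrite ep -!catA /=; apply: th_right_star => // y yb; apply/negPn/negP => yq.
have := inv_insert_post i xq ts tq yq; rewrite xt /= {1}ep.
rewrite mem_post_cat mem_post_cons in_cons; move: yb (notin_post x p).
by have := @post_sub y (post x p) x; bool_lia.
Qed.

(** By [inv_merge] only insertions matter. Unless a letter occurring once separates the gap from the
    next [x], all letters in between are repeated and [phi_left_star] brings [x] back to the gap. *)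
Lemma phi_basis : th phi_id.1 phi_id.2 -> forall u v, inv u v -> th u v.
Proof.
move=> phi u v uv; apply: (inv_merge thP _ (w := [::])) uv => // p x q xp xq i.
have [/allP sf|] := boolP (simple_free (p ++ q) (pre x q));
  last exact: insert_after_simple.
have [q' eq] := split_first xq; rewrite eq; apply: phi_left_star => // c cb.
by rewrite -eq; exact: sf.
Qed.

(** The hard case has only repeated letters between the gap and the next [x], among them a first
    occurrence of some [y]. A letter occurring once between the previous [x] and the gap would then
    tell the two words apart by its block before [y]. So the whole stretch from [x] to [x] consists
    of repeated letters and can be squared; inside the square the insertion is an instance of a
    short identity. *)
Lemma alpha_basis : th alpha_id.1 alpha_id.2 -> forall u v, inv u v -> th u v.
Proof.
move=> alpha u v uv; apply: (inv_merge thP _ (w := [::])) uv => // p x q xp xq i.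
have [/allP sf|] := boolP (simple_free (p ++ q) (pre x q));
  last exact: insert_after_simple.
have [q' eq] := split_first xq.
have [/allP bp|/allPn[y yb yp]] := boolP (all (mem p) (pre x q)).
  by rewrite eq; apply: th_left_star.
have [p1 ep] := split_last xp.
have sf' c : c \in post x p -> sub2 c c (p ++ q).
  move=> cb; apply/negPn/negP => cs.
  have cp := post_sub cb; have := inv_insert_pre i xp cs cp yp.
  case/orP=> [s|xy]; last exact: (pre_asym xy yb).
  suff : sub2 c c p by move=> cc; rewrite sub2_cat cc in cs.
  by move: s; rewrite ep; apply: sub2_before_last => //; exact: notin_post.
have xx : sub2 x x (p ++ q) by rewrite sub2_cat xp xq !orbT.
set b0 := post x p in ep sf'; set b1 := pre x q in eq sf yb.
have W : p ++ q = p1 ++ (x :: b0 ++ b1 ++ [:: x]) ++ q'.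
  by rewrite ep eq -!catA /= -!catA.
have W' : p ++ x :: q = p1 ++ (x :: b0 ++ x :: b1 ++ [:: x]) ++ q'.
  by rewrite ep eq -!catA /= -!catA /= -!catA.
have mult c : c \in x :: b0 ++ b1 ++ [:: x] -> sub2 c c (p ++ q).
  by rewrite !(in_cons, mem_cat) in_nil orbF => /or4P[/eqP->|/sf'|/sf|/eqP->].
have H : th [:: 0; 1; 2; 0; 0; 1; 2; 0] [:: 0; 1; 0; 2; 0; 0; 1; 0; 2; 0]%N.
  by apply: (short_dec thS); vm_compute.
apply: (th_trans thP (p1 ++ (x :: b0 ++ b1 ++ [:: x]) ++ (x :: b0 ++ b1 ++ [:: x]) ++ q')).
  by rewrite W; apply: alpha_double => // c /mult; rewrite -W.
apply: (th_trans thP (p1 ++ (x :: b0 ++ x :: b1 ++ [:: x]) ++ (x :: b0 ++ x :: b1 ++ [:: x]) ++ q')).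
  inst thP [:: [:: x]; b0; b1] p1 q' H.
apply: (th_sym thP); rewrite W'; apply: alpha_double => // c cm; rewrite -W'.
by apply: sub2_insert; apply: mult; move: cm; rewrite !(in_cons, mem_cat) !in_nil;
  bool_lia.
Qed.
End Bases.

(** * Subvarieties of S *)

(** The features behind these identities, [phi_id] and [alpha_id]: which letters occur ([one_id]),
    which are repeated ([idem_id]), the order of two single letters ([comm_id]), whether a repeated
    letter precedes a single one ([pi_id]), scattered pairs of repeated letters ([alpha_id]), the
    order of first occurrences ([lambda_id]), the block between two single letters ([beta_id]), and
    the block between a single letter and a first occurrence ([phi_id]). *)
Definition one_id : identity := ([:: 0], [::])%N.
Definition idem_id : identity := ([:: 0], [:: 0; 0])%N.
Definition comm_id : identity := ([:: 0; 1], [:: 1; 0])%N.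
Definition pi_id : identity := ([:: 2; 1; 1], [:: 1; 2; 1])%N.
Definition beta_id : identity := ([:: 0; 1; 0; 2; 0], [:: 0; 1; 2; 0])%N.
Definition lambda_id : identity := ([:: 0; 1; 0; 1], [:: 1; 0; 0; 1])%N.

Definition rev_id (e : identity) : identity := (rev e.1, rev e.2).

Definition Lambda0 : seq identity :=
  [:: one_id; idem_id; comm_id; pi_id; beta_id; phi_id; lambda_id; alpha_id].

Definition Lambda : seq identity := Lambda0 ++ map rev_id Lambda0.

Lemma inv_short : short_inv inv. Proof. by []. Qed.

Lemma sub2_count x u : sub2 x x u = (1 < count_mem x u).
Proof.
elim: u => //= c u ->; rewrite (eq_sym c) -has_pred1 has_count.
by case: (x == c) => /=; lia.
Qed.

Lemma filter_pred1_nseq (x : nat) u : filter (pred1 x) u = nseq (count_mem x u) x.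
Proof. by elim: u => //= c u ->; case: eqP => [->|]. Qed.

Lemma inv_nseq p x q i : 0 < i -> (x \in p) || (x \in q) ->
  inv (p ++ nseq i x ++ q) (p ++ x :: q).
Proof.
case: i => // i _ pq; elim: i => [|i IH]; first exact: (th_refl inv_theory).
apply: (th_trans inv_theory _ _ IH); apply: (th_sym inv_theory) => /=.
apply: th_dup_mult; [exact: inv_theory|exact: inv_short|].
by rewrite sub2_count count_cat /= count_cat eqxx; move: pq;
  rewrite -!has_pred1 !has_count; bool_lia.
Qed.

Lemma inv_nseq2 p x q i : 1 < i -> inv (p ++ nseq i x ++ q) (p ++ x :: x :: q).
Proof.
case: i => // i i0; have := @inv_nseq p x (x :: q) i i0.
rewrite mem_head orbT => /(_ isT) /= H; apply: (th_trans inv_theory _ _ H).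
have -> : nseq i x ++ x :: q = x :: nseq i x ++ q.
  by elim: i {i0 H} => //= i ->.
exact: (th_refl inv_theory).
Qed.

(** Both letters are repeated, so the conditions on blocks are void and six comparisons of order
    remain. *)
Lemma inv_two x y u v : x != y -> {subset u <= [:: x; y]} -> {subset v <= [:: x; y]} ->
  [&& sub2 x x u, sub2 y y u, sub2 x x v & sub2 y y v] ->
  sub2 x y u = sub2 x y v -> sub2 y x u = sub2 y x v ->
  (x \in pre y u) = (x \in pre y v) -> (y \in pre x u) = (y \in pre x v) ->
  (x \in post y u) = (x \in post y v) -> (y \in post x u) = (y \in post x v) ->
  inv u v.
Proof.
move=> xy us vs /and4P[xu yu xv yv] s1 s2 p1 p2 q1 q2.
have [xu' yu' xv' yv'] := And4 (sub2_meml xu) (sub2_meml yu) (sub2_meml xv) (sub2_meml yv).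
have mem z : (z \in u) = (z \in v).
  apply/idP/idP => [/us|/vs]; rewrite !inE => /orP[] /eqP->;
    by rewrite ?xu' ?yu' ?xv' ?yv'.
have other (P Q : nat -> bool) : (forall z, P z -> z \in u) -> (forall z, Q z ->
  z \in v) ->
    P x = Q x -> P y = Q y -> forall z, P z = Q z.
  move=> Pu Qv Px Py z; apply/idP/idP => H.
    by have := us _ (Pu _ H); rewrite !inE => /orP[] /eqP e; move: H; rewrite e ?Px ?Py.
  by have := vs _ (Qv _ H); rewrite !inE => /orP[] /eqP e; move: H; rewrite e ?Px ?Py.
have sim t (w : word) : {subset w <= [:: x; y]} -> sub2 x x w -> sub2 y y w ->
    ~~ sub2 t t w -> t \notin w.
  move=> ws xw yw ts; apply/negP => /ws; rewrite !inE => /orP[] /eqP e;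
  by move: ts; rewrite e ?xw ?yw.
apply: inv_intro => //.
- move=> a b; move: b; apply: (other) => [z /sub2_memr|z /sub2_memr||] //.
    by move: a; apply: (other) => [z /sub2_meml|z /sub2_meml||] //; rewrite ?xu ?xv.
  by move: a; apply: (other) => [z /sub2_meml|z /sub2_meml||] //; rewrite ?yu ?yv.
- move=> a b; have [bu|bu] := boolP (b \in u); last by rewrite !pre_notin -?mem.
  have := us _ bu; rewrite !inE => /orP[] /eqP->;
    move: a; apply: (other) => [z /pre_sub|z /pre_sub||] //;
    by rewrite !(negbTE (notin_pre _ _)).
- move=> a b; have [bu|bu] := boolP (b \in u); last by rewrite !post_notin -?mem.
  have := us _ bu; rewrite !inE => /orP[] /eqP->;
    move: a; apply: (other) => [z /post_sub|z /post_sub||] //;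
    by rewrite !(negbTE (notin_post _ _)).
- move=> t a b /(sim t u us xu yu) tu; apply/idP/idP => /sub2_meml/pre_sub.
    by rewrite (negbTE tu).
  by rewrite -mem (negbTE tu).
move=> t a b /(sim t u us xu yu) tu; apply/idP/idP => /sub2_memr/post_sub.
  by rewrite (negbTE tu).
by rewrite -mem (negbTE tu).
Qed.

Lemma filter_none (P : pred nat) u : (forall z, z \in u -> ~~ P z) -> filter P u = [::].
Proof. by move=> H; rewrite (eq_in_filter (a2 := pred0)) ?filter_pred0 // => z /H /negbTE. Qed.

Lemma simple_notin t p q : ~~ sub2 t t (p ++ t :: q) -> (t \notin p) && (t \notin q).
Proof.
rewrite sub2_cat /= in_cons eqxx /= !andbT; case: (t \in p); first by rewrite !orbT.
by case: (t \in q); rewrite ?orbT.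
Qed.

Lemma split_simple t u : t \in u -> ~~ sub2 t t u ->
  exists p q, [/\ u = p ++ t :: q, t \notin p & t \notin q].
Proof. by move=> /splitPr[p q] /simple_notin/andP[]; exists p, q. Qed.

Lemma sub2_cons x y c u : sub2 x y (c :: u) = (x == c) && (y \in u) || sub2 x y u.
Proof. by []. Qed.
Lemma sub2_nil x y : sub2 x y [::] = false. Proof. by []. Qed.
Lemma mem_pre_nil x y : (x \in pre y [::]) = false. Proof. by []. Qed.
Lemma mem_post_nil x y : (x \in post y [::]) = false. Proof. by []. Qed.

Definition wordE := (sub2_cat, sub2_cons, sub2_nil, mem_cat, in_cons, in_nil,
  mem_pre_cat, mem_pre_cons, mem_pre_nil, mem_post_cat, mem_post_cons, mem_post_nil, eqxx).

Section TwoLetters.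
Variables (x y : nat) (a : word).
Hypotheses (xy : x != y) (axy : {subset a <= [:: x; y]}).

Let sub_cat b c : {subset b <= [:: x; y]} -> {subset c <= [:: x; y]} ->
  {subset b ++ c <= [:: x; y]}.
Proof. by move=> bs cs z; rewrite mem_cat => /orP[/bs|/cs]. Qed.

(** The padding by [x] and [y] fixes the order of first and of last occurrences; only the scattered
    subword [y x] remains visible. *)
Lemma inv_xxyy : x \in a -> y \in a -> ~~ sub2 y x a ->
  inv ([:: x] ++ a ++ [:: y]) [:: x; x; y; y].
Proof.
move=> xa ya s; apply: (inv_two xy).
- by apply: sub_cat => [z|]; [rewrite !inE => ->|apply: sub_cat => // z;
    rewrite !inE => ->; rewrite orbT].
- by move=> z; rewrite !inE; bool_lia.
all: rewrite !wordE (eq_sym y x) ?(negbTE xy) /=;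
  move: xa ya s (notin_pre x a) (notin_pre y a) (notin_post x a) (notin_post y a);
    bool_cases.
Qed.

Lemma inv_xyxy : sub2 y x a -> inv ([:: x] ++ a ++ [:: y]) [:: x; y; x; y].
Proof.
move=> s; have xa := sub2_memr s; have ya := sub2_meml s; apply: (inv_two xy).
- by apply: sub_cat => [z|]; [rewrite !inE => ->|apply: sub_cat => // z;
    rewrite !inE => ->; rewrite orbT].
- by move=> z; rewrite !inE; bool_lia.
all: rewrite !wordE (eq_sym y x) ?(negbTE xy) /=;
  move: xa ya s (notin_pre x a) (notin_pre y a) (notin_post x a) (notin_post y a);
    bool_cases.
Qed.

(** After the padding [x x y] only the order of the first occurrences depends on [a]. *)
Lemma inv_first : y \in a -> x \in pre y a ->
  inv (a ++ [:: x; x; y]) [:: x; y; x; y].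
Proof.
move=> ya s; have xa := pre_sub s; apply: (inv_two xy).
- by apply: sub_cat => // z; rewrite !inE; bool_lia.
- by move=> z; rewrite !inE; bool_lia.
all: rewrite !wordE (eq_sym y x) ?(negbTE xy) /=;
  have : y \notin pre x a by apply/negP => /(pre_asym s).
all: move: xa ya s (notin_pre x a) (notin_pre y a) (notin_post x a) (notin_post y a); bool_cases.
Qed.

Lemma inv_second : y \in a -> x \notin pre y a ->
  inv (a ++ [:: x; x; y]) [:: y; x; x; y].
Proof.
move=> ya s; have yx : y != x by rewrite eq_sym.
have yp : y \in pre x a by have := pre_total yx ya; rewrite (negbTE s) orbF.
apply: (inv_two xy).
- by apply: sub_cat => // z; rewrite !inE; bool_lia.
- by move=> z; rewrite !inE; bool_lia.
all: rewrite !wordE (eq_sym y x) ?(negbTE xy) /=.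
all: move: ya s yp (notin_pre x a) (notin_pre y a) (notin_post x a) (notin_post y a); bool_cases.
Qed.
End TwoLetters.

(* If the sides of an identity of th differ in a feature recorded by [inv],
   erasing all letters but the two or three concerned, and padding, leaves one
   of the short identities. *)
Section ErasingLetters.
Variables (th : word -> word -> Prop) (thP : theory th).
Hypothesis thI : forall u v, inv u v -> th u v.

Lemma th_filter (P : pred nat) u v : th u v -> th (filter P u) (filter P v).
Proof.
have e (w : word) : filter P w = subst (fun z => if P z then [:: z] else [::]) w.
  by elim: w => //= c w ->; rewrite /subst /=; case: (P c).
by rewrite !e => uv; exact: (th_subst thP).
Qed.

Lemma th_map (f : nat -> nat) u v : th u v -> th (map f u) (map f v).
Proof.
have e (w : word) : map f w = subst (fun z => [:: f z]) w by elim: w => //= c w ->.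
by rewrite !e => uv; exact: (th_subst thP).
Qed.

Lemma th_via u u' v v' : th u' v' -> inv u' u -> inv v' v -> th u v.
Proof.
move=> uv iu iv; apply: (th_trans thP v'); last exact: thI.
by apply: (th_trans thP u') => //; apply: (th_sym thP); exact: thI.
Qed.

(** Erasing the other letters gives [x^k = 1], hence [x^2 = x^(2k) = 1] and [x = x^3 = x^2 = 1]. *)
Lemma extract_one x u v : th u v -> x \in u -> x \notin v -> th one_id.1 one_id.2.
Proof.
move=> uv xu xv; have := th_map (fun=> 0) (th_filter (pred1 x) uv).
rewrite !filter_pred1_nseq (count_memPn xv) /= !map_nseq.
have : 0 < count_mem x u by rewrite -has_count has_pred1.
move: (count_mem x u) => k k0 H.
have H2 : th [:: 0; 0] [::].
  apply: (th_trans thP (nseq (k + k) 0)).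
    apply: (th_sym thP); apply: thI.
    by have /= := @inv_nseq2 [::] 0 [::] (k + k); rewrite cats0; apply; lia.
  by rewrite nseqD; have := th_cat thP H H.
apply: (th_trans thP [:: 0; 0; 0]).
  by apply: (th_sym thP); have := th_ctx thP [:: 0] [::] H2.
apply: (th_trans thP [:: 0; 0]) => //; apply: thI.
exact: (@inv_nseq2 [::] 0 [::] 3).
Qed.

Lemma extract_idem x u v : th u v -> x \in u -> ~~ sub2 x x u -> sub2 x x v ->
  th idem_id.1 idem_id.2.
Proof.
move=> uv xu; have := th_map (fun=> 0) (th_filter (pred1 x) uv).
rewrite !sub2_count !filter_pred1_nseq !map_nseq => H u1 v1.
have u2 : count_mem x u = 1.
  by move: xu; rewrite -has_pred1 has_count; move: u1; lia.
rewrite u2 in H; apply: (th_trans thP _ H); apply: thI.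
by have /= := @inv_nseq2 [::] 0 [::] (count_mem x v); rewrite cats0; apply.
Qed.

Let ren (x y z : nat) : nat := if z == x then 0 else if z == y then 1 else 2.

Lemma filter_two_simple x y u : x != y -> ~~ sub2 x x u -> ~~ sub2 y y u ->
  sub2 x y u -> filter (pred2 x y) u = [:: x; y].
Proof.
move=> xy xx yy /sub2_split[p [q [r e]]].
have none s : x \notin s -> y \notin s -> filter (pred2 x y) s = [::].
  move=> xs ys; apply: filter_none => z zs; apply/negP => /orP[] /eqP e';
  by move: zs; rewrite e' ?(negbTE xs) ?(negbTE ys).
move: xx yy; rewrite e => /simple_notin/andP[xp].
rewrite mem_cat in_cons !negb_or => /and3P[xq _ xr].
rewrite -cat_cons catA => /simple_notin/andP[]; rewrite mem_cat in_cons !negb_or.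
case/and3P=> yp _ yq yr.
by rewrite -catA filter_cat /= filter_cat /= !eqxx /= orbT !none.
Qed.

Lemma extract_comm x y u v : x != y -> th u v ->
  ~~ sub2 x x u -> ~~ sub2 y y u -> ~~ sub2 x x v -> ~~ sub2 y y v ->
  x \in v -> y \in v -> sub2 x y u -> ~~ sub2 x y v -> th comm_id.1 comm_id.2.
Proof.
move=> xy uv xu yu xv yv xv' yv' s1 s2.
have s3 : sub2 y x v by have := sub2_total xy xv' yv'; rewrite (negbTE s2).
have := th_map (ren x y) (th_filter (pred2 x y) uv).
have eqf : pred2 x y =1 pred2 y x by move=> z /=; rewrite orbC.
rewrite (filter_two_simple xy) // (eq_filter eqf) (filter_two_simple _ yv xv s3) 1?eq_sym //.
by rewrite /ren /= !eqxx (eq_sym y) (negbTE xy).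
Qed.

Lemma filter_pred2_nseq (t y : nat) u : t \notin u ->
  filter (pred2 t y) u = nseq (count_mem y u) y.
Proof.
move=> tu; rewrite -filter_pred1_nseq; apply: eq_in_filter => z zu /=.
by case: eqP => // e; rewrite -e zu in tu.
Qed.

(** With one more [y] at the end, powers of [y] collapse and only the presence of [y] before [t] is
    left. *)
Lemma extract_pi t y u v : t != y -> th u v -> t \in u -> t \in v ->
  ~~ sub2 t t u -> ~~ sub2 t t v -> sub2 y y v ->
  sub2 y t u -> ~~ sub2 y t v -> th pi_id.1 pi_id.2.
Proof.
move=> ty uv tu tv ts ts' yv s1 s2.
have [p [q [eu tp tq]]] := split_simple tu ts.
have [p' [q' [ev tp' tq']]] := split_simple tv ts'.
have H := th_filter (pred2 t y) uv; move: H.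
rewrite eu ev !filter_cat /= !eqxx /= !filter_pred2_nseq // => H.
have yp : y \in p.
  move: s1; rewrite eu sub2_cat /= in_cons eqxx /= andbT.
  have := @sub2_memr y t p; have := @sub2_memr y t q; move: ty tp tq; bool_cases.
have yp' : y \notin p'.
  by apply: contraNN s2 => yp'; rewrite ev sub2_cat yp' mem_head !orbT.
have i0 : 0 < count_mem y p by rewrite -has_count has_pred1.
have k1 : 1 < count_mem y q'.
  move: yv; rewrite sub2_count ev count_cat /= (count_memPn yp').
  by rewrite (negbTE ty).
rewrite (count_memPn yp') /= in H.
have {}H := th_ctx thP [::] [:: y] H.
have {}H : th [:: y; t; y] [:: t; y; y].
  apply: th_via H _ _.
    rewrite -catA /= -[[:: y]]/(nseq 1 y) -nseqD /=.
    apply: (th_trans inv_theory (nseq (count_mem y p) y ++ [:: t; y])).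
      have := @inv_nseq (nseq (count_mem y p) y ++ [:: t]) y [::] (count_mem y q + 1).
      rewrite -!catA cats0 /=; apply; first by rewrite addn1.
      by rewrite !mem_cat mem_nseq i0 eqxx.
    by have := @inv_nseq [::] y [:: t; y] _ i0; rewrite !inE eqxx !orbT; apply.
  rewrite /= -[[:: y]]/(nseq 1 y) -nseqD.
  by have := @inv_nseq2 [:: t] y [::] (count_mem y q' + 1); rewrite cats0; apply;
    rewrite addn1 ltnS ltnW.
by have := th_map (fun z => if z == y then 1 else 2) (th_sym thP H);
  rewrite /= !eqxx (negbTE ty).
Qed.

Lemma filter_subset (P : pred nat) (u s : word) : (forall z, P z -> z \in s) ->
  {subset filter P u <= s}.
Proof. by move=> H z; rewrite mem_filter => /andP[/H]. Qed.

Lemma extract_alpha x y u v : x != y -> th u v -> sub2 x x u -> sub2 y y u ->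
  sub2 x x v -> sub2 y y v -> ~~ sub2 y x u -> sub2 y x v -> th alpha_id.1 alpha_id.2.
Proof.
move=> xy uv xu yu xv yv s1 s2.
have H := th_ctx thP [:: x] [:: y] (th_filter (pred2 x y) uv).
have Pxy z : pred2 x y z -> z \in [:: x; y] by rewrite !inE.
have Px : pred2 x y x by rewrite /= eqxx.
have Py : pred2 x y y by rewrite /= eqxx orbT.
have {}H : th [:: x; x; y; y] [:: x; y; x; y].
  apply: th_via H _ _.
    apply: inv_xxyy => //; first exact: filter_subset.
    - by rewrite mem_filter Px (sub2_meml xu).
    - by rewrite mem_filter Py (sub2_meml yu).
    by rewrite sub2_filter Px Py.
  apply: inv_xyxy => //; first exact: filter_subset.
  by rewrite sub2_filter Px Py.
by have := th_map (ren x y) H; rewrite /ren /= !eqxx (eq_sym y) (negbTE xy).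
Qed.

Lemma extract_lambda x y u v : x != y -> th u v -> x \in u -> y \in u -> y \in v ->
  x \in pre y u -> x \notin pre y v -> th lambda_id.1 lambda_id.2.
Proof.
move=> xy uv xu yu yv s1 s2.
have H := th_ctx thP [::] [:: x; x; y] (th_filter (pred2 x y) uv).
have Pxy z : pred2 x y z -> z \in [:: x; y] by rewrite !inE.
have Px : pred2 x y x by rewrite /= eqxx.
have Py : pred2 x y y by rewrite /= eqxx orbT.
have {}H : th [:: x; y; x; y] [:: y; x; x; y].
  apply: th_via H _ _.
    apply: inv_first => //; first exact: filter_subset.
    - by rewrite mem_filter Py.
    by rewrite pre_filter // mem_filter Px.
  apply: inv_second => //; first exact: filter_subset.
  - by rewrite mem_filter Py.
  by rewrite pre_filter // mem_filter Px.
by have := th_map (ren x y) H; rewrite /ren /= !eqxx (eq_sym y) (negbTE xy).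
Qed.

Lemma extract_beta x t s u v : x != t -> x != s -> t != s -> th u v ->
  ~~ sub2 t t u -> ~~ sub2 t t v -> ~~ sub2 s s u -> ~~ sub2 s s v ->
  s \in u -> s \in v -> t \in pre s u -> t \in pre s v ->
  sub2 t x (pre s u) -> ~~ sub2 t x (pre s v) -> th beta_id.1 beta_id.2.
Proof.
move=> xt xs ts uv tu tv su sv su' sv' tsu tsv xu xv.
have F w : ~~ sub2 t t w -> ~~ sub2 s s w -> s \in w -> t \in pre s w ->
    exists i j k, filter (mem [:: x; t; s]) w =
                  nseq i x ++ t :: nseq j x ++ s :: nseq k x
                  /\ (0 < j) = sub2 t x (pre s w).
  move=> tw sw sw' tsw; have [r e] := split_first sw'.
  case: (splitPr tsw) e (notin_pre s w) => p q e; rewrite mem_cat in_cons !negb_or.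
  case/and3P=> sp _ sq; move: tw sw; rewrite e => tw /simple_notin/andP[_ sr].
  move: tw; rewrite -catA => /simple_notin/andP[tp]; rewrite mem_cat in_cons !negb_or.
  case/and3P=> tq _ tr.
  have N z : t \notin z -> s \notin z -> filter (mem [:: x; t;
    s]) z = nseq (count_mem x z) x.
    move=> tz sz; rewrite -filter_pred1_nseq; apply: eq_in_filter => a az /=.
    rewrite !inE; case: (eqVneq a t) => [at_|_]; first by rewrite -at_ az in tz.
    case: (eqVneq a s) => [as_|_]; first by rewrite -as_ az in sz.
    by rewrite !orbF.
  exists (count_mem x p), (count_mem x q), (count_mem x r).
  rewrite filter_cat /= filter_cat /= !inE !eqxx !orbT !N //; split=> //.
  rewrite -has_count has_pred1 sub2_cat /= in_cons (negbTE xt) eqxx /=.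
  have := @sub2_meml t x p; have := @sub2_meml t x q.
  by move: tp tq; bool_cases.
have [i [j [k [eu ju]]]] := F u tu su su' tsu.
have [i' [j' [k' [ev jv]]]] := F v tv sv sv' tsv.
have H := th_ctx thP [:: x] [:: x] (th_filter (mem [:: x; t; s]) uv).
rewrite eu ev in H; rewrite xu in ju; rewrite (negbTE xv) in jv.
have j0 : j' = 0 by move: jv; lia.
rewrite j0 /= in H.
have {}H : th [:: x; t; x; s; x] [:: x; t; s; x].
  apply: th_via H _ _.
    apply: (th_trans inv_theory [:: x, t & nseq j x ++ s :: nseq (k + 1) x]).
      have := @inv_nseq [::] x (t :: nseq j x ++ s :: nseq (k + 1) x) i.+1 isT.
      rewrite /= nseqD -!catA /= -!catA; apply.
      by rewrite in_cons mem_cat in_cons mem_cat mem_seq1 eqxx !orbT.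
    apply: (th_trans inv_theory [:: x, t, x, s & nseq (k + 1) x]).
      by apply: (@inv_nseq [:: x; t] x (s :: nseq (k + 1) x) j ju); rewrite mem_head.
    by have := @inv_nseq [:: x; t; x; s] x [::] (k + 1); rewrite cats0; apply;
      [rewrite addn1|rewrite mem_head].
  apply: (th_trans inv_theory [:: x, t, s & nseq (k' + 1) x]).
    have := @inv_nseq [::] x (t :: s :: nseq (k' + 1) x) i'.+1 isT.
    rewrite /= nseqD -!catA /=; apply.
    by rewrite !in_cons mem_cat mem_seq1 eqxx !orbT.
  by have := @inv_nseq [:: x; t; s] x [::] (k' + 1); rewrite cats0; apply;
    [rewrite addn1|rewrite mem_head].
by have := th_map (fun z => if z == x then 0 else if z == t then 1 else 2) H;
  rewrite /= !eqxx (eq_sym t x) (negbTE xt) (eq_sym s x) (negbTE xs) (eq_sym s t) (negbTE ts).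
Qed.

Lemma extract_phi x y t u v : x != y -> x != t -> y != t -> th u v ->
  ~~ sub2 t t u -> ~~ sub2 t t v -> t \in pre y u -> t \in pre y v ->
  y \in u -> y \in v ->
  sub2 t x (pre y u) -> ~~ sub2 t x (pre y v) -> th phi_id.1 phi_id.2.
Proof.
move=> xy xt yt uv tu tv tyu tyv yu yv xu xv.
pose P : pred nat := fun z => [|| z == x, z == y | z == t].
have Px : P x by rewrite /P eqxx.
have Py : P y by rewrite /P eqxx orbT.
have Pt : P t by rewrite /P eqxx !orbT.
have F w : ~~ sub2 t t w -> t \in pre y w -> y \in w ->
    exists i q, [/\ filter P w = nseq i x ++ t :: q, {subset q <= [:: x; y]}, y \in q &
                (x \in pre y q) = sub2 t x (pre y w)].
  move=> tw tyw yw; have [p [q [e tp tq]]] := split_simple (pre_sub tyw) tw.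
  have yp : y \notin p.
    apply/negP => yp; move: tyw; rewrite e mem_pre_cat yp /= orbF => /pre_sub.
    by rewrite (negbTE tp).
  exists (count_mem x p), (filter P q); split.
  - rewrite e filter_cat /= Pt; congr (_ ++ _).
    rewrite -filter_pred1_nseq; apply: eq_in_filter => a ap /=; rewrite /P.
    case: (eqVneq a t) => [at_|_]; first by rewrite -at_ ap in tp.
    case: (eqVneq a y) => [ay|_]; first by rewrite -ay ap in yp.
    by rewrite !orbF.
  - move=> a; rewrite mem_filter !inE => /andP[/or3P[->|->|/eqP at_]]; rewrite ?orbT //.
    by rewrite at_ (negbTE tq).
  - rewrite mem_filter Py /=; move: yw; rewrite e mem_cat in_cons (negbTE yp).
    by rewrite (negbTE yt).
  rewrite pre_filter // mem_filter Px /=.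
  rewrite e sub2_pre_cat sub2_pre_cons mem_pre_cons yp yt eqxx /=.
  rewrite (pre_notin yp); have := @sub2_meml t x p; have := @sub2_memr t x (pre y q).
  by move: tp xt; bool_cases.
have [i [q [eu qs yq xq]]] := F u tu tyu yu.
have [i' [q' [ev qs' yq' xq']]] := F v tv tyv yv.
have H := th_ctx thP [:: x] [:: x; x; y] (th_filter P uv).
rewrite eu ev in H.
have B j r : inv ([:: x] ++ (nseq j x ++ t :: r) ++ [:: x; x;
  y]) (x :: t :: (r ++ [:: x; x; y])).
  have := @inv_nseq [::] x (t :: r ++ [:: x; x; y]) j.+1 isT; rewrite /= -!catA; apply.
  by rewrite in_cons mem_cat mem_head !orbT.
have {}H : th [:: x; t; x; y; x; y] [:: x; t; y; x; x; y].
  apply: th_via H _ _; apply: (th_trans inv_theory _ (B _ _));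
    apply: (th_cat inv_theory (u := [:: x; t]) (v := [:: x; t]) (th_refl inv_theory _)).
    by apply: inv_first => //; rewrite xq.
  by apply: inv_second => //; rewrite xq'.
by have := th_map (ren x y) H; rewrite /ren /= !eqxx (eq_sym y) (negbTE xy)
  (eq_sym t) (negbTE xt) (eq_sym t) (negbTE yt).
Qed.
End ErasingLetters.

(** * Two theories with the same identities from [Lambda] *)

Lemma Lambda_rev e : e \in Lambda -> rev_id e \in Lambda.
Proof.
have revK2 d : rev_id (rev_id d) = d by case: d => a b; rewrite /rev_id /= !revK.
rewrite !mem_cat => /orP[e0|/mapP[d d0 ->]]; first by rewrite (map_f rev_id e0) orbT.
by rewrite revK2 d0.
Qed.

(** In the application [th] is the theory of a subvariety W and [th0] that of the subvariety of S
    defined by the members of [Lambda] valid in W. The aim is that [th] is contained in [th0]. The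
    trivial variety is set aside by [set_one], so that [th] preserves the set of letters. *)
Record setting (th0 th : word -> word -> Prop) : Prop := Setting {
  set_th0 : theory th0;
  set_th : theory th;
  set_sub : forall u v, th0 u v -> th u v;
  set_inv : forall u v, inv u v -> th0 u v;
  set_Lambda : forall e, e \in Lambda -> th e.1 e.2 -> th0 e.1 e.2;
  set_one : ~ th one_id.1 one_id.2
}.

Lemma setting_rev th0 th : setting th0 th -> setting (rev_rel th0) (rev_rel th).
Proof.
case=> t0 t s i l o; split.
- exact: rev_theory.
- exact: rev_theory.
- by move=> u v; exact: s.
- by move=> u v /inv_rev; exact: i.
- by move=> e eL; exact: (l (rev_id e) (Lambda_rev eL)).
by [].
Qed.

Lemma exists_max (P : word -> Prop) (f : word -> nat) B u :
  P u -> (forall w, P w -> f w <= B) ->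
  exists2 w, P w & forall w', P w' -> f w' <= f w.
Proof.
move=> Pu fB; have [n] := ubnP (B - f u); elim: n u Pu => // n IH u Pu Bn.
have [[w [Pw uw]]|H] := pselect (exists w, P w /\ f u < f w).
  by apply: (IH w Pw); have := fB _ Pw; move: Bn uw; clear; lia.
exists u => // w Pw; rewrite leqNgt; apply/negP => uw; apply: H; by exists w.
Qed.

Lemma count_le (T : eqType) (a b : pred T) (s : seq T) :
  (forall z, z \in s -> a z -> b z) -> count a s <= count b s.
Proof.
move=> ab; rewrite (eq_in_count (a2 := predI a b)).
  by apply: sub_count => z /andP[].
by move=> z zs /=; case: (boolP (a z)) => // /(ab _ zs) ->.
Qed.

Lemma count_sub_eq (T : eqType) (a b : pred T) (s : seq T) :
  (forall z, z \in s -> a z -> b z) -> count b s <= count a s ->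
  forall z, z \in s -> b z -> a z.
Proof.
move=> + + z zs; case/splitPr: zs => p q ab; rewrite !count_cat /= => le bz.
have ab1 : count a p <= count b p.
  by apply: count_le => x xp; apply: ab; rewrite mem_cat xp.
have ab2 : count a q <= count b q.
  by apply: count_le => x xq; apply: ab; rewrite mem_cat in_cons xq !orbT.
by move: le; rewrite bz; case: (a z) => //; move: ab1 ab2; clear; lia.
Qed.

Section StageOne.
Variables th0 th : word -> word -> Prop.
Hypothesis st : setting th0 th.

Let T0 := set_th0 st.
Let T := set_th st.
Let I0 : forall u v, inv u v -> th0 u v := set_inv st.
Let I u v (uv : inv u v) : th u v := set_sub st (set_inv st uv).

Lemma setting_short : short_inv th0. Proof. by move=> u v _ _; exact: I0. Qed.

Lemma setting_mem u v : th u v -> forall x, (x \in u) = (x \in v).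
Proof.
move=> uv x; apply/idP/idP => H; apply/negPn/negP => H'.
  by case: (set_one st); exact: (extract_one T I uv H H').
by case: (set_one st); exact: (extract_one T I (th_sym T uv) H H').
Qed.

(* Such a u has as many scattered subwords of length two as its class allows,
   so the identities idem, pi and alpha have nothing left to add to it. *)
Definition max1 u : Prop := forall w, th0 u w ->
  (forall x y, sub2 x y u -> sub2 x y w) -> forall x y, sub2 x y w -> sub2 x y u.

Lemma exists_max1 u : exists2 w, th0 u w & max1 w.
Proof.
pose C := undup u; pose pairs := allpairs pair C C.
pose f (w : word) := count (fun e : nat * nat => sub2 e.1 e.2 w) pairs.
have [w uw wmax] := @exists_max (th0 u) f (size pairs) u (th_refl T0 u) (fun w _ => count_size _ _).
exists w => // w' ww' le x y s.
have mw' : forall z, (z \in w') = (z \in u).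
  move=> z; apply: setting_mem; apply: (th_sym T).
  exact: (set_sub st (th_trans T0 _ uw ww')).
have xyP : (x, y) \in pairs.
  by apply/allpairsP; exists (x, y); split=> //=;
    rewrite mem_undup -mw' ?(sub2_meml s) ?(sub2_memr s).
apply: (@count_sub_eq _ (fun e : nat * nat => sub2 e.1 e.2 w)
         (fun e : nat * nat => sub2 e.1 e.2 w') pairs _ _ (x, y)) => //.
  by move=> [a b] _ /=; exact: le.
by apply: wmax; exact: (th_trans T0 w).
Qed.

Lemma max1_trans u w : max1 u -> th0 u w ->
  (forall x y, sub2 x y u -> sub2 x y w) -> max1 w.
Proof.
move=> mu uw le w' ww' le' x y s; apply: (le); apply: (mu w') s.
  exact: (th_trans T0 w).
by move=> a b /le /le'.
Qed.

Lemma max1_idem u x : max1 u -> th idem_id.1 idem_id.2 -> x \in u -> sub2 x x u.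
Proof.
move=> mu H xu; have H0 := set_Lambda st (e := idem_id) isT H.
have [p [q e]] : exists p q, u = p ++ x :: q by case/splitPr: xu => p q; exists p, q.
apply: (mu (p ++ x :: x :: q)).
- by rewrite e; inst T0 [:: [:: x]] p q H0.
- by move=> a b; apply: subseq_sub2; rewrite e cat_subseq // subseq_cons.
by rewrite !wordE !orbT.
Qed.

Lemma max1_pi u y t : max1 u -> th pi_id.1 pi_id.2 -> sub2 y y u -> t \in u ->
  sub2 y t u.
Proof.
move=> mu H yy tu; have H0 := set_Lambda st (e := pi_id) isT H.
apply: (mu (y :: u)).
- have [p [q e]] : exists p q, u = p ++ y :: q.
    by case/splitPr: (sub2_meml yy) => p q; exists p, q.
  apply: (th_trans T0 (p ++ y :: y :: q)).
    by rewrite e; apply: th_dup_mult => //; [exact: setting_short|rewrite -e].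
  by rewrite e; inst T0 [:: [::]; [:: y]; p] ([::] : word) q H0.
- by move=> a b; apply: subseq_sub2; exact: subseq_cons.
by rewrite sub2_cons eqxx tu.
Qed.

(** If all letters from the last [x] to the first [y] were repeated, this stretch could be squared,
    which would create [y x]. So it contains a letter occurring once, and that letter separates
    every [x] from every [y]. *)
Lemma max1_alpha u x y : max1 u -> th alpha_id.1 alpha_id.2 -> x != y ->
  sub2 x x u -> sub2 y y u -> ~~ sub2 y x u ->
  exists t, [/\ t \in u, ~~ sub2 t t u, ~~ sub2 t x u & ~~ sub2 y t u].
Proof.
move=> mu H xy xx yy yx; have H0 := set_Lambda st (e := alpha_id) isT H.
have [p ep] := split_last (sub2_meml xx).
have xb := notin_post x u; set b := post x u in ep xb.
have yb : y \in b.
  move: (sub2_meml yy) yx xy; rewrite ep !wordE (eq_sym y x).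
  by bool_cases.
have [r er] := split_first yb; have ym := notin_pre y b; set m := pre y b in er ym.
have yp : y \notin p by move: yx; rewrite ep !wordE; bool_cases.
have e : u = p ++ (x :: m ++ [:: y]) ++ r by rewrite ep er /= -catA.
have [/allP mm|/allPn[t tm ts]] := boolP (all (fun c => sub2 c c u) (x :: m ++ [:: y])).
  case/negP: yx; apply: (mu (p ++ (x :: m ++ [:: y]) ++ (x :: m ++ [:: y]) ++ r)).
  - rewrite {1}e; apply: alpha_double => //; first exact: setting_short.
    by move=> c /mm; rewrite {1}e.
  - move=> a c; apply: subseq_sub2; rewrite e cat_subseq // -{1}[_ ++ r]cat0s catA.
    by rewrite cat_subseq // suffix_subseq.
  by rewrite !wordE !orbT.
have tx : t != x by apply: contraNneq ts => ->.
have ty : t != y by apply: contraNneq ts => ->.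
have {}tm : t \in m by move: tm; rewrite !wordE (negbTE tx) (negbTE ty) /= orbF.
have [m1 [m2 em]] : exists m1 m2, m = m1 ++ t :: m2.
  by case/splitPr: tm => m1 m2; exists m1, m2.
have e2 : u = (p ++ x :: m1) ++ t :: (m2 ++ y :: r) by rewrite e em;
  do 4!rewrite -?catA /=.
have := ts; rewrite {1}e2 => /simple_notin/andP[t1 t2].
exists t; split=> //; first by rewrite e2 mem_cat mem_head orbT.
  have xm : x \notin m by move: xb; rewrite er mem_cat negb_or => /andP[].
  have := xb; rewrite er em -catA => xb'.
  move: t1 t2 xb' tx; rewrite e2 !wordE.
  have := @sub2_meml t x p; have := @sub2_meml t x m1; have := @sub2_meml t x m2.
  by have := @sub2_meml t x r; bool_cases.
move: t1 t2 ym yp ty xy; rewrite em e2 !wordE (eq_sym y t) (eq_sym y x).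
have := @sub2_meml y t p; have := @sub2_meml y t m1; have := @sub2_memr y t m2.
by have := @sub2_memr y t r; bool_cases.
Qed.
End StageOne.

Lemma max1_rev th0 u : max1 th0 u -> max1 (rev_rel th0) (rev u).
Proof.
move=> mu w uw le x y s; rewrite sub2_rev.
apply: (mu (rev w)); [by rewrite /rev_rel revK in uw| |by rewrite sub2_rev].
by move=> a b s'; rewrite sub2_rev; apply: (le); rewrite sub2_rev.
Qed.

Lemma pre_simple_l x y u : x != y -> ~~ sub2 x x u ->
  (x \in pre y u) = (x \in u) && ~~ sub2 y x u.
Proof.
move=> xy xx; have [xu|xu] := boolP (x \in u); last first.
  by apply/negbTE/negP => /pre_sub; rewrite (negbTE xu).
have [p [q [-> xp xq]]] := split_simple xu xx.
move: xp xq xy; rewrite !wordE (eq_sym y x).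
have := @pre_sub y p x; have := @pre_sub y q x.
have := @sub2_memr y x p; have := @sub2_memr y x q.
by bool_cases.
Qed.

Lemma pre_simple_r x y u : x != y -> y \in u -> ~~ sub2 y y u ->
  (x \in pre y u) = sub2 x y u.
Proof.
move=> xy yu yy; have [p [q [-> yp yq]]] := split_simple yu yy.
rewrite mem_pre_cat (pre_notin yp) mem_pre_cons eqxx andbF orbF.
rewrite !wordE (negbTE xy) /=; have := @sub2_memr x y p; have := @sub2_memr x y q.
by move: yp yq; bool_cases.
Qed.

Lemma sub2_separated t x y u : t \in u -> ~~ sub2 t t u ->
  ~~ sub2 t x u -> ~~ sub2 y t u -> t != x -> t != y -> ~~ sub2 y x u.
Proof.
move=> tu tt; have [p [q [-> tp tq]]] := split_simple tu tt; rewrite !wordE.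
have := @sub2_meml y x p; have := @sub2_memr y x q.
rewrite (eq_sym y t); bool_cases.
Qed.

Section StageOneAgreement.
Variables th0 th : word -> word -> Prop.
Hypothesis st : setting th0 th.

Let T := set_th st.
Let I u v (uv : inv u v) : th u v := set_sub st (set_inv st uv).

Lemma agree_simple u v x : th u v -> max1 th0 v -> sub2 x x u -> sub2 x x v.
Proof.
move=> uv mv xu; have xv : x \in v by rewrite -(setting_mem st uv) (sub2_meml xu).
have [H|H] := pselect (th idem_id.1 idem_id.2); first exact: (max1_idem st).
by apply/negPn/negP => xx; case: H; exact: (extract_idem T I (th_sym T uv) xv xx xu).
Qed.

Lemma agree_sub2_right u v t y : th u v -> max1 th0 u -> max1 th0 v -> t != y ->
  ~~ sub2 t t u -> sub2 y y v -> sub2 y t u -> sub2 y t v.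
Proof.
move=> uv mu mv ty tu yv s.
have tu' := sub2_memr s; have tv' : t \in v by rewrite -(setting_mem st uv).
have tv : ~~ sub2 t t v by apply: contraNN tu; exact: (agree_simple (th_sym T uv)).
have [H|H] := pselect (th pi_id.1 pi_id.2); first exact: (max1_pi st).
by apply/negPn/negP => s'; case: H; exact: (extract_pi T I ty uv tu' tv' tu tv yv s s').
Qed.
End StageOneAgreement.

Section StageOneAll.
Variables th0 th : word -> word -> Prop.
Hypothesis st : setting th0 th.
Hypothesis ncomm : ~ th comm_id.1 comm_id.2.

Let T := set_th st.
Let I u v (uv : inv u v) : th u v := set_sub st (set_inv st uv).

Lemma agree_sub2_left u v t y : th u v -> max1 th0 u -> max1 th0 v -> t != y ->
  ~~ sub2 t t u -> sub2 y y v -> sub2 t y u -> sub2 t y v.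
Proof.
move=> uv mu mv ty tu yv s.
have := @agree_sub2_right _ _ (setting_rev st) (rev u) (rev v) t y.
by rewrite /rev_rel !revK !sub2_rev; apply=> //; exact: max1_rev.
Qed.

(** Pairs involving a letter that occurs once come before pairs of repeated letters: when [alpha_id]
    holds, a pair missing in [v] is blocked by a letter [t] occurring once, and since the pairs with
    [t] agree, [t] blocks it in [u] too. *)
Lemma agree_sub2 u v x y : th u v -> max1 th0 u -> max1 th0 v ->
  sub2 x y u -> sub2 x y v.
Proof.
move=> uv mu mv s; have vu := th_sym T uv.
have [e|xy] := eqVneq x y; first by rewrite -e in s *; exact: (agree_simple st uv).
have yx : y != x by rewrite eq_sym.
have [xu yu] := (sub2_meml s, sub2_memr s).
have [xv yv] : x \in v /\ y \in v by rewrite -!(setting_mem st uv).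
have agr z : sub2 z z u = sub2 z z v.
  by apply/idP/idP; [exact: (agree_simple st uv)|exact: (agree_simple st vu)].
have [xx|xx] := boolP (sub2 x x u); have [yy|yy] := boolP (sub2 y y u).
- have [H|H] := pselect (th alpha_id.1 alpha_id.2); last first.
    apply/negPn/negP => s'; case: H.
    by apply: (extract_alpha T I yx vu) => //; rewrite -?agr.
  apply/negPn/negP => s'.
  have xx' : sub2 x x v by rewrite -agr.
  have yy' : sub2 y y v by rewrite -agr.
  have [t [tv tt t1 t2]] := max1_alpha st mv H yx yy' xx' s'.
  have tu : t \in u by rewrite (setting_mem st uv).
  have tt' : ~~ sub2 t t u by rewrite agr.
  have tx : t != x by apply: contraNneq tt' => ->.
  have ty : t != y by apply: contraNneq tt' => ->.
  suff /negP : ~~ sub2 x y u by [].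
  apply: (sub2_separated tu) => //.
    by apply: contraNN t1; apply: (agree_sub2_left uv) => //; rewrite -agr.
  by apply: contraNN t2; apply: (agree_sub2_right st uv) => //; rewrite -agr.
- by apply: (agree_sub2_right st uv) => //; rewrite -agr.
- by apply: (agree_sub2_left uv) => //; rewrite -agr.
apply/negPn/negP => s'; case: ncomm.
by apply: (extract_comm T xy uv) => //; rewrite -agr.
Qed.

Lemma size_pre_lt a b u : a \in pre b u -> size (pre a u) < size (pre b u).
Proof.
elim: u => //= c u IH; case: (eqVneq b c) => // _; rewrite in_cons.
by case: (eqVneq a c) => //= _ /IH.
Qed.

(** As in bubble sort: an inverted pair with some first occurrence in between contains a closer
    inverted pair. *)
Lemma adjacent_inversion u v x y : (forall z, (z \in u) = (z \in v)) ->
  x \in pre y u -> x \notin pre y v ->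
  exists x' y', [/\ x' \in pre y' u, x' \notin pre y' v &
    forall z, x' \in pre z u -> z \in pre y' u -> False].
Proof.
move=> mem; have [n] := ubnP (size (pre y u) - size (pre x u)).
elim: n x y => // n IH x y Hn xu xv.
have [[z [xz zy]]|H] := pselect (exists z, x \in pre z u /\ z \in pre y u); last first.
  by exists x, y; split=> // z xz zy; apply: H; exists z.
have [s1 s2] := (size_pre_lt xz, size_pre_lt zy).
have [zv|zv] := boolP (x \in pre z v).
  have zv' : z \notin pre y v by apply: contraNN xv; exact: mem_pre_prefix.
  by apply: (IH z y) => //; move: Hn s1 s2; clear; lia.
by apply: (IH x z) => //; move: Hn s1 s2; clear; lia.
Qed.

(** One exchange of neighbouring first occurrences by [lambda_id], realised by putting a single new
    [y] in front of the first [x]. The work lies in the letters [q] between them, which are taken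
    out of the way and restored. *)
Lemma bubble u v x y : th u v -> max1 th0 u -> max1 th0 v ->
  x \in pre y u -> x \notin pre y v ->
  (forall z, x \in pre z u -> z \in pre y u -> False) ->
  exists w, [/\ th0 u w, max1 th0 w, x \notin pre y w,
    forall a b, a \in pre b w -> a \notin pre b v -> a \in pre b u &
    forall a b, (a \in post b w) = (a \in post b u)].
Proof.
move=> uv mu mv xu xv adj; have T0 := set_th0 st; have vu := th_sym T uv.
have mem := setting_mem st uv.
have S a b : sub2 a b u = sub2 a b v.
  by apply/idP/idP; [exact: agree_sub2 uv mu mv|exact: agree_sub2 vu mv mu].
have xy : x != y by apply: contraTneq xu => ->; exact: notin_pre.
have yx : y != x by rewrite eq_sym.
have xu' := pre_sub xu; have xv' : x \in v by rewrite -mem.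
have yv' : y \in v by apply/negPn/negP => yv'; rewrite pre_notin ?xv' in xv.
have yu' : y \in u by rewrite mem.
have yxv : y \in pre x v by have := pre_total yx yv'; rewrite (negbTE xv) orbF.
(* If [x] or [y] occurred once, scattered pairs, which agree, would determine their order. *)
have xx : sub2 x x u.
  by apply/negPn/negP => xx; move: xv; rewrite pre_simple_l // -?S // -mem -pre_simple_l // xu.
have yy : sub2 y y u.
  by apply/negPn/negP => yy; move: xv; rewrite pre_simple_r // -?S // -pre_simple_r // xu.
have lam : th lambda_id.1 lambda_id.2 by exact: (extract_lambda T I xy uv).
have lam0 := set_Lambda st (e := lambda_id) isT lam.
have phi0 : th0 phi_id.1 phi_id.2.
  exact: (th_cat T0 (th_refl T0 [:: 0; 2]) lam0).
have [r er] := split_first yu'; have ya := notin_pre y u.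
have [q eq] := split_first xu.
have px : pre x (pre y u) = pre x u.
  by rewrite {2}er pre_cat xu.
set p := pre x (pre y u) in eq px; set A := pre y u in xu er ya eq adj.
have e : u = p ++ x :: q ++ y :: r by rewrite er eq -catA.
have xp : x \notin p by exact: notin_pre.
have yp : y \notin p by move: ya; rewrite eq mem_cat negb_or => /andP[].
have yq : y \notin q by move: ya; rewrite eq mem_cat in_cons !negb_or => /and3P[].
(* No letter starts between the neighbours [x] and [y]. *)
have qp z : z \in q -> (z \in p) || (z == x).
  move=> zq; apply/negPn/negP; rewrite negb_or => /andP[zp zx].
  apply: (adj z); last by rewrite eq mem_cat in_cons zq !orbT.
  by rewrite e mem_pre_cat mem_pre_cons zp zx eqxx orbT.
have yxu : sub2 y x u.
  rewrite S; have [r' ->] := split_first xv'.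
  by rewrite sub2_cat yxv mem_head !orbT.
have xr : x \in r.
  move: yxu yp yq yx; rewrite e !wordE; have := @sub2_meml y x p.
  by have := @sub2_meml y x q; have := @sub2_memr y x r; bool_cases.
have yr : y \in r.
  move: yy yp yq yx; rewrite e !wordE; have := @sub2_meml y y p.
  by have := @sub2_meml y y q; have := @sub2_memr y y r; bool_cases.
(* In [v] the first [y] precedes every [x], so [x z] being a scattered subword implies the same of
   [y z]. *)
have qr z : z \in q -> z \in r.
  move=> zq; apply/negPn/negP => zr.
  have zy : z != y by apply: contraNneq yq => <-.
  have : ~~ sub2 y z u.
    move: yp yq yx zr zy; rewrite e !wordE; have := @sub2_meml y z p.
    by have := @sub2_meml y z q; have := @sub2_memr y z r; bool_cases.
  rewrite S; have : sub2 x z v by rewrite -S e !wordE zq !orbT.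
  have [r' ->] := split_first xv'; rewrite !sub2_cat /= yxv !in_cons (negbTE yx) /=.
  have := @sub2_meml x z (pre x v); rewrite (negbTE (notin_pre x v)).
  have := @sub2_memr x z r'; bool_cases.
have thS := setting_short st.
have mulu c : c \in x :: q ++ [:: y] -> sub2 c c u.
  rewrite in_cons mem_cat => /or3P[/eqP->//|cq|]; last by rewrite inE => /eqP->.
  by rewrite e !wordE cq qr // !orbT.
exists (p ++ y :: x :: q ++ y :: r).
(* The chain is [p x q y r], [p x q y q y r], [p x y q y r], [p x y x y q y r], [p y x x y q y r],
   [p y x q y r]. *)
have uw : th0 u (p ++ y :: x :: q ++ y :: r).
  apply: (th_trans T0 (p ++ [:: x & q ++ [:: y]] ++ (q ++ [:: y]) ++ r)).
    rewrite {1}e (_ : _ ++ y :: r = (q ++ [:: y]) ++ r) -?cat_cons;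
      last by rewrite -catA.
    apply: (th_fill_right T0 thS).
      move=> z; rewrite in_cons mem_cat => /or3P[/eqP->//|/qr//|].
      by rewrite inE => /eqP->.
    by move=> z; rewrite in_cons => ->; rewrite orbT.
  apply: (th_trans T0 ((p ++ [:: x]) ++ (y :: q) ++ y :: r)).
    have := @phi_fill_left th0 T0 thS phi0 (p ++ [:: x]) (y :: q) q (y :: r).
    rewrite -!catA /= -!catA => H; apply: (th_sym T0); apply: H.
    - by move=> z /qp; rewrite mem_cat inE.
    - by move=> z zq; rewrite in_cons zq orbT.
    move=> c; rewrite in_cons => /orP[/eqP->|cq];
      rewrite !wordE ?yr ?cq ?(qr _ cq) ?orbT //.
  rewrite -catA /=.
  apply: (th_trans T0 (p ++ [:: x; y] ++ [:: x; y] ++ q ++ y :: r)).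
    have := @th_fill_right th0 T0 thS p [:: x; y] [:: x; y] (q ++ y :: r); apply => //.
    by move=> z; rewrite !inE => /orP[] /eqP->; rewrite !wordE ?xr ?orbT.
  apply: (th_trans T0 (p ++ [:: y; x] ++ [:: x; y] ++ q ++ y :: r)).
    by inst T0 [:: [:: x]; [:: y]] p (q ++ y :: r) lam0.
  apply: (th_sym T0).
  have := @th_fill_right th0 T0 thS p [:: y; x] [:: x; y] (q ++ y :: r); apply => //.
    by move=> z; rewrite !inE => /orP[] /eqP->; rewrite !wordE ?xr ?orbT.
  by move=> z; rewrite !inE orbC.
split=> //.
- apply: (max1_trans st mu uw) => a b; apply: subseq_sub2.
  by rewrite e cat_subseq // subseq_cons.
- by rewrite mem_pre_cat (pre_notin yp) (negbTE xp) mem_pre_cons eqxx andbF.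
- move=> a b; rewrite e !wordE; have := qp b; have := qp a.
  case: (eqVneq b x) => [->|bx].
    case: (eqVneq a y) => [->|ay]; first by rewrite yxv.
    by move: xy xp; bool_cases.
  case: (eqVneq b y) => [->|by_]; first by move: yp; bool_cases.
  by move: (a \in pre b v) => ?; bool_cases.
move=> a b; rewrite e !wordE.
have hx : (b == x) ==> (b \in r) by apply/implyP => /eqP->.
have hy : (b == y) ==> (b \in r) by apply/implyP => /eqP->.
by move: hx hy (qr b); bool_cases.
Qed.
End StageOneAll.

Section StageTwo.
Variables th0 th : word -> word -> Prop.
Hypothesis st : setting th0 th.
Hypothesis ncomm : ~ th comm_id.1 comm_id.2.

Let T0 := set_th0 st.
Let T := set_th st.

(** Each [bubble] lowers the number of inversions relative to [v]. Since [post] is unchanged, the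
    mirror image of this lemma can be applied next without undoing the alignment. *)
Lemma align_pre u v : th u v -> max1 th0 u -> max1 th0 v ->
  exists w, [/\ th0 u w, max1 th0 w, forall a b, (a \in pre b w) = (a \in pre b v) &
    forall a b, (a \in post b w) = (a \in post b u)].
Proof.
move=> uv mu mv; pose C := undup v; pose pairs := allpairs pair C C.
pose D (w : word) (e : nat * nat) := (e.1 \in pre e.2 w) && (e.1 \notin pre e.2 v).
have [n] := ubnP (count (D u) pairs); elim: n u uv mu => // n IH u uv mu Dn.
have mem := setting_mem st uv.
have [[x [y [xu xv]]]|H] :=
    pselect (exists x y, x \in pre y u /\ x \notin pre y v); last first.
  exists u; split=> //; first exact: (th_refl T0).
  have le a b : a \in pre b u -> a \in pre b v.
    by move=> au; apply/negPn/negP => av; apply: H; exists a, b.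
  move=> a b; apply/idP/idP; first exact: le.
  move=> av; have au : a \in u by rewrite mem (pre_sub av).
  have ab : a != b by apply: contraTneq av => ->; exact: notin_pre.
  have /orP[//|/le bv] := pre_total ab au.
  by case: (pre_asym av bv).
have [x' [y' [xu' xv' adj]]] := adjacent_inversion mem xu xv.
have [w [uw mw xw le pw]] := bubble st ncomm uv mu mv xu' xv' adj.
have wv : th w v by apply: (th_trans T u) => //; exact: (th_sym T (set_sub st uw)).
have yv' : y' \in v.
  by apply/negPn/negP => yv; rewrite pre_notin // -mem (pre_sub xu') in xv'.
have xyP : (x', y') \in pairs.
  by apply/allpairsP; exists (x', y'); split=> //=;
    rewrite mem_undup // -mem (pre_sub xu').
have lt : count (D w) pairs < count (D u) pairs.
  rewrite ltnNge; apply/negP => H.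
  have : D w (x', y').
    apply: (count_sub_eq _ H) => //; last by rewrite /D /= xu' xv'.
    by move=> [a b] _ /andP[/= aw av]; rewrite /D /= av (le _ _ aw av).
  by rewrite /D /= (negbTE xw).
have [w' [ww' mw' pre' post']] := IH w wv mw (leq_trans lt (ltnSE Dn)).
exists w'; split=> //; first exact: (th_trans T0 w).
by move=> a b; rewrite post'.
Qed.

(* The same for beta and phi, which insert interior occurrences of letters. *)
Definition max3 v : Prop := forall p x q, v = p ++ q -> x \in p -> x \in q ->
  th0 v (p ++ x :: q) -> forall t a b, ~~ sub2 t t v ->
  (sub2 t a (pre b (p ++ x :: q)) -> sub2 t a (pre b v)) /\
  (sub2 a t (post b (p ++ x :: q)) -> sub2 a t (post b v)).

Lemma exists_max3 u : exists w, [/\ th0 u w,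
  forall a b, sub2 a b w = sub2 a b u, forall a b, (a \in pre b w) = (a \in pre b u),
  forall a b, (a \in post b w) = (a \in post b u) & max3 w].
Proof.
pose C := undup u; pose triples := allpairs pair C (allpairs pair C C).
pose F (w : word) (e : nat * (nat * nat)) :=
  ~~ sub2 e.1 e.1 w && sub2 e.1 e.2.1 (pre e.2.2 w).
pose G (w : word) (e : nat * (nat * nat)) :=
  ~~ sub2 e.1 e.1 w && sub2 e.2.1 e.1 (post e.2.2 w).
pose f w := count (F w) triples + count (G w) triples.
pose P w := [/\ th0 u w, forall a b, sub2 a b w = sub2 a b u,
  forall a b, (a \in pre b w) = (a \in pre b u) &
  forall a b, (a \in post b w) = (a \in post b u)].
have Pu : P u by split=> //; exact: (th_refl T0).
have [w [uw sw pw qw] wmax] := @exists_max P f (size triples + size triples) u Pu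
  (fun w _ => leq_add (count_size _ _) (count_size _ _)).
exists w; split=> // p x q ew xp xq ww'.
set w' := p ++ x :: q in ww' *.
have s' a b : sub2 a b w' = sub2 a b w by rewrite ew insert_sub2.
have Pw' : P w'.
  split.
  - exact: (th_trans T0 w).
  - by move=> a b; rewrite s'.
  - by move=> a b; rewrite -pw ew insert_pre.
  by move=> a b; rewrite -qw ew insert_post.
have Fle e : e \in triples -> F w e -> F w' e.
  by move=> _ /andP[s1 s2]; rewrite /F s' s1 /=; move: s2; rewrite ew;
    exact: insert_pre2.
have Gle e : e \in triples -> G w e -> G w' e.
  by move=> _ /andP[s1 s2]; rewrite /G s' s1 /=; move: s2; rewrite ew;
    exact: insert_post2.
have F1 := count_le Fle; have G1 := count_le Gle; have FG := wmax _ Pw'.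
rewrite /f in FG.
have F2 : count (F w') triples <= count (F w) triples 
  by move: F1 G1 FG; move: (count (F w) _) (count (F w') _) (count (G w) _) (count (G w') _); clear; lia.
have G2 : count (G w') triples <= count (G w) triples 
  by move: F1 G1 FG; move: (count (F w) _) (count (F w') _) (count (G w) _) (count (G w') _); clear; lia.
have mw z : (z \in w) = (z \in u).
  by apply/esym/(setting_mem st)/(set_sub st).
have mw' z : (z \in w') = (z \in w) by rewrite ew insert_mem.
have inT t a b : t \in w -> a \in w -> b \in w -> (t, (a, b)) \in triples.
  rewrite !mw => tu au bu; apply/allpairsP; exists (t, (a, b)); split;
    rewrite ?mem_undup //=.
  by apply/allpairsP; exists (a, b); split; rewrite ?mem_undup.
move=> t a b ts; have [bw|bw] := boolP (b \in w); last first.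
  by rewrite !pre_notin ?mw' // !post_notin ?mw' // !s'.
split=> s.
  have tw : t \in w by rewrite -mw' (pre_sub (sub2_meml s)).
  have aw : a \in w by rewrite -mw' (pre_sub (sub2_memr s)).
  have : F w (t, (a, b)).
    by apply: (count_sub_eq Fle F2); [exact: inT|rewrite /F /= s' ts].
  by case/andP.
have tw : t \in w by rewrite -mw' (post_sub (sub2_memr s)).
have aw : a \in w by rewrite -mw' (post_sub (sub2_meml s)).
have : G w (t, (a, b)).
  by apply: (count_sub_eq Gle G2); [exact: inT|rewrite /G /= s' ts].
by case/andP.
Qed.
End StageTwo.

Lemma max3_rev th0 v : max3 th0 v -> max3 (rev_rel th0) (rev v).
Proof.
move=> mv p x q e xp xq vw t a b; rewrite sub2_rev => ts.
have ev : v = rev q ++ rev p by rewrite -rev_cat -e revK.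
have := mv (rev q) x (rev p) ev; rewrite !mem_rev => /(_ xq xp).
have er : rev q ++ x :: rev p = rev (p ++ x :: q) by rewrite rev_cat rev_cons cat_rcons.
rewrite er => /(_ _ t a b ts) H; have [] := H.
  by move: vw; rewrite /rev_rel revK.
rewrite pre_rev post_rev !sub2_rev => H1 H2; split.
  by rewrite pre_rev sub2_rev.
by rewrite post_rev sub2_rev.
Qed.

Section StageThree.
Variables th0 th : word -> word -> Prop.
Hypothesis st : setting th0 th.

Let T0 := set_th0 st.
Let T := set_th st.
Let I u v (uv : inv u v) : th u v := set_sub st (set_inv st uv).

Variables u v : word.
Hypotheses (uv : th u v) (S : forall a b, sub2 a b u = sub2 a b v).
Hypothesis mv : max3 th0 v.

Let mem := setting_mem st uv.

(** A difference would yield [beta_id]. By agreement of scattered pairs [x] occurs in [v] before [t]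
    and after [s], so [beta_id] puts an [x] right after [t], against [max3]. *)
Lemma block_content_le t x s : ~~ sub2 t t u -> ~~ sub2 s s u ->
  sub2 t x (pre s u) -> sub2 t x (pre s v).
Proof.
move=> tt ss H; have [su|su] := boolP (s \in u); last first.
  by move: H; rewrite !pre_notin -?mem // S.
have sv : s \in v by rewrite -mem.
have tsu := sub2_meml H; have xsu := sub2_memr H.
have ts : t != s by apply: contraTneq tsu => ->; exact: notin_pre.
have xs : x != s by apply: contraTneq xsu => ->; exact: notin_pre.
have sub_pre a b w : sub2 a b (pre s w) -> sub2 a b w.
  have [sw|sw] := boolP (s \in w); last by rewrite pre_notin.
  by have [r {2}->] := split_first sw; rewrite sub2_cat => ->.
have xt : x != t by apply: contraNneq tt => e; rewrite -{2}e; exact: sub_pre.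
have [ttv ssv] : ~~ sub2 t t v /\ ~~ sub2 s s v by rewrite -!S.
have tsv : t \in pre s v by rewrite pre_simple_r // -S -pre_simple_r.
apply/negPn/negP => Hv.
have [bet|nb] := pselect (th beta_id.1 beta_id.2); last first.
  by apply: nb; exact: (extract_beta T I xt xs ts uv).
have bet0 := set_Lambda st (e := beta_id) isT bet.
have [c ec] := split_first sv.
have [a [b eab]] : exists a b, pre s v = a ++ t :: b.
  by case/splitPr: tsv => a b; exists a, b.
have e : v = (a ++ [:: t]) ++ (b ++ s :: c) by rewrite ec eab -!catA.
have xb : x \notin b.
  by apply: contraNN Hv => xb; rewrite eab sub2_cat sub2_cons eqxx xb orbT.
have xsv : sub2 x s v by rewrite -S -pre_simple_r.
have xa : x \in a.
  have : x \in pre s v by rewrite pre_simple_r.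
  by rewrite eab mem_cat in_cons (negbTE xt) (negbTE xb) !orbF.
have xc : x \in c.
  have : sub2 t x v by rewrite -S; exact: sub_pre.
  have tc : t \notin c /\ t \notin a.
    by move: ttv; rewrite e -catA => /simple_notin/andP[-> ];
      rewrite mem_cat in_cons !negb_or => /and3P[].
  have tb : t \notin b.
    by move: ttv; rewrite e -catA => /simple_notin/andP[_];
      rewrite mem_cat in_cons !negb_or => /and3P[].
  case: tc; move: tb xb ts xs; rewrite e !wordE.
  have := @sub2_meml t x a; have := @sub2_meml t x b; have := @sub2_meml t x c.
  by bool_cases.
have [a1 [a2 ea]] : exists a1 a2, a = a1 ++ x :: a2.
  by case/splitPr: xa => a1 a2; exists a1, a2.
have [c1 [c2 ecc]] : exists c1 c2, c = c1 ++ x :: c2.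
  by case/splitPr: xc => c1 c2; exists c1, c2.
have ins : th0 v ((a ++ [:: t]) ++ x :: (b ++ s :: c)).
  apply: (th_sym T0); rewrite e ea ecc.
  by inst T0 [:: [:: x]; a2 ++ [:: t]; b ++ s :: c1] a1 c2 bet0.
have [||H1 _] := mv e _ _ ins (t := t) x s ttv.
- by rewrite mem_cat xa.
- by rewrite mem_cat in_cons xc !orbT.
case/negP: Hv; apply: H1.
have sa : s \notin a ++ [:: t].
  have := notin_pre s v; rewrite eab !mem_cat !in_cons !negb_or.
  by case/and3P=> -> ->.
by rewrite sub2_pre_cat sub2_pre_cons mem_pre_cons sa (eq_sym s x) xs eqxx mem_cat mem_seq1 eqxx !orbT.
Qed.

Hypothesis Pr : forall a b, (a \in pre b u) = (a \in pre b v).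

(** For repeated [y] a difference would yield [phi_id], which inserts [x] before the first [y] of
    [v], against [max3], unless some [s] occurring once lies between that [y] and the next [x]. Then
    [x] is missing between [t] and [s] in [v] but not in [u], which [block_content_le] forbids. *)
Lemma first_order_le t x y : ~~ sub2 t t u ->
  sub2 t x (pre y u) -> sub2 t x (pre y v).
Proof.
move=> tt H; have [yy|yy] := boolP (sub2 y y u); last exact: block_content_le.
have yu := sub2_meml yy; have yv : y \in v by rewrite -mem.
have tyu := sub2_meml H; have xyu := sub2_memr H.
have ty : t != y by apply: contraTneq tyu => ->; exact: notin_pre.
have xy : x != y by apply: contraTneq xyu => ->; exact: notin_pre.
have sub_pre a b w : sub2 a b (pre y w) -> sub2 a b w.
  have [sw|sw] := boolP (y \in w); last by rewrite pre_notin.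
  by have [r {2}->] := split_first sw; rewrite sub2_cat => ->.
have xt : x != t by apply: contraNneq tt => e; rewrite -{2}e; exact: sub_pre.
have ttv : ~~ sub2 t t v by rewrite -S.
have tyv : t \in pre y v by rewrite -Pr.
have xyv : x \in pre y v by rewrite -Pr.
have [xtu|xtu] := boolP (sub2 x t v); last first.
  have tx : t != x by rewrite eq_sym.
  have /orP[//|/sub_pre] := sub2_total tx tyv xyv.
  by rewrite (negbTE xtu).
apply/negPn/negP => Hv.
have [phi|np] := pselect (th phi_id.1 phi_id.2); last first.
  by apply: np; apply: (extract_phi T I xy xt _ uv) => //; rewrite eq_sym.
have phi0 := set_Lambda st (e := phi_id) isT phi.
have [b eb] := split_first yv; have ya := notin_pre y v;
  set a := pre y v in tyv xyv Hv eb ya.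
have xb : x \in b.
  have : sub2 t x v by rewrite -S; exact: sub_pre.
  have tb : t \notin b.
    have [a1 [a2 ea]] : exists a1 a2, a = a1 ++ t :: a2.
      by case/splitPr: tyv => a1 a2; exists a1, a2.
    move: ttv; rewrite eb ea -catA => /simple_notin/andP[_].
    by rewrite mem_cat in_cons !negb_or => /and3P[].
  move: tb Hv ty xy; rewrite {1}eb !wordE.
  by have := @sub2_meml t x b; bool_cases.
have [b2 eb2] := split_first xb; have xb1 := notin_pre x b;
  set b1 := pre x b in eb2 xb1.
have [/allP mb|/allPn[s sb ss]] := boolP (all (fun c => sub2 c c v) (y :: b1)).
  have e : v = a ++ y :: b by [].
  have ins : th0 v (a ++ x :: y :: b).
    rewrite {1}e eb2 -!cat_cons.
    apply: (phi_left_star T0 (setting_short st) phi0) => // c /mb.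
    by rewrite {1}e eb2 -cat_cons.
  have [|H1 _] := mv e xyv _ ins (t := t) x y ttv.
    by rewrite in_cons xb orbT.
  case/negP: Hv; apply: H1.
  by rewrite sub2_pre_cat ya tyv /= (eq_sym y x) (negbTE xy) mem_head !orbT.
have sy : s != y by apply: contraNneq ss => ->; rewrite -S.
have {}sb : s \in b1 by move: sb; rewrite in_cons (negbTE sy).
have ysv : sub2 y s v.
  by rewrite eb !wordE {1}eb2 mem_cat sb !orbT.
have ssu : ~~ sub2 s s u by rewrite S.
have su : s \in u by rewrite mem (sub2_memr ysv).
have ys : y \in pre s u by rewrite pre_simple_r ?S // eq_sym.
have := block_content_le tt ssu (sub2_pre_prefix H ys).
have sa : s \notin a.
  by apply: contraNN ss => sa; rewrite eb sub2_cat sa in_cons eb2 mem_cat sb !orbT.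
have x1 : x \notin pre s b by rewrite eb2 mem_pre_cat sb orbF; apply: contraNN xb1;
  exact: pre_sub.
have := @sub2_memr t x (pre s b); rewrite {1}eb sub2_pre_cat sub2_pre_cons mem_pre_cons.
by rewrite (pre_notin sa); move: Hv x1 xy; bool_cases.
Qed.
End StageThree.

(** * The commutative case *)

Section Commutative.
Variables (th0 : word -> word -> Prop) (T0 : theory th0).
Hypothesis I0 : forall u v, inv u v -> th0 u v.
Hypothesis comm : th0 comm_id.1 comm_id.2.

Lemma comm_perm u v : perm_eq u v -> th0 u v.
Proof.
move=> uv; apply: (@catCA_perm_ind _ (th0 u) _ u v uv); last exact: (th_refl T0).
move=> a b c H; apply: (th_trans T0 _ H).
inst T0 [:: a; b] ([::] : word) c comm.
Qed.

(** Words may be sorted, and in S all powers of a letter with exponent at least two coincide. *)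
Lemma comm_eq u v : (forall x, (x \in u) = (x \in v)) ->
  (forall x, sub2 x x u = sub2 x x v) -> th0 u v.
Proof.
move=> mem sim; pose nf (c : nat -> nat) (s : seq nat) := flatten [seq nseq (c x) x | x <- s].
have uv : perm_eq (undup u) (undup v).
  by apply: uniq_perm; rewrite ?undup_uniq // => x; rewrite !mem_undup.
apply: (th_trans T0 (nf (fun x => count_mem x u) (undup u))).
  by apply: comm_perm; rewrite perm_sym perm_count_undup.
apply: (th_trans T0 (nf (fun x => count_mem x v) (undup u))); last first.
  apply: comm_perm; apply: perm_trans (perm_count_undup v).
  by apply: perm_flatten; exact: perm_map.
have : {subset undup u <= u} by move=> x; rewrite mem_undup.
elim: (undup u) => [|x s IH] su; first exact: (th_refl T0).
apply: (th_cat T0); last by apply: IH => y ys; apply: su; rewrite in_cons ys orbT.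
have xu : x \in u by apply: su; exact: mem_head.
have := sim x; rewrite !sub2_count.
have [cu cv] : 0 < count_mem x u /\ 0 < count_mem x v.
  by rewrite -!has_count !has_pred1 -mem.
case: (ltnP 1 (count_mem x u)) => [c1 /esym c2|c1 /esym/negbT c2].
  apply: I0; have /= H1 := @inv_nseq2 [::] x [::] _ c1;
    have /= H2 := @inv_nseq2 [::] x [::] _ c2.
  rewrite !cats0 in H1 H2.
  exact: (th_trans inv_theory _ H1 (th_sym inv_theory H2)).
have -> : count_mem x u = count_mem x v by move: c1 c2 cu cv; clear; lia.
exact: (th_refl T0).
Qed.
End Commutative.

(** Both words are changed within [th0] until [inv] relates them: [max1] settles scattered pairs,
    [align_pre] and its mirror image the first and last occurrences, [max3] the blocks. Each stage
    keeps what the earlier ones have settled. *)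
Lemma setting_eq th0 th : setting th0 th -> forall u v, th u v -> th0 u v.
Proof.
move=> st u v uv; have T0 := set_th0 st; have T := set_th st.
have [u1 uu1 mu1] := exists_max1 st u; have [v1 vv1 mv1] := exists_max1 st v.
have thw a b a' b' : th a b -> th0 a a' -> th0 b b' -> th a' b'.
  move=> ab aa bb; apply: (th_trans T b); last exact: (set_sub st).
  by apply: (th_trans T a) => //; exact: (th_sym T (set_sub st aa)).
have u1v1 : th u1 v1 by exact: thw uv uu1 vv1.
suff H : th0 u1 v1.
  apply: (th_trans T0 v1); last exact: (th_sym T0).
  exact: (th_trans T0 u1).
have [comm|ncomm] := pselect (th comm_id.1 comm_id.2).
  have comm0 := set_Lambda st (e := comm_id) isT comm.
  apply: (comm_eq T0 (set_inv st) comm0); first exact: (setting_mem st u1v1).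
  move=> x; apply/idP/idP; first exact: (agree_simple st u1v1).
  exact: (agree_simple st (th_sym T u1v1)).
have [u2 [u12 mu2 pre2 _]] := align_pre st ncomm u1v1 mu1 mv1.
have u2v1 : th u2 v1 := thw _ _ _ _ u1v1 u12 (th_refl T0 _).
have ncomm' : ~ rev_rel th comm_id.1 comm_id.2.
  by move=> H; apply: ncomm; exact: (th_sym T H).
have revuv : rev_rel th (rev u2) (rev v1) by rewrite /rev_rel !revK.
have [w [u2w mw prew postw]] :=
  align_pre (setting_rev st) ncomm' revuv (max1_rev mu2) (max1_rev mv1).
pose u3 := rev w.
have u23 : th0 u2 u3 by move: u2w; rewrite /rev_rel revK.
have mu3 : max1 th0 u3.
  by have := max1_rev mw; rewrite /max1 /rev_rel => H x ux; apply: H; rewrite !revK.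
have u3v1 : th u3 v1 := thw _ _ _ _ u2v1 u23 (th_refl T0 _).
have pre3 a b : (a \in pre b u3) = (a \in pre b v1).
  by rewrite -pre2 /u3 pre_rev mem_rev postw post_rev mem_rev.
have post3 a b : (a \in post b u3) = (a \in post b v1).
  by rewrite /u3 post_rev mem_rev prew pre_rev mem_rev.
have sub3 a b : sub2 a b u3 = sub2 a b v1.
  apply/idP/idP; first exact: (agree_sub2 st ncomm u3v1 mu3 mv1).
  exact: (agree_sub2 st ncomm (th_sym T u3v1) mv1 mu3).
have [u4 [u34 su4 pu4 qu4 mu4]] := exists_max3 st u3.
have [v4 [v14 sv4 pv4 qv4 mv4]] := exists_max3 st v1.
have uv4 : th u4 v4 := thw _ _ _ _ u3v1 u34 v14.
have vu4 := th_sym T uv4.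
have sub4 a b : sub2 a b u4 = sub2 a b v4 by rewrite su4 sv4.
have pre4 a b : (a \in pre b u4) = (a \in pre b v4) by rewrite pu4 pv4.
have post4 a b : (a \in post b u4) = (a \in post b v4) by rewrite qu4 qv4.
suff H : inv u4 v4.
  apply: (th_trans T0 u3); first exact: (th_trans T0 u2).
  apply: (th_trans T0 u4) => //; apply: (th_trans T0 v4); first exact: (set_inv st).
  exact: (th_sym T0).
apply: inv_intro => //; first exact: (setting_mem st uv4).
  move=> t x y ts; apply/idP/idP.
    exact: (first_order_le st uv4 sub4 mv4 pre4 ts).
  apply: (first_order_le st vu4 _ mu4); rewrite -?sub4 //.
move=> t x y ts; have st' := setting_rev st.
have rev4 a b : (a \in pre b (rev u4)) = (a \in pre b (rev v4)).
  by rewrite !pre_rev !mem_rev.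
have srev4 a b : sub2 a b (rev u4) = sub2 a b (rev v4) by rewrite !sub2_rev.
have ruv4 : rev_rel th (rev u4) (rev v4) by rewrite /rev_rel !revK.
have ts' : ~~ sub2 t t (rev u4) by rewrite sub2_rev.
have postE z : sub2 x t (post y z) = sub2 t x (pre y (rev z)) by rewrite pre_rev sub2_rev.
rewrite !postE; apply/idP/idP.
  exact: (first_order_le st' ruv4 srev4 (max3_rev mv4) rev4 ts').
apply: (first_order_le st' (th_sym (set_th st') ruv4) _ (max3_rev mu4));
  rewrite -?srev4 //.
Qed.

(** * Classification of the subvarieties *)

Definition Lambda_of (W : variety) : seq identity :=
  [seq e <- Lambda | `[< identities W e.1 e.2 >]].

Definition part_S (L : seq identity) : variety := defined_within var_S (mem L).

Lemma S_subvariety W : subvariety W var_S -> variety_eq W (part_S (Lambda_of W)).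
Proof.
move=> WS M; split=> [WM|[SM HM]].
  split; first exact: WS.
  by move=> e; rewrite /= mem_filter => /andP[/asboolP We _]; case: e We => u v; apply.
have WI u v : inv u v -> identities W u v.
  by move=> /S_identities; apply: (iffLR (identities_sub _ _)).
have TW := identities_theory W; have TU := identities_theory (part_S (Lambda_of W)).
have PI u v : inv u v -> identities (part_S (Lambda_of W)) u v.
  by move=> /S_identities uv N [SN _]; exact: uv.
have PL e : e \in Lambda -> identities W e.1 e.2 ->
  identities (part_S (Lambda_of W)) e.1 e.2.
  by move=> eL eW N [_ HN] ; case: e eL eW => a b eL eW; apply: HN;
    rewrite mem_filter eL andbT; apply/asboolP.
have PW u v : identities (part_S (Lambda_of W)) u v -> identities W u v.
  move=> uv N WN; apply: uv; split; first exact: WS.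
  by move=> [a b]; rewrite mem_filter => /andP[/asboolP We _]; exact: We.
apply: birkhoff => u v uv.
suff : identities (part_S (Lambda_of W)) u v by apply; split.
(* With [one_id] the variety is trivial, the case excluded by [setting]. *)
have [one|none] := pselect (identities W one_id.1 one_id.2); last first.
  exact: (setting_eq (Setting TU TW PW PI PL none)).
have one0 := PL one_id isT one.
have nil (w : word) : identities (part_S (Lambda_of W)) w [::].
  elim: w => [|c w IH]; first exact: (th_refl TU).
  apply: (th_trans TU w) IH; inst TU [:: [:: c]] ([::] : word) w one0.
exact: (th_trans TU _ (nil u) (th_sym TU (nil v))).
Qed.

Lemma Lambda_of_eq U W : subvariety U var_S -> subvariety W var_S ->
  Lambda_of U = Lambda_of W -> variety_eq U W.
Proof.
move=> US WS e M; split=> H.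
  by apply/(S_subvariety WS); rewrite -e; apply/(S_subvariety US).
by apply/(S_subvariety US); rewrite e; apply/(S_subvariety WS).
Qed.

Lemma subvariety_small W : subvariety W var_S -> small W.
Proof.
move=> WS; pose A := {ffun 'I_(size Lambda) -> bool}.
exists #|A|, (fun i => part_S (mask (codom (enum_val i : A)) Lambda)) => U UW.
have US : subvariety U var_S by move=> M /UW /WS.
pose f : A := [ffun i => `[< identities U (tnth (in_tuple Lambda) i).1 (tnth (in_tuple Lambda) i).2 >]].
exists (enum_rank f) => M; rewrite enum_rankK.
have -> : mask (codom f) Lambda = Lambda_of U; last exact: (S_subvariety US).
rewrite /Lambda_of filter_mask; congr mask.
apply: (@eq_from_nth _ false); rewrite size_codom card_ord ?size_map // => i iL.
rewrite (nth_map one_id) // codomE (nth_map (Ordinal iL)) ?size_enum_ord // ffunE.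
by rewrite (tnth_nth one_id) /= nth_enum_ord.
Qed.

Lemma subst_id (u : word) : subst (fun z => [:: z]) u = u.
Proof. by elim: u => //= c u IH; rewrite -{2}IH. Qed.

(** * Finite generation *)

Section FreeMonoidRankThree.
Variable W : variety.
Hypothesis WS : subvariety W var_S.

Let T := identities_theory W.

Let cut (u : word) : word := filter (fun z => z < 3) u.

Let rho u v := identities W (cut u) (cut v).

Let rhoP : word_congruence rho.
Proof.
split=> [u|u v|u v w|u v u' v' uv uv'].
- exact: (th_refl T).
- exact: (th_sym T).
- exact: (th_trans T).
by rewrite /rho /cut !filter_cat; exact: (th_cat T).
Qed.

(** The relatively free monoid of [W] on the letters 0, 1, 2: all other letters are erased before
    words are compared. It generates [W] because [Lambda] uses only these three letters. *)
Definition free3 : monoidType := quotient_monoid rhoP.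

Lemma free3_in : W free3.
Proof.
apply: birkhoff => u v uv; apply/quotient_satisfies => s /=.
by apply: (th_filter T); exact: (th_subst T).
Qed.

Lemma free3_generates : variety_eq W (variety_of_monoid free3).
Proof.
have sub : subvariety (variety_of_monoid free3) W.
  by move=> M; apply=> N ->; exact: free3_in.
apply: Lambda_of_eq => //; first by move=> M /sub /WS.
apply: eq_in_filter => e eL; apply/asboolP/asboolP => H.
  by move=> M /sub; exact: H.
have cutE : cut e.1 = e.1 /\ cut e.2 = e.2.
  suff /allP/(_ e eL)/andP[/eqP-> /eqP->] :
    all (fun e => (cut e.1 == e.1) && (cut e.2 == e.2)) Lambda by [].
  by vm_compute.
case: cutE => <- <-; move/variety_of_monoid_identities: H.
move/quotient_satisfies/(_ (fun z => [:: z])); rewrite /rho /= !subst_id.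
by case: e eL.
Qed.

Let inv_tuple (u : word) (x y t : nat) : 6.-tuple bool :=
  Tuple (isT : size (inv_data u x y t) == 6).

(** The class of a word over three letters is determined by the table of [inv_data] on indices up to
    3, where 3 stands for all absent letters; [g] picks a word for each table that occurs. *)
Lemma free3_finite : finite_monoid free3.
Proof.
pose D : finType := {ffun 'I_4 * ('I_4 * 'I_4) -> 6.-tuple bool}.
pose F (w : word) : D := [ffun e : 'I_4 * ('I_4 * 'I_4) => inv_tuple w e.1 e.2.1 e.2.2].
have pickP (d : D) : exists w, (exists w', bounded 3 w' /\ F w' = d) ->
  bounded 3 w /\ F w = d.
  have [[w Hw]|H] := pselect (exists w', bounded 3 w' /\ F w' = d); first by exists w.
  by exists [::].
have [g gP] := choice pickP.
exists [seq in_quotient rhoP (g d) | d <- enum D] => a.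
rewrite -(in_quotientK (rhoP := rhoP) a); set u : word := val a.
have cu : bounded 3 (cut u) by exact: filter_all.
have [gb gF] := gP (F (cut u)) (ex_intro _ (cut u) (conj cu erefl)).
apply/mapP; exists (F (cut u)); first by rewrite mem_enum.
apply: in_quotient_eq.
have -> : rho u (g (F (cut u))) = identities W (cut u) (g (F (cut u))).
  by rewrite /rho {2}/cut; congr identities; apply/all_filterP.
apply: (iffLR (identities_sub _ _) WS); apply/S_identities.
apply: (inv_bounded cu gb) => x y t xK yK tK.
have lt z : z \in iota 0 4 -> z < 4 by rewrite mem_iota.
have := congr1 (fun f : D => val (f (Ordinal (lt x xK), (Ordinal (lt y yK), Ordinal (lt t tK))))) gF.
by rewrite !ffunE /= => ->.
Qed.
End FreeMonoidRankThree.

Lemma subvariety_finitely_generated W : subvariety W var_S -> finitely_generated W.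
Proof.
move=> WS; exists (free3 W); first exact: free3_finite.
exact: free3_generates.
Qed.

(** * Finite bases of the proper subvarieties *)

Lemma finite_short n K : exists s : seq word, forall w, size w <= n ->
  bounded K w -> w \in s.
Proof.
elim: n => [|n [s IH]].
  by exists [:: [::]] => w; rewrite leqn0 size_eq0 => /eqP->.
exists ([::] :: allpairs cons (iota 0 K) s) => -[|c w] //= wn /andP[cK wK].
rewrite in_cons /=; apply/allpairsP; exists (c, w); split=> //=; last exact: IH.
by rewrite mem_iota.
Qed.

Lemma short_dec_inv th u v : (forall u v, inv u v -> th u v) -> inv_check 6 u v ->
  th u v.
Proof. by move=> H /inv_checkP; exact: H. Qed.

Section ProperConsequences.
Variables (th : word -> word -> Prop) (T : theory th).
Hypothesis I : forall u v, inv u v -> th u v.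

Lemma Lambda0_consequence e : e \in Lambda0 -> th e.1 e.2 ->
  th alpha_id.1 alpha_id.2 \/ th phi_id.1 phi_id.2.
Proof.
rewrite !in_cons in_nil orbF => H; repeat case/orP: H => H; rewrite (eqP H) => {H e} H.
- left; have N (w : word) : th w [::].
    elim: w => [|c w IH]; first exact: (th_refl T).
    by apply: (th_trans T w) IH; inst T [:: [:: c]] ([::] : word) w H.
  exact: (th_trans T _ (N _) (th_sym T (N _))).
- left; apply: (th_trans T [:: 0; 1]).
    apply: (th_trans T [:: 0; 1; 1]).
      by apply: (th_sym T); inst T [:: [:: 0]] ([::] : word) [:: 1; 1] H.
    by apply: (th_sym T); inst T [:: [:: 1]] [:: 0] ([::] : word) H.
  by inst T [:: [:: 0; 1]] ([::] : word) ([::] : word) H.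
- by left; inst T [:: [:: 0]; [:: 1]] [:: 0] [:: 1] H.
- by left; inst T [:: [::]; [:: 1]; [:: 0]] [:: 0] ([::] : word) H.
(* With [y y] as its third letter, [beta_id] deletes the [x] before the first [y]; doubling that [y]
   is an identity of S. *)
- right; apply: (th_trans T [:: 0; 2; 0; 1; 1; 0; 1]).
    by apply: (short_dec_inv I); vm_compute.
  apply: (th_trans T [:: 0; 2; 1; 1; 0; 1]); last by apply: (short_dec_inv I);
    vm_compute.
  by inst T [:: [:: 0]; [:: 2]; [:: 1; 1]] ([::] : word) [:: 1] H.
- by right.
- by right; exact: (th_cat T (th_refl T [:: 0; 2]) H).
by left.
Qed.
End ProperConsequences.

Lemma Lambda_consequence th e : theory th -> (forall u v, inv u v -> th u v) ->
  e \in Lambda -> th e.1 e.2 ->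
  [\/ th alpha_id.1 alpha_id.2, th phi_id.1 phi_id.2 | rev_rel th phi_id.1 phi_id.2].
Proof.
move=> T I; rewrite mem_cat => /orP[eL H|/mapP[d dL ->] H].
  by have [] := Lambda0_consequence T I eL H; [constructor 1|constructor 2].
have I' u v : inv u v -> rev_rel th u v by move=> /inv_rev; exact: I.
have [H'|H'] := Lambda0_consequence (rev_theory T) I' dL H; last by constructor 3.
(* Exchanging the letters 0 and 1 turns the mirror image of [alpha_id] into [alpha_id]. *)
constructor 1; have := th_map T (fun z => 1 - z) H'; exact.
Qed.

(** By the classification a proper subvariety satisfies a member of [Lambda], hence one of three
    identities [eps]. Together with the short identities of S, [eps] yields all identities of S, and
    [Lambda_of W] then cuts out [W]. *)
Lemma proper_finitely_based W : proper_subvariety W var_S -> finitely_based W.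
Proof.
case=> WS nW; have TW := identities_theory W.
have WI u v : inv u v -> identities W u v.
  by move=> /S_identities; apply: (iffLR (identities_sub _ _)).
have [e eL eW] : exists2 e, e \in Lambda & identities W e.1 e.2.
  apply: contrapT => H; apply: nW => M; split; first exact: WS.
  move=> SM; apply/(S_subvariety WS); split=> // e; rewrite /= mem_filter.
  by case/andP=> /asboolP eW eL; case: H; exists e.
have [s sP] := finite_short short_bound short_bound.
pose shorts := [seq d <- allpairs pair s s | `[< inv d.1 d.2 >]].
have [eps epsW epsB] : exists2 eps : identity, identities W eps.1 eps.2 &
    forall th, theory th -> short_inv th -> th eps.1 eps.2 ->
      forall u v, inv u v -> th u v.
  have [H|H|H] := Lambda_consequence TW WI eL eW.
  - by exists alpha_id => // th T S; exact: alpha_basis.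
  - by exists phi_id => // th T S; exact: phi_basis.
  exists (rev_id phi_id) => // th T S H' u v uv.
  have := @phi_basis (rev_rel th) (rev_theory T) (short_inv_rev S) H' (rev u) (rev v) (inv_rev uv).
  by rewrite /rev_rel !revK.
exists (eps :: shorts ++ Lambda_of W) => M; split=> [WM d|HM].
  rewrite in_cons mem_cat => /or3P[/eqP->||].
  - by case: eps epsW {epsB} => a b; apply.
  - by rewrite mem_filter => /andP[/asboolP + _]; case: d => a b /WI; apply.
  by rewrite mem_filter => /andP[/asboolP + _]; case: d => a b; apply.
pose V := defined_within all_monoids (mem (eps :: shorts ++ Lambda_of W)).
have VM : V M by split.
apply/(S_subvariety WS); split; last first.
  by move=> d dL; apply: HM; rewrite in_cons mem_cat dL !orbT.
apply: birkhoff => u v /S_identities uv.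
suff : identities V u v by apply.
apply: (epsB _ (identities_theory V)) uv.
  move=> a b /andP[sa ba] /andP[sb bb] iab N [_ HN]; apply: HN.
  rewrite /= in_cons mem_cat mem_filter; apply/or3P; constructor 2.
  apply/andP; split; first exact/asboolP.
  by apply/allpairsP; exists (a, b); split=> //; exact: sP.
by move=> N [_ HN]; have := HN eps; rewrite mem_head => /(_ isT); case: (eps).
Qed.

(** * S is not finitely based *)

Section Deduction.
Variable Sigma : seq identity.

Definition rewrites (u v : word) : Prop := exists p q s e,
  [/\ (e \in Sigma) \/ ((e.2, e.1) \in Sigma), u = p ++ subst s e.1 ++ q &
      v = p ++ subst s e.2 ++ q].

Inductive deduces (u : word) : word -> Prop :=
| deduces_refl : deduces u u
| deduces_step v w : deduces u v -> rewrites v w -> deduces u w.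

Lemma deduces_trans u v w : deduces u v -> deduces v w -> deduces u w.
Proof. by move=> uv; elim=> // v' w' _ IH r; exact: deduces_step IH r. Qed.

Lemma deduces_sym u v : deduces u v -> deduces v u.
Proof.
elim=> [|v' w _ IH r]; first exact: deduces_refl.
apply: deduces_trans IH; apply: deduces_step (deduces_refl w) _.
case: r => p [q [s [[e1 e2] [eS -> ->]]]]; exists p, q, s, (e2, e1); split=> //=.
by case: eS; [right|left].
Qed.

Lemma deduces_ctx p q u v : deduces u v -> deduces (p ++ u ++ q) (p ++ v ++ q).
Proof.
elim=> [|v' w _ IH r]; first exact: deduces_refl.
apply: deduces_step IH _; case: r => p' [q' [s [e [eS -> ->]]]].
by exists (p ++ p'), (q' ++ q), s, e; split; rewrite // -!catA.
Qed.

Lemma deduces_congruence : word_congruence deduces.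
Proof.
split; [exact: deduces_refl|exact: deduces_sym|exact: deduces_trans|].
move=> u v u' v' uv uv'; apply: (@deduces_trans _ (v ++ u')).
  by have := deduces_ctx [::] u' uv.
by have := deduces_ctx v [::] uv'; rewrite !cats0.
Qed.

(** Completeness of equational logic: words modulo deduction form a monoid that satisfies [Sigma],
    hence lies in [V]. *)
Lemma finite_basis_deduces (V : variety) u v :
  (forall M, V M <-> forall e, e \in Sigma -> satisfies M e) ->
  identities V u v -> deduces u v.
Proof.
move=> basis uv.
have VQ : V (quotient_monoid deduces_congruence).
  apply/basis => e eS; apply/quotient_satisfies => s.
  apply: deduces_step (deduces_refl _) _; exists [::], [::], s, e.
  by split; [left| |]; rewrite ?cats0.
have := uv _ VQ; move/quotient_satisfies/(_ (fun z => [:: z])).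
by rewrite /= !subst_id.
Qed.
End Deduction.

Lemma cat_split (T : Type) (p q a b : seq T) : p ++ q = a ++ b ->
  (exists c, a = p ++ c /\ q = c ++ b) \/ (exists c, p = a ++ c /\ b = c ++ q).
Proof.
elim: p a => [|d p IH] [|f a] /=.
- by move=> ->; left; exists [::].
- by move=> ->; left; exists (f :: a).
- by move=> <-; right; exists (d :: p).
case=> -> /IH[[c [-> ->]]|[c [-> ->]]]; [left|right]; by exists c.
Qed.

Lemma cat_split_cons (T : Type) (p q a b : seq T) x : p ++ q = a ++ x :: b ->
  (exists c, p = a ++ x :: c /\ b = c ++ q) \/ (exists c, a = p ++ c /\ q = c ++ x :: b).
Proof.
case/cat_split=> [[c [-> ->]]|[[|d c] [-> /= e]]]; first by right; exists c.
  by right; exists [::]; rewrite !cats0 e.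
by case: e => -> ->; left; exists c.
Qed.

Lemma mem_subst (s : nat -> word) (u : word) z :
  (z \in subst s u) = has (fun c => z \in s c) u.
Proof. by elim: u => //= c u <-; rewrite /subst /= mem_cat. Qed.

Lemma subst_split (s : nat -> word) (u a b : word) x : subst s u = a ++ x :: b ->
  exists u1 c u2 c1 c2, [/\ u = u1 ++ c :: u2, s c = c1 ++ x :: c2,
    a = subst s u1 ++ c1 & b = c2 ++ subst s u2].
Proof.
elim: u a => [|c u IH] a /=; first by case: a.
rewrite {1}/subst /= -/(subst s u) => H.
have [[d [e1 ->]]|[d [-> /IH]]] := cat_split_cons H.
  by exists [::], c, u, a, d.
case=> u1 [c' [u2 [c1 [c2 [-> e -> ->]]]]].
by exists (c :: u1), c', u2, c1, c2; split; rewrite // /subst /= catA.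
Qed.

(* The position of g forbids c to move to the right of the last letter
   satisfying hz that stands between c and g. *)
Lemma no_crossing (hz hy : pred nat) a b b1 b2 c g : inv a b -> b = b1 ++ c :: b2 ->
  ~~ sub2 g g a -> g \in b2 -> g != c ->
  (forall a1 a2, a = a1 ++ c :: a2 -> has hz a2 || has hy a1) ->
  ~~ has hz b2 ->
  (forall a1 a2, a = a1 ++ g :: a2 -> ~~ has hy a1 /\ ~~ has hz a2) -> False.
Proof.
move=> ab eb gg gb2 gc zone zb2 gzone.
have ga : g \in a by rewrite (inv_mem ab) eb mem_cat in_cons gb2 !orbT.
have [g1 [g2 [ea gg1 gg2]]] := split_simple ga gg.
have [yg1 zg2] := gzone _ _ ea.
have cg1 : c \in g1.
  have : sub2 c g a by rewrite (inv_sub2 ab) eb !wordE gb2 !orbT.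
  rewrite ea !wordE (eq_sym c g) (negbTE gc).
  have := @sub2_memr c g g1; have := @sub2_memr c g g2.
  by move: gg1 gg2; bool_cases.
have [h1 eh] := split_last cg1; have ch2 := notin_post c g1.
set h2 := post c g1 in eh ch2.
have ea' : a = h1 ++ c :: (h2 ++ g :: g2) by rewrite ea eh -catA.
have yh1 : ~~ has hy h1 by move: yg1; rewrite eh has_cat negb_or => /andP[].
have := zone _ _ ea'; rewrite (negbTE yh1) orbF has_cat /= (negbTE zg2) orbF.
case/orP=> [/hasP[d dh2 zd]|zg]; last by case/negP: zb2; apply/hasP; exists g.
have db2 : d \notin b2 by apply: contraNN zb2 => db2; apply/hasP; exists d.
have dc : d != c by apply: contraNneq ch2 => <-.
(* In [b] some [c] lies between the last [d] and [g], in [a] none does, although [g] occurs once. *)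
have := inv_post2 ab c d gg; rewrite eb.
have gh2 : g \notin h2 by move: gg1; rewrite eh mem_cat in_cons !negb_or => /and3P[].
have dg : d != g by apply: contraNneq gh2 => <-.
have -> : sub2 c g (post d (b1 ++ c :: b2)).
  by rewrite sub2_post_cat sub2_post_cons (post_notin db2) in_cons (negbTE dc) db2 eqxx gb2 !orbT.
have -> // : sub2 c g (post d a) = false.
rewrite ea' -cat_cons catA post_cat in_cons (negbTE dg) /=.
have ngg2 : sub2 c g g2 = false by apply: contraNF gg2 => /sub2_memr.
have [dg2|dg2] := boolP (d \in g2).
  by apply: contraNF gg2 => /sub2_memr/post_sub.
have -> : post d (h1 ++ c :: h2) = post d h2 by rewrite post_cat in_cons dh2 orbT /= dh2.
have np : c \notin post d h2 by apply: contraNN ch2; exact: post_sub.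
have := @sub2_meml c g (post d h2); move: np.
by rewrite sub2_cat sub2_cons ngg2 (eq_sym c g) (negbTE gc); bool_cases.
Qed.

Lemma no_crossing_rev (hz hy : pred nat) a b b1 b2 c g : inv a b -> b = b1 ++ c :: b2 ->
  ~~ sub2 g g a -> g \in b1 -> g != c ->
  (forall a1 a2, a = a1 ++ c :: a2 -> has hz a2 || has hy a1) ->
  ~~ has hy b1 ->
  (forall a1 a2, a = a1 ++ g :: a2 -> ~~ has hy a1 /\ ~~ has hz a2) -> False.
Proof.
move=> ab eb gg gb1 gc zone yb1 gzone.
apply: (@no_crossing hy hz (rev a) (rev b) (rev b2) (rev b1) c g) => //.
- exact: inv_rev.
- by rewrite eb rev_cat rev_cons cat_rcons.
- by rewrite sub2_rev.
- by rewrite mem_rev.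
- move=> a1 a2 e; have := zone (rev a2) (rev a1).
  by rewrite !has_rev orbC; apply; rewrite -(revK a) e rev_cat rev_cons cat_rcons.
- by rewrite has_rev.
move=> a1 a2 e; have := gzone (rev a2) (rev a1); rewrite !has_rev => H.
by case: H => //; rewrite -(revK a) e rev_cat rev_cons cat_rcons.
Qed.

(** * Adjacent pairs of letters under substitution *)

Section Crossings.
Variables (l r : nat -> nat) (I : seq nat).
Hypotheses (lI : injective l) (uI : uniq I).

Definition pairs_in (w : word) : nat := count (fun i => infix [:: l i; r i] w) I.

Lemma infix2_cat i u v : infix [:: l i; r i] (u ++ v) ->
  [|| infix [:: l i; r i] u, infix [:: l i; r i] v | last 0 u == l i].
Proof.
move/infixP=> [p [q e]].
have {e} : u ++ v = p ++ [:: l i, r i & q] by [].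
case/cat_split=> [[c [_ ->]]|[[|d [|f c]] [-> /= e]]].
- by apply/or3P; constructor 2; apply/infixP; exists c, q.
- by rewrite -e; apply/or3P; constructor 2; apply/infixP; exists [::], q.
- by case: e => <- _; rewrite last_cat /= eqxx !orbT.
by case: e => <- <- _; apply/or3P; constructor 1; apply/infixP; exists p, c.
Qed.

(** A pair straddling the cut has the last letter of [u] as its [l i], which determines [i] by
    injectivity. *)
Lemma pairs_in_cat u v : pairs_in (u ++ v) <= pairs_in u + pairs_in v + 1.
Proof.
have cle (P Q : pred nat) : count (predU P Q) I <= count P I + count Q I.
  by rewrite -count_predUI leq_addr.
apply: (@leq_trans (count (predU (predU (fun i => infix [:: l i; r i] u)
   (fun i => infix [:: l i; r i] v)) (fun i => last 0 u == l i)) I)).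
  by apply: sub_count => i /infix2_cat /or3P[] H /=; rewrite H ?orbT.
apply: (leq_trans (cle _ _)); apply: leq_add; first exact: cle.
rewrite (eq_count (a2 := preim l (pred1 (last 0 u)))); last by move=> i /=;
  rewrite eq_sym.
by rewrite -count_map count_uniq_mem ?leq_b1 // map_inj_uniq.
Qed.

Lemma pairs_in_subst (s : nat -> word) u :
  (forall c i, c \in u -> i \in I -> ~~ infix [:: l i; r i] (s c)) ->
  pairs_in (subst s u) <= size u.
Proof.
elim: u => [|c u IH] H.
  by rewrite /pairs_in leqn0 eqn0Ngt -has_count; apply/hasPn.
rewrite /subst /= -/(subst s u); apply: (leq_trans (pairs_in_cat _ _)).
have -> : pairs_in (s c) = 0.
  by apply/eqP; rewrite /pairs_in eqn0Ngt -has_count; apply/hasPn => i iI;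
    apply: H => //; exact: mem_head.
by rewrite add0n addn1 ltnS; apply: IH => d i du; apply: H; rewrite in_cons du orbT.
Qed.
End Crossings.

Section Separation.
Variables (x z y : nat) (l r : nat -> nat) (I : seq nat).
Hypotheses (lI : injective l) (uI : uniq I).

(** No [x] stands after the last [z] and before the first [y]. With the first [z_i] and the last
    [y_i] in these roles, this holds for [uword n] and fails for [vword n]. *)
Definition separated (w : word) : Prop :=
  forall A B, w = A ++ x :: B -> (z \in B) || (y \in A).

(** An [x] newly in the forbidden zone comes from the image of a letter [c] of [b]. If [c] occurs
    once, scattered pairs fix its position. Otherwise its first and last occurrences show that the
    image of [a] contains [z] and [y], so no pair [l i], [r i] is a factor of [p] or [q]. As [a] is
    too short to cut all pairs apart, the image of some letter [g] contains a whole pair; such a [g]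
    occurs once, and [c] cannot cross it. *)
Lemma separated_step p q s a b : inv a b -> size a + 2 < size I ->
  let w := p ++ subst s a ++ q in
  (forall i, i \in I -> [/\ infix [:: l i; r i] w, ~~ sub2 (r i) (l i) w,
                            ~~ sub2 (r i) z w & ~~ sub2 y (l i) w]) ->
  separated w -> separated (p ++ subst s b ++ q).
Proof.
move=> ab aI w HI sw A B e; apply/negPn/negP; rewrite negb_or => /andP[zB yA].
have memS d : (d \in subst s a) = (d \in subst s b).
  by rewrite !mem_subst; apply: eq_has_r; exact: (inv_mem ab).
case: (cat_split_cons e) => [[c [ep eB]]|[A' [eA e2]]].
  have := sw A (c ++ subst s a ++ q).
  rewrite /w ep -catA => /(_ erefl); rewrite (negbTE yA) orbF.
  by move: zB; rewrite eB !mem_cat memS => /negbTE->.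
case: (cat_split_cons e2) => [[B' [eS eB]]|[c [eA' eq]]]; last first.
  have := sw (p ++ subst s a ++ c) B; rewrite /w eq -!catA => /(_ erefl).
  by rewrite (negbTE zB) /= !mem_cat memS; move: yA;
    rewrite eA eA' !mem_cat => /negbTE->.
have [b1 [c [b2 [c1 [c2 [eb ec eA' eB']]]]]] := subst_split eS.
move: yA zB; rewrite eA eB eA' eB' !mem_cat !mem_subst !negb_or.
set hz := fun d => z \in s d; set hy := fun d => y \in s d.
case/and3P=> yp yb1 yc1 /andP[/andP[zc2 zb2] zq].
have zone a1 a2 : a = a1 ++ c :: a2 -> has hz a2 || has hy a1.
  move=> ea; have := sw (p ++ subst s a1 ++ c1) (c2 ++ subst s a2 ++ q).
  rewrite /w ea subst_cat -cat1s subst_cat {2}/subst /= ec cats0 -!catA /= => /(_ erefl).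
  by rewrite !mem_cat !mem_subst (negbTE zc2) (negbTE zq) (negbTE yp) (negbTE yc1) /= !orbF.
have ca : c \in a by rewrite (inv_mem ab) eb mem_cat mem_head orbT.
have [cc|cc] := boolP (sub2 c c a); last first.
  have [a1 [a2 [ea ca1 ca2]]] := split_simple ca cc.
  have := cc; rewrite (inv_sub2 ab) eb => /simple_notin/andP[cb1 cb2].
  case/orP: (zone _ _ ea) => /hasP[d da hd].
    have : sub2 c d b by rewrite -(inv_sub2 ab) ea !wordE da !orbT.
    rewrite eb !wordE (negbTE cb1) /= => H.
    have db2 : d \in b2.
      have := @sub2_meml c d b1; have := @sub2_meml c d b2; move: H cb1 cb2; bool_cases.
    by case/negP: zb2; apply/hasP; exists d.
  have dc : d != c by apply: contraNneq ca1 => <-.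
  have : sub2 d c b by rewrite -(inv_sub2 ab) ea !wordE da !orbT.
  rewrite eb !wordE => H; have db1 : d \in b1.
    have := @sub2_memr d c b1; have := @sub2_memr d c b2; move: H dc cb1 cb2;
      bool_cases.
  by case/negP: yb1; apply/hasP; exists d.
(* c occurs in a both to the left of all r i and to the right of all l i. *)
have zS : z \in subst s a.
  have [a2 ea] := split_first ca; case/orP: (zone _ _ ea) => [|/hasP[d da hd]].
    by rewrite mem_subst {1}ea has_cat /= => ->; rewrite !orbT.
  have : d \in b1.
    have := inv_pre ab d c; rewrite da => /esym;
      rewrite eb mem_pre_cat mem_pre_cons eqxx andbF orbF.
    exact: pre_sub.
  by move=> db1; case/negP: yb1; apply/hasP; exists d.
have yS : y \in subst s a.
  have [a1 ea] := split_last ca; case/orP: (zone _ _ ea) => [/hasP[d da hd]|];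
    last first.
    by rewrite mem_subst {1}ea has_cat /= => ->.
  have : d \in b2.
    have := inv_post ab d c; rewrite da => /esym;
      rewrite eb mem_post_cat mem_post_cons in_cons eqxx /= !andbF !orbF.
    exact: post_sub.
  by move=> db2; case/negP: zb2; apply/hasP; exists d.
have pp : pairs_in l r I p = 0.
  apply/eqP; rewrite eqn0Ngt -has_count; apply/hasPn => i /HI[_ _ rz _].
  apply: contraNN rz => /mem_infix H; rewrite /w sub2_cat mem_cat zS H ?orbT //.
  by rewrite !inE eqxx orbT.
have pq : pairs_in l r I q = 0.
  apply/eqP; rewrite eqn0Ngt -has_count; apply/hasPn => i /HI[_ _ _ yl].
  apply: contraNN yl => /mem_infix H; rewrite /w !sub2_cat yS H ?orbT //.
  by rewrite !inE eqxx.
have [g ga [i iI ig]] : exists2 g, g \in a & exists2 i, i \in I & infix [:: l i;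
  r i] (s g).
  apply: contrapT => H.
  have Hs : pairs_in l r I (subst s a) <= size a.
    by apply: pairs_in_subst => // g i ga iI; apply/negP => ig; apply: H;
      exists g => //; exists i.
  have pw : pairs_in l r I w = size I.
    by apply/eqP; rewrite -all_count; apply/allP => i /HI[].
  have h1 : pairs_in l r I w <= pairs_in l r I p + pairs_in l r I (subst s a ++ q) + 1.
    exact: pairs_in_cat.
  have h2 : pairs_in l r I (subst s a ++ q) <= pairs_in l r I (subst s a) + pairs_in l r I q + 1.
    exact: pairs_in_cat.
  (* The 2 in the hypothesis on [size a] pays for the cuts at the two ends of the substituted
     part. *)
  move: h1 h2 Hs aI; rewrite pw pp pq.
  by move: (pairs_in _ _ _ _) (pairs_in _ _ _ _) (size a) (size I); clear; lia.
have [_ rl rz yl] := HI i iI.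
have [lg rg] : l i \in s g /\ r i \in s g.
  by split; apply: (mem_infix ig); rewrite !inE eqxx ?orbT.
have gg : ~~ sub2 g g a.
  apply: contraNN rl => /sub2_split[g1 [g2 [g3 ea]]]; rewrite /w ea.
  rewrite subst_cat -cat1s subst_cat subst_cat -(cat1s g) subst_cat /subst /= !cats0.
  by rewrite !(sub2_cat, mem_cat) lg rg !orbT.
have gc : g != c by apply: contraNneq gg => ->.
have gzone a1 a2 : a = a1 ++ g :: a2 -> ~~ has hy a1 /\ ~~ has hz a2.
  move=> ea; split.
    apply: contraNN yl => H; rewrite /w ea subst_cat -cat1s subst_cat {2}/subst /= cats0.
    by rewrite !(sub2_cat, mem_cat) (mem_subst s a1) H lg !orbT.
  apply: contraNN rz => H; rewrite /w ea subst_cat -cat1s subst_cat {2}/subst /= cats0.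
  by rewrite !(sub2_cat, mem_cat) (mem_subst s a2) H rg !orbT.
have : g \in b by rewrite -(inv_mem ab).
rewrite eb mem_cat in_cons (negbTE gc) => /orP[gb1|gb2].
  exact: (no_crossing_rev ab eb gg gb1 gc zone yb1 gzone).
exact: (no_crossing ab eb gg gb2 gc zone zb2 gzone).
Qed.
End Separation.

(* [uword n] is z_1 ... z_n t x z_1 y_1 ... z_n y_n x s y_1 ... y_n, where x, t
   and s are the letters 0, 1 and 2; [vword n] has a third x after the second
   occurrence of z_1. *)
Definition zlet (i : nat) : nat := (2 * i).+3.
Definition ylet (i : nat) : nat := (2 * i).+4.

Definition zy (l : seq nat) : word := flatten [seq [:: zlet i; ylet i] | i <- l].

Definition uword (n : nat) : word :=
  map zlet (iota 0 n) ++ 1 :: 0 :: zy (iota 0 n) ++ 0 :: 2 :: map ylet (iota 0 n).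

(** The cut is between the last [zlet i] and the first [ylet i], so the two parts are [pre (ylet i)]
    and [post (zlet i)] of [uword n]. *)
Definition uleft (n i : nat) : word :=
  map zlet (iota 0 n) ++ 1 :: 0 :: zy (iota 0 i) ++ [:: zlet i].
Definition uright (n i : nat) : word :=
  ylet i :: zy (iota i.+1 (n - i.+1)) ++ 0 :: 2 :: map ylet (iota 0 n).

Definition vword (n : nat) : word := uleft n 0 ++ 0 :: uright n 0.

Lemma Z_inj : injective zlet. Proof. by rewrite /zlet => i j; lia. Qed.
Lemma Y_inj : injective ylet. Proof. by rewrite /ylet => i j; lia. Qed.
Lemma ZY i j : (zlet i == ylet j) = false. Proof. by apply/eqP;
  rewrite /zlet /ylet; lia. Qed.
Lemma YZ i j : (ylet i == zlet j) = false. Proof. by rewrite eq_sym ZY. Qed.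

Lemma zy_cat k l : zy (k ++ l) = zy k ++ zy l.
Proof. by rewrite /zy map_cat flatten_cat. Qed.

Lemma Z_zy j l : (zlet j \in zy l) = (j \in l).
Proof.
elim: l => //= i l IH; rewrite /zy /= !in_cons ZY (inj_eq Z_inj) /=.
by rewrite -IH.
Qed.

Lemma Y_zy j l : (ylet j \in zy l) = (j \in l).
Proof.
elim: l => //= i l IH; rewrite /zy /= !in_cons YZ (inj_eq Y_inj) /=.
by rewrite -IH.
Qed.

Lemma small_zy c l : c < 3 -> (c \in zy l) = false.
Proof.
move=> c3; elim: l => //= i l IH; rewrite /zy /= !in_cons -/(zy l) IH /zlet /ylet.
by apply/negbTE; move: c3; clear; lia.
Qed.

Lemma Z_mapZ j l : (zlet j \in map zlet l) = (j \in l). Proof. exact: (mem_map Z_inj). Qed.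
Lemma Y_mapY j l : (ylet j \in map ylet l) = (j \in l). Proof. exact: (mem_map Y_inj). Qed.
Lemma Y_mapZ j l : (ylet j \in map zlet l) = false.
Proof. by apply/negbTE/mapP => -[i _ /eqP]; rewrite YZ. Qed.
Lemma Z_mapY j l : (zlet j \in map ylet l) = false.
Proof. by apply/negbTE/mapP => -[i _ /eqP]; rewrite ZY. Qed.
Lemma small_mapZ c l : c < 3 -> (c \in map zlet l) = false.
Proof. by move=> c3; apply/negbTE/mapP => -[i _]; rewrite /zlet; move: c3; clear;
  lia. Qed.
Lemma small_mapY c l : c < 3 -> (c \in map ylet l) = false.
Proof. by move=> c3; apply/negbTE/mapP => -[i _]; rewrite /ylet; move: c3; clear;
  lia. Qed.

Lemma small_Z i : ((0 == zlet i) = false) * ((1 == zlet i) = false) * ((2 == zlet i) = false).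
Proof. by []. Qed.
Lemma small_Y i : ((0 == ylet i) = false) * ((1 == ylet i) = false) * ((2 == ylet i) = false).
Proof. by []. Qed.
Lemma Z_small i : ((zlet i == 0) = false) * ((zlet i == 1) = false) * ((zlet i == 2) = false).
Proof. by []. Qed.
Lemma Y_small i : ((ylet i == 0) = false) * ((ylet i == 1) = false) * ((ylet i == 2) = false).
Proof. by []. Qed.

Definition ltrE := (mem_cat, in_cons, in_nil, Z_zy, Y_zy, Z_mapZ, Y_mapY, Y_mapZ,
  Z_mapY, ZY, YZ, small_Z, small_Y, Z_small, Y_small, inj_eq Z_inj, inj_eq Y_inj,
  (@small_zy 0, @small_zy 1, @small_zy 2, @small_mapZ 0, @small_mapZ 1, @small_mapZ 2),
  (@small_mapY 0, @small_mapY 1, @small_mapY 2), mem_iota).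

Lemma U_split n i : i < n -> uword n = uleft n i ++ uright n i.
Proof.
move=> iN; have e : iota 0 n = iota 0 i ++ i :: iota i.+1 (n - i.+1).
  have {1}-> : n = i + (n - i.+1).+1 by move: iN; clear; lia.
  by rewrite iotaD.
by rewrite /uword {2}e zy_cat /uleft /uright /= -!catA /= -!catA.
Qed.

Section CriticalWord.
Variable n : nat.

Lemma small_simple_U c : (c == 1) || (c == 2) -> ~~ sub2 c c (uword n).
Proof.
case/orP=> /eqP->; rewrite sub2_count /uword !count_cat /= !count_cat /=.
  by rewrite !(count_memPn _) //; apply/negP; rewrite !ltrE.
by rewrite !(count_memPn _) //; apply/negP; rewrite !ltrE.
Qed.

Lemma pre_Y_U i : i < n -> pre (ylet i) (uword n) = uleft n i.
Proof.
move=> iN; rewrite (U_split iN) pre_cat.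
have -> : (ylet i \in uleft n i) = false.
  by rewrite /uleft !ltrE /= ltnn; rewrite /ylet.
by rewrite /uright /= eqxx cats0.
Qed.

Lemma post_Z_U i : i < n -> post (zlet i) (uword n) = uright n i.
Proof.
move=> iN; rewrite (U_split iN) post_cat.
have -> : (zlet i \in uright n i) = false.
  by rewrite /uright !ltrE /= ltnn; rewrite /zlet.
have -> : uleft n i = (map zlet (iota 0 n) ++ 1 :: 0 :: zy (iota 0 i)) ++ [:: zlet i].
  by rewrite -catA.
by rewrite post_cat mem_head /= eqxx.
Qed.

Variable w : word.
Hypothesis Uw : inv (uword n) w.

Lemma YZ_order i j : i < n -> j <= i -> ~~ sub2 (ylet i) (zlet j) w.
Proof.
move=> iN ji; rewrite -(inv_sub2 Uw) (U_split iN) sub2_cat.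
have yl : ylet i \notin uleft n i by rewrite -(pre_Y_U iN) notin_pre.
have zr : zlet j \notin uright n i.
  by rewrite /uright !ltrE /=; move: ji; rewrite /zlet; clear; lia.
have := @sub2_meml (ylet i) (zlet j) (uleft n i);
  have := @sub2_memr (ylet i) (zlet j) (uright n i).
by move: yl zr; bool_cases.
Qed.

(** A letter between the last [z_i] and the first [y_i] of [w] would be some [z_j] with [j > i],
    some [y_j] with [j < i], or [x]. The first is excluded by the block between [t] and the first
    [y_i], the second by the block between the last [z_i] and [s], the third by separation, as [i]
    is neither 0 nor [n.-1]. *)
Lemma separated_infix i : separated 0 (zlet 0) (ylet n.-1) w -> 0 < i -> i < n.-1 ->
  infix [:: zlet i; ylet i] w.
Proof.
move=> sw i0 i1; have iN : i < n by move: i1; clear; lia.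
have Zw : zlet i \in w by rewrite -(inv_mem Uw) (U_split iN) /uleft !ltrE iN.
have Yw : ylet i \in w by rewrite -(inv_mem Uw) (U_split iN) /uright !ltrE eqxx orbT.
have [a ea] := split_last Zw; have Zc := notin_post (zlet i) w.
set c := post (zlet i) w in ea Zc.
have Ya : ylet i \notin a.
  by apply: contraNN (YZ_order iN (leqnn i)) => Ya;
    rewrite ea sub2_cat Ya mem_head !orbT.
have Yc : ylet i \in c by move: Yw; rewrite ea !ltrE (negbTE Ya).
have [b eb] := split_first Yc; have Ym := notin_pre (ylet i) c.
set m := pre (ylet i) c in eb Ym.
have ew : w = (a ++ zlet i :: m) ++ ylet i :: b by rewrite ea eb -catA.
have prew : pre (ylet i) w = a ++ zlet i :: m.
  rewrite ew pre_cat !ltrE (negbTE Ya) (negbTE Ym) /= eqxx cats0 //.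
have postw : post (zlet i) w = m ++ ylet i :: b by rewrite -eb.
suff m0 : m = [::] by rewrite ew m0 -catA; apply/infixP; exists a, b.
case em : m => [|f m'] //; exfalso.
have fm : f \in m by rewrite em mem_head.
have fpre : f \in uleft n i by rewrite -(pre_Y_U iN) (inv_pre Uw) prew !ltrE fm !orbT.
have fpost : f \in uright n i by rewrite -(post_Z_U iN) (inv_post Uw) postw mem_cat fm.
have tpre : 1 \in a.
  have : 1 \in pre (ylet i) w by rewrite -(inv_pre Uw) pre_Y_U // /uleft !ltrE.
  have : 1 \notin post (zlet i) w by rewrite -(inv_post Uw) post_Z_U // /uright !ltrE.
  by rewrite prew postw !ltrE; bool_cases.
have sb : 2 \in b.
  have : 2 \in post (zlet i) w by rewrite -(inv_post Uw) post_Z_U // /uright !ltrE.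
  have : 2 \notin pre (ylet i) w by rewrite -(inv_pre Uw) pre_Y_U // /uleft !ltrE.
  by rewrite prew postw !ltrE; bool_cases.
have simw d : (d == 1) || (d == 2) -> ~~ sub2 d d (uword n) by exact: small_simple_U.
have fZ j : f = zlet j -> False.
  move=> ef; have jn : i < j.
    move: fpost; rewrite ef /uright !ltrE /=; clear; lia.
  have := inv_pre2 Uw (zlet j) (ylet i) (simw 1 isT).
  rewrite pre_Y_U // prew sub2_cat in_cons -ef fm tpre !orbT ef => /eqP.
  have zl : zlet j \notin 0 :: zy (iota 0 i) ++ [:: zlet i].
    by rewrite !ltrE /=; move: jn; clear; lia.
  have := @sub2_memr 1 (zlet j) (0 :: zy (iota 0 i) ++ [:: zlet i]).
  have := @sub2_meml 1 (zlet j) (map zlet (iota 0 n)).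
  rewrite /uleft sub2_cat (sub2_cons 1 _ 1) !small_mapZ // eqxx.
  by move: zl; bool_cases.
have fY j : f = ylet j -> False.
  move=> ef; have jn : j < i.
    by move: fpre; rewrite ef /uleft !ltrE /=; clear; lia.
  have := inv_post2 Uw (ylet j) (zlet i) (simw 2 isT).
  rewrite post_Z_U // postw sub2_cat in_cons -ef fm sb !orbT ef => /eqP.
  have yr : ylet j \notin ylet i :: zy (iota i.+1 (n - i.+1)) ++ [:: 0].
    by rewrite !ltrE /=; move: jn; clear; lia.
  have -> : uright n i = (ylet i :: zy (iota i.+1 (n - i.+1)) ++ [:: 0]) ++ 2 :: map ylet (iota 0 n).
    by rewrite /uright /= -catA.
  have := @sub2_meml (ylet j) 2 (ylet i :: zy (iota i.+1 (n - i.+1)) ++ [:: 0]).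
  have := @sub2_memr (ylet j) 2 (map ylet (iota 0 n)).
  rewrite sub2_cat (sub2_cons _ _ 2) Y_small small_mapY //.
  by move: yr; bool_cases.
move: fpre; rewrite /uleft mem_cat !in_cons mem_cat in_cons in_nil orbF.
case/or4P=> [/mapP[j _ /fZ]|/eqP ef|/eqP ef|/orP[|/eqP/fZ]] //.
- by move: fpost; rewrite ef /uright !ltrE.
- have [m1 em1] : exists m1, m = 0 :: m1 by exists m'; rewrite em ef.
  have := sw (a ++ [:: zlet i]) (m1 ++ ylet i :: b);
    rewrite ew em1 -!catA => /(_ erefl).
  case/orP=> H.
    have : zlet 0 \in post (zlet i) w by rewrite postw em1 /= in_cons H orbT.
    by rewrite -(inv_post Uw) post_Z_U // /uright !ltrE.
  have : ylet n.-1 \in pre (ylet i) w by rewrite prew -cat1s catA mem_cat H.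
  rewrite -(inv_pre Uw) pre_Y_U // /uleft !ltrE /=.
  by move: i1; clear; lia.
by case/flattenP=> k /mapP[j _ ->]; rewrite !inE => /orP[/eqP/fZ|/eqP/fY].
Qed.
End CriticalWord.

Lemma simple_U n c : c \in uword n -> ~~ sub2 c c (uword n) -> (c == 1) || (c == 2).
Proof.
have mZ j : j \in iota 0 n -> sub2 (zlet j) (zlet j) (uword n).
  by move=> jn; rewrite /uword sub2_cat Z_mapZ jn !in_cons mem_cat Z_zy jn !orbT.
have mY j : j \in iota 0 n -> sub2 (ylet j) (ylet j) (uword n).
  move=> jn; rewrite /uword sub2_cat !sub2_cons sub2_cat Y_zy jn.
  by rewrite !in_cons Y_mapY jn !orbT.
have m0 : sub2 0 0 (uword n) by rewrite /uword sub2_cat sub2_cons sub2_cons !in_cons mem_cat mem_head !orbT.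
rewrite {1}/uword mem_cat !in_cons mem_cat !in_cons => /or4P[/mapP[j /mZ jn ->]|->//|/eqP->|].
- by rewrite jn.
- by rewrite m0.
case/or4P=> [/flattenP[k /mapP[j jn ->]]|/eqP->|->|/mapP[j /mY jn ->]];
  rewrite ?orbT ?m0 ?jn //.
by rewrite !inE => /orP[] /eqP->; rewrite ?mZ ?mY.
Qed.

(** Only [t] and [s] occur once, and in [uword n] an [x] already stands between [t] and the gap and
    between the gap and [s]. *)
Lemma inv_U_V n : 1 < n -> inv (uword n) (vword n).
Proof.
move=> n2; have n0 : 0 < n by move: n2; clear; lia.
have xl : 0 \in uleft n 0 by rewrite /uleft !ltrE.
have xr : 0 \in uright n 0 by rewrite /uright !ltrE.
have e := U_split n0; rewrite e.
apply: inv_insert => // c d; rewrite -e => cs cin _; apply/orP; left.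
  have cU : c \in uword n by rewrite e mem_cat cin.
  case/orP: (simple_U cU cs) => /eqP ec; move: cin; rewrite ec /uleft ?ltrE //.
  by rewrite sub2_cat sub2_cons in_cons eqxx !orbT.
have cU : c \in uword n by rewrite e mem_cat cin orbT.
case/orP: (simple_U cU cs) => /eqP ec; move: cin; rewrite ec /uright ?ltrE //.
by rewrite sub2_cons sub2_cat sub2_cons in_cons eqxx !orbT.
Qed.

Lemma separated_U n : 0 < n -> separated 0 (zlet 0) (ylet n.-1) (uword n).
Proof.
move=> n0 A B eU; have [[c [e _]]|[c [-> e]]] := cat_split_cons eU.
  have : 0 \in map zlet (iota 0 n) by rewrite e mem_cat mem_head orbT.
  by rewrite small_mapZ.
case: c e => [|c1 [|c2 c]] //= [].
  by move=> _ <-; rewrite mem_cat Z_zy mem_iota n0.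
move=> _ _ e'; have [[d [e _]]|[d [-> _]]] := cat_split_cons e'.
  have : 0 \in zy (iota 0 n) by rewrite e mem_cat mem_head orbT.
  by rewrite small_zy.
by rewrite mem_cat !in_cons mem_cat Y_zy mem_iota /= prednK // leqnn !orbT.
Qed.

Lemma not_separated_V n : 1 < n -> ~ separated 0 (zlet 0) (ylet n.-1) (vword n).
Proof.
move=> n2 /(_ (uleft n 0) (uright n 0) erefl).
by rewrite /uleft /uright !ltrE /=; move: n2; clear; lia.
Qed.

Lemma S_not_finitely_based : ~ finitely_based var_S.
Proof.
case=> Sigma basis; pose k := sumn (map (fun e : identity => size e.1 + size e.2) Sigma).
(* This leaves [n - 2 = k + 4] inner pairs, more than the [k + 2] that an identity with sides of
   length at most [k] could cope with. *)
pose n := k + 6; have n2 : 1 < n by rewrite /n; clear; lia.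
have sizeS e : e \in Sigma -> size e.1 + size e.2 <= k.
  rewrite /k; elim: Sigma {basis k n n2} => //= d S IH; rewrite in_cons.
  by case/orP=> [/eqP->|/IH H]; [exact: leq_addr|exact: leq_trans H (leq_addl _ _)].
have invS e : e \in Sigma -> inv e.1 e.2.
  move=> eS; apply/S_identities => M /basis /(_ e eS); by case: e {eS}.
have UV : deduces Sigma (uword n) (vword n).
  by apply: (finite_basis_deduces basis); apply/S_identities; exact: inv_U_V.
(* Both properties pass along a deduction; together they make [separated_infix] available at every
   step. *)
suff [_] : inv (uword n) (vword n) /\ separated 0 (zlet 0) (ylet n.-1) (vword n) by exact: not_separated_V.
elim: UV => [|v w _ [iv sv] [p [q [s [e [eS ev ew]]]]]].
  by split; [exact: (th_refl inv_theory)|apply: separated_U; move: n2; clear; lia].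
have [ie ek] : inv e.1 e.2 /\ size e.1 <= k.
  case: eS => eS; have := sizeS _ eS; have := invS _ eS => /= H1 H2; split=> //.
  - exact: leq_trans (leq_addr _ _) H2.
  - exact: (th_sym inv_theory).
  exact: leq_trans (leq_addl _ _) H2.
have vw : inv v w by rewrite ev ew; apply: (th_ctx inv_theory);
  exact: (th_subst inv_theory).
split; first exact: (th_trans inv_theory v).
rewrite ev in iv sv; rewrite ew.
apply: (@separated_step 0 (zlet 0) (ylet n.-1) zlet ylet (iota 1 (n - 2)) Z_inj (iota_uniq _ _) p q s e.1 e.2) => //.
  have arith m K : m <= K -> m + 2 < K + 6 - 2 by clear; lia.
  by rewrite size_iota; exact: arith.
move=> i; rewrite mem_iota => /andP[i1 i2].
have [j1 [j2 j3]] : i < n.-1 /\ (i < n /\ n.-1 < n) 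
  by move: (n) i1 i2 n2 => N; clear; lia.
split.
- exact: (separated_infix iv sv i1 j1).
- exact: (YZ_order iv j2 (leqnn i)).
- exact: (YZ_order iv j2 (leq0n i)).
by apply: (YZ_order iv j3); exact: ltnW.
Qed.


Theorem proposition3p26 :
  ~ finitely_based var_S /\ finitely_generated var_S /\ almost_cross var_S.
Proof.
split; first exact: S_not_finitely_based.
split; first exact: subvariety_finitely_generated.
split; first by case=> fb _ _; exact: S_not_finitely_based.
move=> W pW; have [WS _] := pW; split.
- exact: proper_finitely_based.
- exact: subvariety_finitely_generated.
exact: subvariety_small.
Qed.
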